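(* Let $(\Omega,\mathcal F,P)$ be a probability space with a filtration $(\mathcal F_t)_{t=0}^T$ such that every set in $\mathcal F_0$ has probability zero or one. For $t=0,\dots,T-1$, let $L_t:\mathbb R^N\times\mathbb R^{M^b}\times\mathbb R^{M^a}\times\Omega\to\overline{\mathbb R}$ be an $\mathcal F_{t+1}$-measurable lower bounded convex normal integrand, let $J:\mathbb R^N\times\Omega\to\overline{\mathbb R}$ be an $\mathcal F_T$-measurable lower bounded convex normal integrand, and let $$F_t(x,u^b,u^a,\omega)=A_{t+1}(\omega)x+B^b_{t+1}(\omega)u^b+B^a_{t+1}(\omega)u^a+W_{t+1}(\omega),$$ where $A_{t+1},B^b_{t+1},B^a_{t+1}$ are $\mathcal F_{t+1}$-measurable random matrices of appropriate dimensions and $W_{t+1}$ is an $\mathcal F_{t+1}$-measurable random vector in $\mathbb R^N$. Consider the problem $$(\mathrm{OC})\quad \text{minimize } E\Big[\sum_{t=0}^{T-1}L_t(X_t,U^b_t,U^a_{t+1})+J(X_T)\Big]\ \text{ over } (X,U^b,U^a)\in\mathcal N$$ $$\text{subject to } X_{t+1}=F_t(X_t,U^b_t,U^a_{t+1}),\quad t=0,\dots,T-1,\ \text{a.s.}$$ Assume that the set $$\Big\{(X,U^b,U^a)\in\mathcal N\ \Big|\ \sum_{t=0}^{T-1}L_t^\infty(X_t,U^b_t,U^a_{t+1})+J^\infty(X_T)\le 0,\ X_t=A_tX_{t-1}+B^b_tU^b_{t-1}+B^a_tU^a_t,\ t=1,\dots,T,\ \text{a.s.}\Big\}$$ is a linear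 space. Then (OC) has a solution $(\bar X,\bar U^b,\bar U^a)\in\mathcal N$, and the Bellman equations for (OC) have a unique lower bounded convex normal solution $((J_t)_{t=0}^T,(\tilde Q_t)_{t=0}^{T-1})$.
   Context: $\overline{\mathbb R}=[-\infty,+\infty]$. A function $h:\mathbb R^n\times\Omega\to\overline{\mathbb R}$ is a ($\mathcal G$-measurable) normal integrand if $\omega\mapsto\operatorname{epi}h(\cdot,\omega)$ is a closed-valued ($\mathcal G$-)measurable set-valued mapping, i.e. $\{\omega\mid \operatorname{epi}h(\cdot,\omega)\cap O\ne\emptyset\}$ is measurable for every open $O\subset\mathbb R^{n}\times\mathbb R$; it is convex if $h(\cdot,\omega)$ is convex for each $\omega$. It is lower bounded if there is $m\in L^1$ with $h(x,\omega)\ge m(\omega)$ for all $x\in\mathbb R^n$ and almost every $\omega$. For a random variable $x$, $h(x)$ denotes $\omega\mapsto h(x(\omega),\omega)$; the argument $\omega$ is often suppressed. For a sub-$\sigma$-algebra $\mathcal G\subset\mathcal F$, the $\mathcal G$-conditional expectation $E^{\mathcal G}h$ of a lower bounded normal integrand $h$ is the ($\mathcal G$-measurable, a.s. unique) normal integrand such that $(E^{\mathcal G}h)(x)=E[h(x)\mid\mathcal G]$ a.s. for every $\mathcal G$-measurable $\mathbb R^n$-valued random variable $x$. $E_t:=E^{\mathcal F_t}$. $\mathcal N$ is the space of adapted processes $(X_t,U^b_t,U^a_t)_{t=0}^T$, i.e. $(X_t,U^b_t,U^a_t)$ is $\mathcal F_t$-measurable with values in $\mathbb R^N\times\mathbb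 R^{M^b}\times\mathbb R^{M^a}$ for each $t$ (no integrability is required). For a lower semicontinuous convex $g:\mathbb R^n\to\overline{\mathbb R}$, the recession function is $g^\infty(x)=\lim_{\alpha\to\infty}\frac{g(\bar x+\alpha x)-g(\bar x)}{\alpha}$ for any $\bar x\in\operatorname{dom}g$ (whenever $g^\infty$ is written, $\operatorname{dom} g\neq\emptyset$ is understood). For a convex normal integrand, $h^\infty(\cdot,\omega)$ is the recession function of $h(\cdot,\omega)$. Sequences $(J_t)_{t=0}^T$, $(\tilde Q_t)_{t=0}^{T-1}$ of normal integrands on $\mathbb R^N\times\Omega$ and $\mathbb R^N\times\mathbb R^{M^b}\times\Omega$ are a normal solution of the Bellman equations for (OC) if, for almost every $\omega$, $J_T(\cdot,\omega)=J(\cdot,\omega)$ and, for all $t=0,\dots,T-1$, $x\in\mathbb R^N$, $u^b\in\mathbb R^{M^b}$, $$\tilde Q_t(x,u^b,\omega)=\inf_{u^a\in\mathbb R^{M^a}}\{L_t(x,u^b,u^a,\omega)+J_{t+1}(F_t(x,u^b,u^a,\omega),\omega)\},\qquad J_t(x,\omega)=\inf_{u^b\in\mathbb R^{M^b}}(E_t\tilde Q_t)(x,u^b,\omega).$$ The solution is lower bounded/convex if all $J_t$ and $\tilde Q_t$ are. Uniqueness is up to equality of the functions $J_t(\cdot,\omega)$, $\tilde Q_t(\cdot,\omega)$ for almost every $\omega$. A solution of (OC) is a feasible point attaining the infimum. *)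

(* Defs.v *)
From HB Require Import structures.
From mathcomp Require Import all_boot all_order all_algebra.
From mathcomp Require Import all_classical all_reals all_analysis.

Set Implicit Arguments.
Unset Strict Implicit.
Unset Printing Implicit Defensive.

Import Order.TTheory GRing.Theory Num.Theory.
Import numFieldNormedType.Exports.

Local Open Scope classical_set_scope.
Local Open Scope ring_scope.
Local Open Scope ereal_scope.

Definition dom {R : realType} {V : Type} (g : V -> \bar R) : set V :=
  [set x | g x < +oo].

Definition epi {R : realType} {V : Type} (g : V -> \bar R) : set (V * R^o) :=
  [set p | g p.1 <= (p.2)%:E].

Section convex_analysis.
Context {R : realType} {V : lmodType R}.
Implicit Types g : V -> \bar R.

Definition convex_efun g : Prop :=
  convex_set (epi g : set (convex_lmodType (V * R^o)%type)).

(* For [g] convex, lower semicontinuous and proper, the limit exists and does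
   not depend on the base point, so an arbitrary point of [dom g] is chosen.
   The value is meaningless when [dom g] is empty. *)
Definition recession g (x : V) : \bar R :=
  let xbar := xget 0%R (dom g) in
  lim ((g (xbar + a *: x)%R - g xbar) * (a^-1)%:E @[a --> (+oo)%R]).

End convex_analysis.

Section sub_sigma_algebras.
Context {d : measure_display} {Om : measurableType d}.
Implicit Types G : set (set Om).

Definition filtration (T : nat) (Fil : nat -> set (set Om)) : Prop :=
  (forall t, (t <= T)%N -> sigma_algebra setT (Fil t) /\
                           Fil t `<=` measurable) /\
  (forall s t, (s <= t <= T)%N -> Fil s `<=` Fil t).

(* Borel measurability: it is enough to test open sets, as they generate the
   Borel sigma-algebra. *)
Definition measurable_wrt {V : topologicalType} G (f : Om -> V) : Prop :=
  forall O : set V, open O -> G (f @^-1` O).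

End sub_sigma_algebras.

Section integrands.
Context {R : realType} {d : measure_display} {Om : measurableType d}.
Variable P : probability Om R.
Implicit Types G : set (set Om).

(* Products of spaces of column vectors play the role of R^n. *)
Definition normal_integrand {V : topologicalType} G (h : V -> Om -> \bar R) :
    Prop :=
  (forall w, closed (epi (h^~ w))) /\
  (forall O : set (V * R^o), open O ->
     G [set w | epi (h^~ w) `&` O !=set0]).

Definition convex_integrand {V : lmodType R} (h : V -> Om -> \bar R) : Prop :=
  forall w, convex_efun (h^~ w).

Definition lower_bounded {V : Type} (h : V -> Om -> \bar R) : Prop :=
  exists2 m : Om -> R, P.-integrable setT (EFin \o m) &
    {ae P, forall w, forall x, (m w)%:E <= h x w}.

Definition recession_integrand {V : lmodType R} (h : V -> Om -> \bar R) :
    V -> Om -> \bar R :=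
  fun x w => recession (h^~ w) x.

(* [Y] is a version of E[Z | G], for [Z] measurable with integrable negative
   part; [Z] and [Y] may take the value +oo. Taking [A := [set w | Y w < 0]]
   shows that the negative part of [Y] is integrable as well. *)
Definition cond_expectation G (Z Y : Om -> \bar R) : Prop :=
  measurable_wrt G Y /\
  forall A, G A -> \int[P]_(w in A) Y w = \int[P]_(w in A) Z w.

(* [g] is a version of the [G]-conditional expectation of the integrand [h]. *)
Definition cond_integrand {V : topologicalType} G (h g : V -> Om -> \bar R) :
    Prop :=
  normal_integrand G g /\
  forall x : Om -> V, measurable_wrt G x ->
    cond_expectation G (fun w => h (x w) w) (fun w => g (x w) w).

End integrands.

(* Triples (X, U^b, U^a) with the pointwise vector space structure; only the
   components with index at most the horizon matter. *)
Notation strategy R Om N Mb Ma :=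
  ((nat -> Om -> 'cV[R]_N) * (nat -> Om -> 'cV[R]_Mb) *
   (nat -> Om -> 'cV[R]_Ma))%type (only parsing).

Section optimal_control.
Context {R : realType} {d : measure_display} {Om : measurableType d}.
Variables (P : probability Om R) (N Mb Ma T : nat).
Variable Fil : nat -> set (set Om).

Local Notation strategy := (strategy R Om N Mb Ma).

Definition stX (Z : strategy) := Z.1.1.
Definition stUb (Z : strategy) := Z.1.2.
Definition stUa (Z : strategy) := Z.2.

Definition adapted (Z : strategy) : Prop :=
  forall t, (t <= T)%N ->
    [/\ measurable_wrt (Fil t) (stX Z t), measurable_wrt (Fil t) (stUb Z t) &
        measurable_wrt (Fil t) (stUa Z t)].

Variables (L : nat -> 'cV[R]_N * 'cV[R]_Mb * 'cV[R]_Ma -> Om -> \bar R)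
          (J : 'cV[R]_N -> Om -> \bar R).

Definition oc_integrand (Z : strategy) (w : Om) : \bar R :=
  \sum_(t < T) L t (stX Z t w, stUb Z t w, stUa Z t.+1 w) w + J (stX Z T w) w.

Definition oc_cost (Z : strategy) : \bar R := \int[P]_w oc_integrand Z w.

Variables (A : nat -> Om -> 'M[R]_N) (Bb : nat -> Om -> 'M[R]_(N, Mb))
          (Ba : nat -> Om -> 'M[R]_(N, Ma)) (W : nat -> Om -> 'cV[R]_N).

Definition dynamics (t : nat) (x : 'cV[R]_N) (ub : 'cV[R]_Mb)
    (ua : 'cV[R]_Ma) (w : Om) : 'cV[R]_N :=
  (A t.+1 w *m x + Bb t.+1 w *m ub + Ba t.+1 w *m ua + W t.+1 w)%R.

Definition oc_feasible : set strategy :=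
  [set Z | adapted Z /\
    {ae P, forall w, forall t, (t < T)%N ->
      stX Z t.+1 w = dynamics t (stX Z t w) (stUb Z t w) (stUa Z t.+1 w) w}].

Definition oc_solution (Z : strategy) : Prop :=
  oc_feasible Z /\ oc_cost Z = ereal_inf (oc_cost @` oc_feasible).

(* Lower bounded integrands exceed -oo almost everywhere, so that the value
   given to (-oo) + (+oo) is irrelevant in the lower bounded case. *)
Definition bellman_solution (Js : nat -> 'cV[R]_N -> Om -> \bar R)
    (Qs : nat -> 'cV[R]_N * 'cV[R]_Mb -> Om -> \bar R) : Prop :=
  [/\ forall t, (t <= T)%N -> normal_integrand measurable (Js t),
      forall t, (t < T)%N -> normal_integrand measurable (Qs t) &
      exists2 EQ : nat -> 'cV[R]_N * 'cV[R]_Mb -> Om -> \bar R,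
        forall t, (t < T)%N -> cond_integrand P (Fil t) (Qs t) (EQ t) &
        {ae P, forall w,
          (forall x, Js T x w = J x w) /\
          (forall t x ub, (t < T)%N ->
            Qs t (x, ub) w =
              ereal_inf (range (fun ua =>
                L t (x, ub, ua) w + Js t.+1 (dynamics t x ub ua w) w))) /\
          (forall t x, (t < T)%N ->
            Js t x w = ereal_inf (range (fun ub => EQ t (x, ub) w)))}].

Definition lb_convex_bellman_solution
    (Js : nat -> 'cV[R]_N -> Om -> \bar R)
    (Qs : nat -> 'cV[R]_N * 'cV[R]_Mb -> Om -> \bar R) : Prop :=
  [/\ bellman_solution Js Qs,
      forall t, (t <= T)%N -> lower_bounded P (Js t) /\ convex_integrand (Js t) &
      forall t, (t < T)%N -> lower_bounded P (Qs t) /\ convex_integrand (Qs t)].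

End optimal_control.

Section recession_cone.
Context {R : realType} {d : measure_display} {Om : measurableType d}.
Variables (P : probability Om R) (N Mb Ma T : nat).
Variable Fil : nat -> set (set Om).
Variables (L : nat -> 'cV[R]_N * 'cV[R]_Mb * 'cV[R]_Ma -> Om -> \bar R)
          (J : 'cV[R]_N -> Om -> \bar R).
Variables (A : nat -> Om -> 'M[R]_N) (Bb : nat -> Om -> 'M[R]_(N, Mb))
          (Ba : nat -> Om -> 'M[R]_(N, Ma)).

Definition oc_recession_cone : set (strategy R Om N Mb Ma) :=
  [set Z | adapted T Fil Z /\
    {ae P, forall w,
      oc_integrand T (fun t => recession_integrand (L t))
        (recession_integrand J) Z w <= 0 /\
      forall t, (1 <= t <= T)%N ->
        stX Z t w = (A t w *m stX Z t.-1 w + Bb t w *m stUb Z t.-1 w +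
                     Ba t w *m stUa Z t w)%R}].

End recession_cone.

(* Main.v *)
(* Backward dynamic programming, in which all infima are attained for a reason
   carried by recession cones. Let K_T be the recession cone of J and let K_t be
   the random cone of those states from which, at time t, a plan satisfying the
   recession constraints exists up to time T. A recession plan in state 0 at time
   t can be extended by zero to the times before t, so the linearity assumption
   forces every kernel met in the recursion to be a linear space. This is what
   makes the projection along the controls of a closed convex epigraph closed (a
   sequence of points of minimal norm in their fibres cannot escape to infinity),
   so that the infima in the Bellman equations are attained by normal integrands
   and their recession cones are the projected ones. The recession cone of E_t Q_t
   consists of the directions whose F_t-measurable selections are recession
   directions of Q_t almost surely; one inclusion is monotonicity of conditional
   expectation, the other one is Fatou's lemma. Conditional expectations of normal
   integrands are obtained from those of Lipschitz regularisations. An optimal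
   strategy is found by measurable selections forward in time: the expectation of
   the accumulated cost plus J_t(X_t) is nondecreasing in t along every feasible
   strategy, and constant along the selected one. *)
From HB Require Import structures.
Require Import Defs.
From mathcomp Require Import all_boot all_order all_algebra.
From mathcomp Require Import all_classical all_reals all_analysis.
From mathcomp Require Import measurable_realfun.
From mathcomp Require Import ring lra.
Set Implicit Arguments.
Unset Strict Implicit.
Unset Printing Implicit Defensive.
Import Order.TTheory GRing.Theory Num.Theory.
Import numFieldNormedType.Exports.
Local Open Scope classical_set_scope.
Local Open Scope ring_scope.

(** * Proper normed spaces *)

(** Two obstacles shape the proof. The filtration is not assumed complete, so a property known
    almost surely cannot simply be enforced on the exceptional set: that set has to be described by
    countably many events of the right sigma-algebra. Hence the dense sequences, the Castaing
    representations, and the closures that produce closed values at every outcome. Moreover, a value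
    function may be identically [+oo] on an event of positive probability, where its empty epigraph
    says nothing about recession; the random cones are therefore built from [L] and [J] alone and
    compared with epigraphs only where these are nonempty. The lower bounds serve twice: they make
    all integrals meaningful in []-oo, +oo]], and they force recession slopes to be nonnegative, so
    that only horizontal directions [(v, 0)] of epigraphs matter and a condition on a sum splits
    into one condition per stage. The spaces below have compact closed balls and a dense sequence;
    products inherit both, so that states, controls and epigraph coordinates are treated alike. *)

Class proper {R : realType} (V : normedModType R) : Prop := {
  closed_ball_compact : forall r : R, compact [set x : V | `|x| <= r] ;
  dense_seq : exists q : nat -> V,
    forall (x : V) (e : R), 0 < e -> exists n, `|x - q n| < e }.

Section norm_topology.
Context {R : realType} {V : normedModType R}.
Implicit Types (C O : set V) (x y : V).

Lemma nbhs_normE x (A : set V) :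
  nbhs x A <-> exists2 e : R, 0 < e & forall y, `|x - y| < e -> A y.
Proof.
split=> [/nbhs_normP[e /= e0 h]|[e e0 h]]; first by exists e.
by apply/nbhs_normP; exists e.
Qed.

Lemma open_normE O :
  open O <-> forall x, O x -> exists2 e : R, 0 < e & forall y, `|x - y| < e -> O y.
Proof.
rewrite openE; split=> h x Ox; first by apply/nbhs_normE/h.
by apply/nbhs_normE/h.
Qed.

Lemma closure_normE C x :
  closure C x <-> forall e : R, 0 < e -> exists2 y, C y & `|x - y| < e.
Proof.
split=> [h e e0|h A /nbhs_normE[e e0 eA]].
  have [|y [Cy xy]] := h [set y | `|x - y| < e]; first by apply/nbhs_normE; exists e.
  by exists y.
by have [y Cy xy] := h e e0; exists y; split=> //; exact: eA.
Qed.

Lemma closed_normE C :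
  closed C <-> forall x,
    (forall e : R, 0 < e -> exists2 y, C y & `|x - y| < e) -> C x.
Proof.
split=> h x; first by move/closure_normE; exact: h.
by move/closure_normE; exact: h.
Qed.

Lemma open_nball x (r : R) : open [set y | `|y - x| < r].
Proof.
apply/open_normE => y /= yr; exists (r - `|y - x|); first by rewrite subr_gt0.
move=> z; rewrite ltrBrDl; apply: le_lt_trans.
by rewrite (distrC y z) [leRHS]addrC; exact: ler_distD.
Qed.

End norm_topology.

Lemma continuous_normE {R : realType} {V W : normedModType R} (f : V -> W) :
  continuous f <-> forall x (e : R), 0 < e ->
    exists2 r : R, 0 < r & forall y, `|x - y| < r -> `|f x - f y| < e.
Proof.
split=> h x.
  move=> e e0; have := h x [set z | `|f x - z| < e].
  have n : nbhs (f x) [set z | `|f x - z| < e] by apply/nbhs_normE; exists e.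
  by move=> /(_ n)/nbhs_normE.
move=> A /nbhs_normE[e e0 eA].
have [r r0 hr] := h x e e0; apply/nbhs_normE; exists r => // y /hr; exact: eA.
Qed.

Section proper_spaces.
Context {R : realType}.

(** Compactness in epsilon form: instead of a subsequence it yields, for every precision,
    arbitrarily late indices, which is what the limit arguments below consume. *)
Lemma cluster_seq {V : normedModType R} {pV : proper V} (x : nat -> V) (r : R) :
  (forall n, `|x n| <= r) ->
  exists v, forall e : R, 0 < e -> forall n0, exists2 n, (n0 <= n)%N & `|v - x n| < e.
Proof.
move=> xr.
have [|v [_ clv]] := @closed_ball_compact _ _ pV r (x @ \oo) _.
  by exists 0%N => // n _ /=; exact: xr.
exists v => e e0 n0.
have [||y [/= [n nn <-] h]] := clv (x @` [set n | (n0 <= n)%N]) [set y | `|v - y| < e].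
- by exists n0 => // n /= n0n; exists n.
- by apply/nbhs_normE; exists e.
by exists n.
Qed.

Lemma cauchy_lim {V : normedModType R} {pV : proper V} (x : nat -> V) (e : nat -> R) :
  (forall r : R, 0 < r -> exists n, e n < r) ->
  (forall n m, (n <= m)%N -> `|x n - x m| <= e n) ->
  exists v, forall n, `|v - x n| <= e n.
Proof.
move=> e0 hx.
have [|v hv] := @cluster_seq V pV x (`|x 0%N| + e 0%N).
  by move=> n; rewrite -lerBlDl; apply: le_trans (lerB_dist _ _) _; rewrite distrC hx.
exists v => n; apply/ler_addgt0Pr => r r0.
have [m nm vm] := hv r r0 n.
apply: le_trans (ler_distD (x m) _ _) _.
by rewrite addrC lerD ?(ltW vm)// distrC hx.
Qed.

#[global] Instance proper_prod {V W : normedModType R} (pV : proper V)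
  (pW : proper W) : proper (V * W)%type.
Proof.
split.
  move=> r; have := compact_setX (@closed_ball_compact _ _ pV r) (@closed_ball_compact _ _ pW r).
  congr compact; apply/seteqP; split=> x /=; rewrite prod_normE ge_max.
    by move=> [-> ->].
  by move/andP.
have [p hp] := @dense_seq _ _ pV; have [q hq] := @dense_seq _ _ pW.
exists (fun n => let ij := odflt (0%N, 0%N) (unpickle n) in (p ij.1, q ij.2)).
move=> [x y] e e0; have [i hi] := hp x e e0; have [j hj] := hq y e e0.
by exists (pickle (i, j)); rewrite pickleK prod_normE gt_max /= hi.
Qed.

(** The sign of [r] matters for matrices without entries, whose norm is [0]; the dimensions of
    states and controls may vanish. *)
Lemma mx_norm_leP m n (x : 'M[R]_(m, n)) (r : R) : 0 <= r ->
  `|x| <= r <-> forall i j, `|x i j| <= r.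
Proof.
move=> r0; rewrite /Num.norm/= mx_normrE; split=> [/bigmax_leP[_ h] i j|h].
  exact: (h (i, j)).
by apply/bigmax_leP; split=> // -[i j] _; exact: h.
Qed.

Lemma mx_norm_ltP m n (x : 'M[R]_(m, n)) (r : R) : 0 < r ->
  `|x| < r <-> forall i j, `|x i j| < r.
Proof.
move=> r0; rewrite /Num.norm/= mx_normrE; split=> [/bigmax_ltP[_ h] i j|h].
  exact: (h (i, j)).
by apply/bigmax_ltP; split=> // -[i j] _; exact: h.
Qed.

Lemma continuous_vec_mx m n : continuous (vec_mx : 'rV[R]_(m * n) -> 'M[R]_(m, n)).
Proof.
apply/continuous_normE => x e e0; exists e => // y.
move=> /mx_norm_ltP-/(_ e0) h; apply/mx_norm_ltP => // i j.
by have := h ord0 (mxvec_index i j); rewrite !mxE.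
Qed.

(** Row vectors carry the compactness, as products of segments, and [vec_mx] transports it; matrices
    with rational entries are dense. *)
#[global] Instance proper_mx m n : proper 'M[R]_(m, n).
Proof.
split.
  move=> r; have [r0|r0] := ltP r 0.
    rewrite (_ : mkset _ = set0); first exact: compact0.
    by apply/seteqP; split=> // x /= /(le_trans (normr_ge0 _)); rewrite leNgt r0.
  pose K := [set v : 'rV[R]_(m * n) | forall i, [set a : R | `|a| <= r] (v ord0 i)].
  have cK : compact K.
    apply: (@rV_compact R _ (fun=> [set a : R | `|a| <= r])) => _.
    rewrite (_ : mkset _ = `[- r, r]%classic); first exact: segment_compact.
    by apply/seteqP; split=> a /=; rewrite in_itv/= ler_norml.
  have := continuous_compact (continuous_subspaceT (@continuous_vec_mx m n)) cK.
  congr compact; apply/seteqP; split=> x /=.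
    by move=> [v Kv <-]; apply/mx_norm_leP => // i j; rewrite mxE; exact: Kv.
  move=> /mx_norm_leP-/(_ r0) h; exists (mxvec x); last exact: mxvecK.
  by move=> k /=; case/mxvec_indexP: k => i j; rewrite mxvecE.
exists (fun k => map_mx ratr (odflt 0 (unpickle k) : 'M[rat]_(m, n))).
move=> x e e0.
have h i j : exists q : rat, `|x i j - ratr q| < e.
  have [|q] := @rat_in_itvoo R (x i j - e) (x i j); first by rewrite ltrBlDr ltrDl.
  rewrite in_itv/= => /andP[q1 q2]; exists q.
  by rewrite gtr0_norm ?subr_gt0// ltrBlDl -ltrBlDr.
pose q := \matrix_(i, j) xget 0 [set q : rat | `|x i j - ratr q| < e].
exists (pickle q); rewrite pickleK; apply/mx_norm_ltP => // i j.
rewrite [odflt _ _]/= !mxE.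
exact: (@xgetPex _ 0 [set q : rat | `|x i j - ratr q| < e] (h i j)).
Qed.

#[global] Instance proper_ro : proper (R^o : normedModType R).
Proof.
split.
  move=> r; rewrite (_ : mkset _ = `[- r, r]%classic); first exact: segment_compact.
  by apply/seteqP; split=> a /=; rewrite in_itv/= ler_norml.
exists (fun n => ratr (odflt 0 (unpickle n))) => x e e0.
have [|q] := @rat_in_itvoo R (x - e) x; first by rewrite ltrBlDr ltrDl.
rewrite in_itv/= => /andP[q1 q2]; exists (pickle q); rewrite pickleK /=.
by rewrite gtr0_norm ?subr_gt0// ltrBlDl -ltrBlDr.
Qed.

End proper_spaces.

Section continuity.
Context {R : realType} {U V W : normedModType R}.

Lemma continuous_pair (f : U -> V) (g : U -> W) :
  continuous f -> continuous g -> continuous (fun x => (f x, g x)).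
Proof. by move=> cf cg x; exact: (cvg_pair (cf x) (cg x)). Qed.

Lemma continuous_fst : continuous (fst : V * W -> V).
Proof. by move=> x; exact: cvg_fst. Qed.

Lemma continuous_snd : continuous (snd : V * W -> W).
Proof. by move=> x; exact: cvg_snd. Qed.

Lemma continuous_comp2 (f : U -> V) (g : V -> W) :
  continuous f -> continuous g -> continuous (g \o f).
Proof. by move=> cf cg x; apply: (cvg_comp f g (cf x)); exact: cg. Qed.

Lemma continuousD (f g : U -> V) :
  continuous f -> continuous g -> continuous (fun x => f x + g x).
Proof. by move=> cf cg x; exact: cvgD (cf x) (cg x). Qed.

Lemma continuousB (f g : U -> V) :
  continuous f -> continuous g -> continuous (fun x => f x - g x).
Proof. by move=> cf cg x; exact: cvgB (cf x) (cg x). Qed.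

Lemma continuous_cst (v : V) : continuous (fun _ : U => v).
Proof. by move=> x; exact: cvg_cst. Qed.

Lemma continuous_id : continuous (fun x : U => x).
Proof. by move=> x; exact: cvg_id. Qed.

Lemma lipschitz_continuous_norm (f : U -> V) (k : R) :
  (forall x y, `|f x - f y| <= k * `|x - y|) -> continuous f.
Proof.
move=> lf; apply/continuous_normE => x e e0.
exists (e / (`|k| + 1)); first by rewrite divr_gt0// ltr_wpDl.
move=> y xy; apply: le_lt_trans (lf x y) _.
have : k * `|x - y| <= (`|k| + 1) * `|x - y|.
  by rewrite ler_wpM2r// (le_trans (ler_norm k))// lerDl.
by move/le_lt_trans; apply; rewrite mulrC -ltr_pdivlMr// ltr_wpDl.
Qed.

End continuity.

(** * Recession cones and projections of closed convex sets *)

Lemma conv_combE {R : realType} {V : lmodType R} (x y : V) (t : R) :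
  t *: x + (1 - t) *: y = y + t *: (x - y).
Proof. by rewrite scalerBl scale1r scalerBr addrCA. Qed.

Lemma add_conv_combE {R : realType} {V : lmodType R} (c v z : V) (t : R) :
  c + v - (t *: z + (1 - t) *: c) = t *: c + (v - t *: z).
Proof.
by rewrite conv_combE opprD addrACA subrr add0r scalerBr opprB addrCA.
Qed.

Section recession_cones.
Context {R : realType} {V : normedModType R}.
Implicit Types C : set V.

Definition convexS C := forall x y (t : R), C x -> C y -> 0 <= t <= 1 ->
  C (t *: x + (1 - t) *: y).

(** For convex [C] the unit step controls all nonnegative multiples, by [rec_scale]. For empty [C]
    the cone is the whole space, hence the nonemptiness premises in statements about epigraphs. *)
Definition rec C : set V := [set v | forall c, C c -> C (c + v)].

(** Iteration reaches the integer multiples of [v]; a real multiple lies on the segment from [c] to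
    [c] plus a larger integer multiple. *)
Lemma rec_scale C v (t : R) : convexS C -> rec C v -> 0 <= t -> rec C (t *: v).
Proof.
move=> cC Cv t0 c Cc.
have Cn n : C (c + n%:R *: v).
  elim: n => [|n IH]; first by rewrite scale0r addr0.
  by rewrite -natr1 scalerDl scale1r addrA; exact: Cv.
have [n nt] : exists n : nat, t <= n.+1%:R.
  by exists (Num.truncn t); exact/ltW/truncnS_gt.
have := cC _ _ (t / n.+1%:R) (Cn n.+1) Cc.
rewrite divr_ge0//= ler_pdivrMr// mul1r nt => /(_ isT).
by rewrite conv_combE [c + _]addrC addrK scalerA divfK ?pnatr_eq0.
Qed.

Lemma small_natV (e : R) (a : R) : 0 < e -> exists n0, forall n, (n0 <= n)%N -> a / n.+1%:R < e.
Proof.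
move=> e0; exists (Num.truncn (a / e)) => n nn.
rewrite ltr_pdivrMr// mulrC -ltr_pdivrMr//.
by apply: lt_le_trans (truncnS_gt _) _; rewrite ler_nat.
Qed.

(** One half-line in [C] suffices: the combination of [c + n v] with weight [1/n] and of an
    arbitrary [c'] with the remaining weight tends to [c' + v]. *)
Lemma rec_base C c v : closed C -> convexS C -> C c ->
  (forall n, C (c + n.+1%:R *: v)) -> rec C v.
Proof.
move=> clC cC Cc Cn c' Cc'; move/closed_normE: clC; apply => e e0.
have [n0 hn] := @small_natV e `|c' - c| e0.
have := hn _ (leqnn n0); set n := n0 => {}hn.
exists (n.+1%:R^-1 *: (c + n.+1%:R *: v) + (1 - n.+1%:R^-1) *: c').
  by apply: cC => //; rewrite invr_ge0 ler0n invf_le1// ler1n.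
rewrite conv_combE [c + _ - c']addrAC scalerDr scalerA mulVf ?pnatr_eq0// scale1r.
rewrite opprD addrACA subrr add0r opprD addrCA subrr addr0.
by rewrite normrN normrZ ger0_norm ?invr_ge0// mulrC distrC.
Qed.

Lemma rec0 C : rec C 0.
Proof. by move=> c; rewrite addr0. Qed.

Lemma recD C u v : rec C u -> rec C v -> rec C (u + v).
Proof. by move=> ru rv c /ru/rv; rewrite addrA. Qed.

Lemma rec_nat C v n : rec C v -> rec C (n%:R *: v).
Proof.
move=> rv; elim: n => [|n IH]; first by rewrite scale0r; exact: rec0.
by rewrite -natr1 scalerDl scale1r; exact: recD.
Qed.

End recession_cones.

Section projection.
Context {R : realType} {V W : normedModType R} {pV : proper V}.
Variables (f : V -> W) (lf : linear f) (cf : continuous f).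
Variables (C : set V) (clC : closed C) (cC : convexS C).
Hypothesis ker_rec : forall v, rec C v -> f v = 0 -> rec C (- v).

Let f0 : f 0 = 0.
Proof. by have := lf (-1) 0 0; rewrite scaler0 addr0 scaleN1r addNr. Qed.
Let fZ a x : f (a *: x) = a *: f x.
Proof. by have := lf a x 0; rewrite f0 !addr0. Qed.
Let fD x y : f (x + y) = f x + f y.
Proof. by have := lf 1 x y; rewrite !scale1r. Qed.
Let fB x y : f (x - y) = f x - f y.
Proof. by rewrite fD -scaleN1r fZ scaleN1r. Qed.

Lemma min_norm_fiber z : C z ->
  exists z', [/\ C z', f z' = f z & forall y, C y -> f y = f z -> `|z'| <= `|y|].
Proof using cf clC pV.
move=> Cz; pose A := [set `|y| | y in [set y | C y /\ f y = f z]].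
have A0 : A !=set0 by exists `|z|; exists z.
have lA : has_lbound A by exists 0 => _ [y _ <-].
have h n : exists y, [/\ C y, f y = f z & `|y| < inf A + n.+1%:R^-1].
  have [|_ [y [Cy fy] <-] yA] := @inf_adherent _ A (n.+1%:R^-1) _ (conj A0 lA); first by rewrite invr_gt0.
  by exists y; split.
have /choice[y hy] := h.
have [|v hv] := @cluster_seq R V pV y (inf A + 1).
  move=> n; have [_ _ /ltW yn] := hy n; apply: le_trans yn _.
  by rewrite lerD2l invf_le1// ler1n.
exists v; split.
- move/closed_normE: clC; apply => e e0; have [n _ vn] := hv e e0 0%N.
  by exists (y n) => //; have [] := hy n.
- apply/eqP; rewrite -subr_eq0 -normr_le0; apply/ler_addgt0Pr => e e0.
  have [r r0 hr] := (continuous_normE f).1 cf v e e0.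
  have [n _ /hr] := hv r r0 0%N; have [_ -> _] := hy n.
  by rewrite add0r => /ltW.
- move=> x Cx fx; apply: (@le_trans _ _ (inf A)); last by apply: ge_inf => //; exists x.
  apply/ler_addgt0Pr => e e0.
  have e2 : 0 < e / 2 by rewrite divr_gt0.
  have [n0 hn0] := @small_natV R (e / 2) 1 e2.
  have [n nn vn] := hv _ e2 n0; have [_ _ yn] := hy n.
  rewrite [e]splitr addrA -[v](subrK (y n)); apply: le_trans (ler_normD _ _) _.
  rewrite addrC lerD// ?(ltW vn)//; apply: le_trans (ltW yn) _.
  by rewrite lerD2l ltW// -[_^-1]mul1r hn0.
Qed.

(* Points of minimal norm in their fibres stay bounded relative to [t]: a limit
   [v] of [z n / |z n|] would be a recession direction in the kernel of [f], and
   subtracting [|z n| v], allowed by [ker_rec], would shorten [z n]. *)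
Lemma min_norm_bound (z : nat -> V) (t : nat -> R) (M : R) :
  (forall n, C (z n)) -> (forall n, 1 <= t n) ->
  (forall n y, C y -> f y = f (z n) -> `|z n| <= `|y|) ->
  (forall n, `|f (z n)| <= M * t n) ->
  exists B, forall n, `|z n| <= B * t n.
Proof using lf cf clC cC ker_rec pV.
move=> Cz t1 zmin fzM; apply: contrapT => /forallNP noB.
have h k : exists n, k.+1%:R * t n < `|z n|.
  by have /existsNP[n /negP] := noB k.+1%:R; rewrite -ltNge; exists n.
have /choice[i hi] := h.
have zi k : k.+1%:R < `|z (i k)|.
  by apply: le_lt_trans (hi k); rewrite ler_peMr.
have zi0 k : 0 < `|z (i k)| by apply: le_lt_trans (zi k).
have zi1 k : `|z (i k)|^-1 <= 1.
  by rewrite invf_le1//; apply: ltW; apply: le_lt_trans (zi k); rewrite ler1n.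
pose u k := `|z (i k)|^-1 *: z (i k).
have [|v hv] := @cluster_seq R V pV u 1.
  by move=> k; rewrite normrZ ger0_norm ?invr_ge0// mulVf// lt0r_neq0.
have rv : rec C v.
  move=> c Cc; move/closed_normE: clC; apply => e e0.
  have e2 : 0 < e / 2 by rewrite divr_gt0.
  have [n0 hn0] := @small_natV R (e / 2) `|c| e2.
  have [n nn vn] := hv _ e2 n0.
  exists (`|z (i n)|^-1 *: z (i n) + (1 - `|z (i n)|^-1) *: c).
    by apply: cC => //; rewrite zi1 invr_ge0 normr_ge0.
  rewrite add_conv_combE.
  rewrite [e]splitr; apply: le_lt_trans (ler_normD _ _) _; apply: ltrD => //.
  apply: le_lt_trans (hn0 _ nn); rewrite normrZ ger0_norm ?invr_ge0// mulrC.
  by rewrite ler_wpM2l// lef_pV2 ?posrE// ltW.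
have fv : f v = 0.
  apply/eqP; rewrite -normr_le0; apply/ler_addgt0Pr => e e0; rewrite add0r.
  have e2 : 0 < e / 2 by rewrite divr_gt0.
  have [r r0 hr] := (continuous_normE f).1 cf v _ e2.
  have [n0 hn0] := @small_natV R (e / 2) M e2.
  have [n nn /hr vn] := hv _ r0 n0.
  rewrite [e]splitr -[f v](subrK (f (u n))).
  apply: le_trans (ler_normD _ _) _; apply: lerD; first exact: ltW.
  apply: le_trans (ltW (hn0 _ nn)).
  rewrite fZ normrZ ger0_norm ?invr_ge0// mulrC ler_pdivrMr//.
  apply: le_trans (fzM _) _.
  have M0 : 0 <= M.
    have := le_trans (normr_ge0 _) (fzM 0%N); rewrite pmulr_lge0//.
    exact: lt_le_trans (t1 0%N).
  rewrite -mulrA ler_wpM2l// ler_pdivlMl//; exact/ltW/hi.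
have [n _ vn] := hv 1 ltr01 0%N.
have := zmin (i n) (z (i n) + `|z (i n)| *: (- v)).
have rz : rec C (`|z (i n)| *: (- v)) by apply: rec_scale => //; exact: ker_rec.
move=> /(_ (rz _ (Cz _))).
rewrite scalerN fB fZ fv scaler0 subr0 => /(_ erefl).
have -> : z (i n) - `|z (i n)| *: v = `|z (i n)| *: (u n - v).
  by rewrite scalerBr scalerA divff ?lt0r_neq0// scale1r.
by rewrite normrZ normr_id distrC leNgt -[ltRHS]mulr1 ltr_pM2l// vn.
Qed.

(** Images converging to [y] are represented by points of minimal norm in their fibres. These are
    bounded, so a cluster point exists, lies in [C] and is sent to [y]. *)
Lemma closed_proj : closed (f @` C).
Proof using lf cf clC cC ker_rec pV.
apply/closed_normE => y hy.
have h n : exists z, [/\ C z, `|y - f z| < n.+1%:R^-1 &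
    forall z', C z' -> f z' = f z -> `|z| <= `|z'|].
  have [|_ [z Cz <-] yz] := hy (n.+1%:R^-1); first by rewrite invr_gt0.
  have [z' [Cz' fz hz]] := min_norm_fiber Cz.
  by exists z'; rewrite fz; split.
have /choice[z hz] := h.
(* The errors are at most [1], so the images have norm at most [|y| + 1]. *)
have [||||B hB] := @min_norm_bound z (fun=> 1) (`|y| + 1).
- by move=> n; have [] := hz n.
- by [].
- by move=> n; have [] := hz n.
- move=> n; have [_ yz _] := hz n; rewrite mulr1 -lerBlDl.
  rewrite distrC in yz; apply: le_trans (lerB_dist _ _) _; apply: le_trans (ltW yz) _.
  by rewrite invf_le1// ler1n.
have [|v hv] := @cluster_seq R V pV z B; first by move=> n; rewrite -[B]mulr1.
exists v.
  move/closed_normE: clC; apply => e e0; have [n _ vn] := hv e e0 0%N.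
  by exists (z n) => //; have [] := hz n.
apply/eqP; rewrite -subr_eq0 -normr_le0; apply/ler_addgt0Pr => e e0; rewrite add0r.
have e2 : 0 < e / 2 by rewrite divr_gt0.
have [r r0 hr] := (continuous_normE f).1 cf v _ e2.
have [n0 hn0] := @small_natV R (e / 2) 1 e2.
have [n nn /hr vn] := hv _ r0 n0.
have [_ yz _] := hz n; apply: le_trans (ler_distD (f (z n)) _ _) _.
rewrite [e]splitr lerD//; first exact: ltW.
by rewrite distrC (le_trans (ltW yz))// -[_^-1]mul1r ltW// hn0.
Qed.

(** Images of recession directions always recede; the converse rests on the kernel condition. Points
    of minimal norm over [f z0 + n w] grow at most linearly in [n], and a cluster point of these
    points divided by [n] is a recession direction over [w]. *)
Lemma rec_proj w : C !=set0 -> rec (f @` C) w -> exists2 v, rec C v & f v = w.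
Proof using lf cf clC cC ker_rec pV.
move=> [z0 Cz0] rw.
have h n : exists z, [/\ C z, f z = f z0 + n.+1%:R *: w &
    forall z', C z' -> f z' = f z -> `|z| <= `|z'|].
  have [|z1 Cz1 fz1] := rec_nat n.+1 rw (c := f z0); first by exists z0.
  have [z' [Cz' fz hz]] := min_norm_fiber Cz1.
  by exists z'; rewrite fz; split.
have /choice[z hz] := h.
have [||||B hB] := @min_norm_bound z (fun n => n.+1%:R) (`|f z0| + `|w|).
- by move=> n; have [] := hz n.
- by move=> n; rewrite ler1n.
- by move=> n; have [] := hz n.
- move=> n; have [_ -> _] := hz n; apply: le_trans (ler_normD _ _) _.
  by rewrite mulrDl lerD// ?normrZ ?normr_nat 1?mulrC// ler_peMl// ler1n.
have [|v hv] := @cluster_seq R V pV (fun n => n.+1%:R^-1 *: z n) B.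
  by move=> n; rewrite normrZ ger0_norm ?invr_ge0// mulrC ler_pdivrMr.
exists v.
  move=> c Cc; move/closed_normE: clC; apply => e e0.
  have e2 : 0 < e / 2 by rewrite divr_gt0.
  have [n0 hn0] := @small_natV R (e / 2) `|c| e2.
  have [n nn vn] := hv _ e2 n0.
  exists (n.+1%:R^-1 *: z n + (1 - n.+1%:R^-1) *: c).
    apply: cC => //; first by have [] := hz n.
    by rewrite invr_ge0 ler0n invf_le1// ler1n.
  rewrite add_conv_combE.
  rewrite [e]splitr; apply: le_lt_trans (ler_normD _ _) _; apply: ltrD => //.
  by apply: le_lt_trans (hn0 _ nn); rewrite normrZ ger0_norm ?invr_ge0// mulrC.
apply/eqP; rewrite -subr_eq0 -normr_le0; apply/ler_addgt0Pr => e e0; rewrite add0r.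
have e2 : 0 < e / 2 by rewrite divr_gt0.
have [r r0 hr] := (continuous_normE f).1 cf v _ e2.
have [n0 hn0] := @small_natV R (e / 2) `|f z0| e2.
have [n nn /hr vn] := hv _ r0 n0.
have [_ fz _] := hz n; apply: le_trans (ler_distD (f (n.+1%:R^-1 *: z n)) _ _) _.
rewrite [e]splitr lerD//; first exact: ltW.
rewrite fZ fz scalerDr scalerA mulVf ?pnatr_eq0// scale1r addrK.
by rewrite normrZ ger0_norm ?invr_ge0// mulrC ltW// hn0.
Qed.

End projection.

(** * Measurability with respect to a sub-sigma-algebra *)

Section sigma_algebra_closure.
Context {T : Type} (G : set (set T)) (sG : sigma_algebra setT G).

Lemma sa_const (Q : Prop) : G [set w | Q].
Proof.
have [G0 GC _] := sG; have GT := GC _ G0.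
have [q|q] := pselect Q.
  by move: GT; congr G; apply/seteqP; split=> w //= _; split=> // -[].
by move: G0; congr G; apply/seteqP; split=> w.
Qed.

Lemma sa_not (A : T -> Prop) : G [set w | A w] -> G [set w | ~ A w].
Proof.
have [_ GC _] := sG => /GC; congr G.
by apply/seteqP; split=> w /=; [move=> []|].
Qed.

Lemma sa_ex {I : countType} (A : I -> T -> Prop) :
  (forall i, G [set w | A i w]) -> G [set w | exists i, A i w].
Proof.
have [_ _ GU] := sG => GA.
rewrite (_ : mkset _ = \bigcup_n [set w | exists2 i, unpickle n = Some i & A i w]).
  apply: GU => n; case: (unpickle n) => [i|]; last first.
    by rewrite (_ : mkset _ = set0); [have [] := sG|apply/seteqP; split=> w // -[]].
  have := GA i; congr G; apply/seteqP; split=> w /=; first by exists i.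
  by move=> [_ [<-]].
apply/seteqP; split=> w /= [i]; first by exists (pickle i) => //=; exists i => //; exact: pickleK.
by move=> _ [j _ ?]; exists j.
Qed.

Lemma sa_all {I : countType} (A : I -> T -> Prop) :
  (forall i, G [set w | A i w]) -> G [set w | forall i, A i w].
Proof.
move=> GA; have := sa_not (sa_ex (fun i => sa_not (GA i))); congr G.
apply/seteqP; split=> w /= h; last by move=> [i]; exact.
by move=> i; apply: contrapT => Ai; apply: h; exists i.
Qed.

Lemma sa_and (A B : T -> Prop) : G [set w | A w] -> G [set w | B w] ->
  G [set w | A w /\ B w].
Proof.
move=> GA GB; have := @sa_all bool (fun b w => if b then A w else B w).
move=> /(_ (fun b => if b as b0 return G [set w | if b0 then A w else B w] then GA else GB)).
congr G; apply/seteqP; split=> w /= h; first by split; [exact: (h true)|exact: (h false)].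
by move=> [] ; case: h.
Qed.

Lemma sa_or (A B : T -> Prop) : G [set w | A w] -> G [set w | B w] ->
  G [set w | A w \/ B w].
Proof.
move=> GA GB; have := sa_not (sa_and (sa_not GA) (sa_not GB)); congr G.
by apply/seteqP; split=> w /=; rewrite not_andP !notK.
Qed.

Lemma sa_imp (A B : T -> Prop) : G [set w | A w] -> G [set w | B w] ->
  G [set w | A w -> B w].
Proof.
move=> GA GB; have := sa_or (sa_not GA) GB; congr G.
by apply/seteqP; split=> w /=; have := pselect (A w); tauto.
Qed.

Lemma sa_ext (A B : T -> Prop) : (forall w, A w <-> B w) -> G [set w | A w] ->
  G [set w | B w].
Proof. by move=> AB; congr G; apply/seteqP; split=> w /= /AB. Qed.

End sigma_algebra_closure.

Lemma small_inv {R : realType} (e : R) : 0 < e ->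
  exists n0, forall n, (n0 <= n)%N -> n.+1%:R^-1 < e.
Proof.
move=> /(@small_natV R e 1)[n0 h]; exists n0 => n /h; by rewrite div1r.
Qed.

Lemma half_gt0 {R : realType} (e : R) : 0 < e -> 0 < e / 2.
Proof. by move=> e0; rewrite divr_gt0. Qed.

Lemma inv_gt0 {R : realType} (n : nat) : 0 < (n.+1%:R^-1 : R).
Proof. by rewrite invr_gt0. Qed.

(* [lra] recognises atoms syntactically, whereas the norms occurring in a goal
   may differ by convertible instances; [set] identifies them. *)
Ltac norm_lra :=
  repeat match goal with H : is_true _ |- _ => revert H end;
  repeat match goal with
  | |- context [Num.norm ?x] => let t := fresh in set t := `|x|; clearbody t
  end;
  repeat match goal with
  | |- context [(?k.+1%:R)^-1] =>
      is_var k; let t := fresh in set t := ((k.+1%:R)^-1); clearbody t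
  end;
  intros; lra.

Section measurable_wrt.
Context {R : realType} {d : measure_display} {Om : measurableType d}.
Variables (G : set (set Om)) (sG : sigma_algebra setT G).

Lemma mwrt_cst {V : topologicalType} (v : V) : measurable_wrt G (fun _ => v).
Proof. by move=> O _; exact: (sa_const sG (O v)). Qed.

Lemma mwrt_comp {V W : topologicalType} (f : V -> W) (x : Om -> V) :
  continuous f -> measurable_wrt G x -> measurable_wrt G (f \o x).
Proof.
by move=> cf mx O oO; apply: (mx (f @^-1` O)); apply: open_comp => // z _; exact: cf.
Qed.

Lemma mwrt_if {V : topologicalType} (A : Om -> Prop) (x y : Om -> V) :
  G [set w | A w] -> measurable_wrt G x -> measurable_wrt G y ->
  measurable_wrt G (fun w => if pselect (A w) then x w else y w).
Proof.
move=> GA mx my O oO.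
have := sa_or sG (sa_and sG GA (mx O oO)) (sa_and sG (sa_not sG GA) (my O oO)).
congr G; apply/seteqP; split=> w; rewrite /preimage/=; case: pselect => Aw /=.
- by case=> [[]|[]].
- by case=> [[]|[]].
- by left.
- by right.
Qed.

(** Every open set of the product is a countable union of boxes about points of the two dense
    sequences, and a box is tested by its sides. *)
Lemma mwrt_pair {V W : normedModType R} {pV : proper V} {pW : proper W}
    (x : Om -> V) (y : Om -> W) :
  measurable_wrt G x -> measurable_wrt G y ->
  measurable_wrt G (fun w => (x w, y w)).
Proof.
move=> mx my O /open_normE oO.
have [p hp] := @dense_seq _ _ pV; have [q hq] := @dense_seq _ _ pW.
pose B (i j k : nat) : set (V * W) :=
  [set z | `|z.1 - p i| < k.+1%:R^-1 /\ `|z.2 - q j| < k.+1%:R^-1].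
apply: (@sa_ext _ G (fun w => exists i : nat * nat * nat,
  B i.1.1 i.1.2 i.2 `<=` O /\ B i.1.1 i.1.2 i.2 (x w, y w))); last first.
  apply: sa_ex => // -[[i j] k]; apply: sa_and => //; first exact: sa_const.
  exact: (sa_and sG (mx _ (open_nball _ _)) (my _ (open_nball _ _))).
move=> w; split; first by move=> [i [BO /BO]].
move=> Ow; have [e e0 he] := oO _ Ow.
have [k /(_ _ (leqnn k)) hk] := small_inv (half_gt0 e0).
have k0 : 0 < (k.+1%:R^-1 : R) by rewrite invr_gt0.
have [i hi] := hp (x w) _ k0; have [j hj] := hq (y w) _ k0.
exists (i, j, k); split; last by split.
move=> [a b] /= [ha hb]; apply: he; rewrite prod_normE gt_max /= [e]splitr.
apply/andP; split.
  by rewrite (le_lt_trans (ler_distD (p i) _ _))// ltrD ?(lt_trans hi)// distrC (lt_trans ha).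
by rewrite (le_lt_trans (ler_distD (q j) _ _))// ltrD ?(lt_trans hj)// distrC (lt_trans hb).
Qed.

Lemma mwrtD {V : normedModType R} {pV : proper V} (f g : Om -> V) :
  measurable_wrt G f -> measurable_wrt G g -> measurable_wrt G (fun w => f w + g w).
Proof.
move=> mf mg; have c : continuous (fun z : V * V => z.1 + z.2).
  by apply: continuousD; [exact: continuous_fst|exact: continuous_snd].
exact: (mwrt_comp c (mwrt_pair mf mg)).
Qed.

Lemma mwrtN {V : normedModType R} (f : Om -> V) :
  measurable_wrt G f -> measurable_wrt G (fun w => - f w).
Proof.
move=> mf; have c : continuous (fun x : V => - x) by move=> x; exact: cvgN.
exact: (mwrt_comp c mf).
Qed.

End measurable_wrt.

(** * Random closed sets and measurable selections *)

(** Effros measurability. On epigraphs this is the definition of a normal integrand, up to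
    conversion, so results on random sets apply to integrands directly. *)
Definition random_set {d : measure_display} {Om : measurableType d}
    {V : topologicalType} (G : set (set Om)) (S : Om -> set V) : Prop :=
  (forall w, closed (S w)) /\
  (forall O, open O -> G [set w | S w `&` O !=set0]).

Section random_sets.
Context {R : realType} {d : measure_display} {Om : measurableType d}.
Variables (G : set (set Om)) (sG : sigma_algebra setT G).

Lemma random_set_cst {V : topologicalType} (C : set V) : closed C ->
  random_set G (fun=> C).
Proof. by move=> cC; split=> // O _; exact: (sa_const sG). Qed.

(** An open set meets the closure of a set exactly when it meets the set, so taking the closure
    costs nothing and yields closed values at every outcome. *)
Lemma random_set_closure {V W : topologicalType} (f : V -> W) (S : Om -> set V) :
  continuous f -> random_set G S -> random_set G (fun w => closure (f @` S w)).
Proof.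
move=> cf [_ mS]; split=> [w|O oO]; first exact: closed_closure.
have := mS (f @^-1` O); rewrite /mkset => h.
apply: sa_ext (h _); last by apply: open_comp => // z _; exact: cf.
move=> w; split=> [[z [Sz Oz]]|[y [cy Oy]]].
  by exists (f z); split => //; apply: subset_closure; exists z.
by have [_ [[z Sz <-] Oz]] := cy O (open_nbhs_nbhs (conj oO Oy)); exists z.
Qed.

Lemma random_set_nonempty {V : topologicalType} (S : Om -> set V) :
  random_set G S -> G [set w | S w !=set0].
Proof.
by move=> [_ /(_ _ openT)]; apply: sa_ext => w; rewrite setIT.
Qed.

(** The moving centre [y w] is replaced by a nearby dense point, which turns the condition into
    countably many hits of fixed balls. *)
Lemma random_set_dist {V : normedModType R} {pV : proper V} (S : Om -> set V)
    (y : Om -> V) (r : R) : random_set G S -> measurable_wrt G y ->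
  G [set w | exists2 z, S w z & `|y w - z| < r].
Proof.
move=> [_ mS] my; have [p hp] := @dense_seq _ _ pV.
apply: (@sa_ext _ G (fun w => exists i : nat * nat,
    `|y w - p i.1| < i.2.+1%:R^-1 /\
    S w `&` [set z | `|z - p i.1| < r - i.2.+1%:R^-1] !=set0)).
  move=> w; split=> [[[i k] /= [yp [z [Sz pz]]]]|[z Sz yz]].
    exists z => //; apply: le_lt_trans (ler_distD (p i) _ _) _.
    by rewrite -(subrKC k.+1%:R^-1 r) ltrD// distrC.
  have e0 : 0 < r - `|y w - z| by rewrite subr_gt0.
  have [k /(_ _ (leqnn k)) hk] := small_inv (half_gt0 e0).
  have [i hi] := hp (y w) _ (inv_gt0 k).
  exists (i, k); split=> //; exists z; split=> //=.
  by apply: le_lt_trans (ler_distD (y w) _ _) _; rewrite (distrC z); norm_lra.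
apply: sa_ex => // -[i k]; apply: sa_and => //.
  by have := my _ (open_nball (p i) k.+1%:R^-1).
exact: (mS _ (open_nball _ _)).
Qed.

Lemma random_set_mem {V : normedModType R} {pV : proper V} (S : Om -> set V)
    (y : Om -> V) : random_set G S -> measurable_wrt G y ->
  G [set w | S w (y w)].
Proof.
move=> rS my; have [cS _] := rS.
apply: (@sa_ext _ G (fun w => forall k, exists2 z, S w z & `|y w - z| < k.+1%:R^-1)).
  move=> w; split=> [h|Sy k]; last by exists (y w); rewrite // subrr normr0.
  apply/(closed_normE (S w)).1 => // e e0; have [k /(_ _ (leqnn k)) hk] := small_inv e0.
  by have [z Sz yz] := h k; exists z => //; exact: lt_trans hk.
by apply: sa_all => // k; exact: random_set_dist.
Qed.

Lemma random_set_prod {V W : normedModType R} {pV : proper V} {pW : proper W}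
    (S : Om -> set V) (S' : Om -> set W) : random_set G S -> random_set G S' ->
  random_set G (fun w => S w `*` S' w).
Proof.
move=> [cS mS] [cS' mS']; split=> [w|O /open_normE oO].
  apply/closed_normE => -[x y] h; split.
    apply/(closed_normE (S w)).1 => // e /h[[x' y'] [Sx _]].
    by rewrite prod_normE gt_max => /andP[? _]; exists x'.
  apply/(closed_normE (S' w)).1 => // e /h[[x' y'] [_ Sy]].
  by rewrite prod_normE gt_max => /andP[_ ?]; exists y'.
have [p hp] := @dense_seq _ _ pV; have [q hq] := @dense_seq _ _ pW.
pose B (i j k : nat) : set (V * W) :=
  [set z | `|z.1 - p i| < k.+1%:R^-1 /\ `|z.2 - q j| < k.+1%:R^-1].
apply: (@sa_ext _ G (fun w => exists i : nat * nat * nat,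
  B i.1.1 i.1.2 i.2 `<=` O /\
  (S w `&` [set z | `|z - p i.1.1| < i.2.+1%:R^-1] !=set0 /\
   S' w `&` [set z | `|z - q i.1.2| < i.2.+1%:R^-1] !=set0))); last first.
  apply: sa_ex => // -[[i j] k]; apply: sa_and => //; first exact: sa_const.
  exact: (sa_and sG (mS _ (open_nball _ _)) (mS' _ (open_nball _ _))).
move=> w; split.
  by move=> [[[i j] k] /= [BO [[x [Sx px]] [y [Sy qy]]]]]; exists (x, y); split=> //; exact: BO.
move=> [[x y] [[Sx Sy] Oxy]].
have [e e0 he] := oO _ Oxy.
have [k /(_ _ (leqnn k)) hk] := small_inv (half_gt0 e0).
have [i hi] := hp x _ (inv_gt0 k); have [j hj] := hq y _ (inv_gt0 k).
exists (i, j, k); split; last by split; [exists x|exists y].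
move=> [a b] /= [ha hb]; apply: he; rewrite prod_normE gt_max /=; apply/andP; split.
  by apply: le_lt_trans (ler_distD (p i) _ _) _; rewrite (distrC (p i)); norm_lra.
by apply: le_lt_trans (ler_distD (q j) _ _) _; rewrite (distrC (q j)); norm_lra.
Qed.

Section preimage.
Context {V W : normedModType R} {pV : proper V} {pW : proper W}.
Variables (S : nat -> Om -> set W) (f : nat -> V -> Om -> W).
Hypothesis rS : forall i, random_set G (S i).
Hypothesis cf : forall i w, continuous (f i ^~ w).
Hypothesis mf : forall i x, measurable_wrt G (f i x).

Let cont_upto w x k (e : R) : 0 < e -> exists2 r : R, 0 < r &
  forall i, (i <= k)%N -> forall y, `|x - y| < r -> `|f i x w - f i y w| < e.
Proof.
move=> e0; elim: k => [|k [r r0 hr]].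
  have [r r0 hr] := (continuous_normE _).1 (@cf 0%N w) x e e0.
  by exists r => // i; rewrite leqn0 => /eqP ->.
have [r' r'0 hr'] := (continuous_normE _).1 (@cf k.+1 w) x e e0.
exists (Num.min r r'); first by rewrite lt_min r0.
move=> i; rewrite leq_eqVlt => /predU1P[->|ik] y; rewrite lt_min => /andP[yr yr'].
  exact: hr'.
exact: hr.
Qed.

(** Testing an intersection with open sets is delicate, since approximate solutions need not give an
    exact one. On a closed ball they do, by compactness: solving all constraints there amounts to
    solving, for every [l], those up to index [l] within [1/(l+1)] by a dense point. *)
Lemma random_set_preimages :
  random_set G (fun w => [set x | forall i, S i w (f i x w)]).
Proof using sG pV pW rS cf mf.
split=> [w|O /open_normE oO].
  apply/closed_normE => x h i; have [cS _] := rS i.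
  apply/(closed_normE (S i w)).1 => // e e0.
  have [r r0 hr] := (continuous_normE _).1 (@cf i w) x e e0.
  by have [y hy /hr] := h r r0; exists (f i y w).
have [q hq] := @dense_seq _ _ pV.
pose K (n k : nat) := [set x : V | `|x - q n| <= k.+1%:R^-1].
pose I (w : Om) := [set x | forall i, S i w (f i x w)].
(* The dense point may leave the closed ball by [1/(l+1)]; the excess vanishes in the limit. *)
pose A (n k l : nat) (w : Om) := exists j : nat, `|q j - q n| < k.+1%:R^-1 + l.+1%:R^-1 /\
  forall i, (i <= l)%N -> exists2 z, S i w z & `|f i (q j) w - z| < l.+1%:R^-1.
have IKE n k w : I w `&` K n k !=set0 <-> forall l, A n k l w.
  split=> [[x [Ix Kx]] l|hA].
    have [r r0 hr] := @cont_upto w x l _ (inv_gt0 l).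
    have mr : 0 < Num.min r l.+1%:R^-1 by rewrite lt_min r0 inv_gt0.
    have [j] := hq x _ mr; rewrite lt_min => /andP[xj xj'].
    exists j; split.
      apply: le_lt_trans (ler_distD x _ _) _; rewrite distrC.
      by rewrite /K/= in Kx; norm_lra.
    by move=> i il; exists (f i x w); [exact: Ix|rewrite distrC; exact: hr].
  have [j hj] := choice hA.
  have [|x hx] := @cluster_seq R V pV (fun l => q (j l)) (`|q n| + k.+1%:R^-1 + 1).
    move=> l; have [+ _] := hj l; have := @lerB_dist _ _ (q (j l)) (q n).
    have : (l.+1%:R^-1 : R) <= 1 by rewrite invf_le1// ler1n.
    by move: (l.+1%:R^-1) => b; norm_lra.
  exists x; split.
    move=> i; have [cS _] := rS i; apply/(closed_normE (S i w)).1 => // e e0.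
    have [r r0 hr] := (continuous_normE _).1 (@cf i w) x _ (half_gt0 e0).
    have [l0 hl0] := small_inv (half_gt0 e0).
    have [l] := hx r r0 (maxn l0 i); rewrite geq_max => /andP[ll il] /hr xl.
    have [_ /(_ i il)[z Sz qz]] := hj l; exists z => //.
    apply: le_lt_trans (ler_distD (f i (q (j l)) w) _ _) _.
    by have := hl0 l ll; norm_lra.
  rewrite /K/=; apply/ler_addgt0Pr => e e0.
  have [l0 hl0] := small_inv (half_gt0 e0).
  have [l ll xl] := hx _ (half_gt0 e0) l0; have [ql _] := hj l.
  apply: le_trans (ler_distD (q (j l)) _ _) _.
  by have := hl0 l ll; norm_lra.
(* Every open set is the union of the countably many such closed balls it contains. *)
apply: (@sa_ext _ G (fun w => exists nk : nat * nat, K nk.1 nk.2 `<=` O /\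
   forall l, A nk.1 nk.2 l w)); last first.
  apply: sa_ex => // -[n k]; apply: sa_and => //; first exact: sa_const.
  apply: sa_all => // l; apply: sa_ex => // j; apply: sa_and => //; first exact: sa_const.
  apply: sa_all => // i; apply: sa_imp => //; first exact: sa_const.
  exact: random_set_dist.
move=> w; split=> [[[n k] /= [KO /IKE[x [Ix Kx]]]]|[x [Ix Ox]]].
  by exists x; split=> //; exact: KO.
have [e e0 he] := oO _ Ox.
have [k /(_ _ (leqnn k)) hk] := small_inv (half_gt0 e0).
have [n hn] := hq x _ (inv_gt0 k).
exists (n, k); split; last by apply/IKE; exists x; split=> //; exact: ltW.
move=> y /= yn; apply: he; apply: le_lt_trans (ler_distD (q n) _ _) _.
by rewrite (distrC (q n)); rewrite /K/= in yn; norm_lra.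
Qed.

End preimage.

Lemma random_set_preimage {V W : normedModType R} {pV : proper V} {pW : proper W}
    (S : Om -> set W) (f : V -> Om -> W) : random_set G S ->
    (forall w, continuous (f ^~ w)) -> (forall x, measurable_wrt G (f x)) ->
  random_set G (fun w => [set x | S w (f x w)]).
Proof.
move=> rS cf mf; have := @random_set_preimages V W pV pW (fun=> S) (fun=> f).
move=> /(_ (fun=> rS) (fun=> cf) (fun=> mf)); congr random_set.
by apply/funext => w; apply/seteqP; split=> x //= /(_ 0%N).
Qed.

End random_sets.

(** * Measurable selections and Castaing representations *)

Section selection.
Context {R : realType} {d : measure_display} {Om : measurableType d}.
Variables (G : set (set Om)) (sG : sigma_algebra setT G).
Context {V : normedModType R} {pV : proper V}.

(** The default [0] is also a genuine value, so [least_measurable] has to account for the case in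
    which no number satisfies the predicate. *)
Definition least (P : nat -> Prop) : nat :=
  xget 0%N [set n | P n /\ forall m, P m -> (n <= m)%N].

Lemma least_spec (P : nat -> Prop) : (exists n, P n) ->
  P (least P) /\ forall m, P m -> (least P <= m)%N.
Proof.
move=> [n Pn]; apply: (@xgetPex _ 0%N [set n | P n /\ forall m, P m -> (n <= m)%N]).
have : exists n, `[< P n >] by exists n; apply/asboolP.
move=> /ex_minnP[m /asboolP Pm hm]; exists m; split=> // k Pk.
by apply: hm; apply/asboolP.
Qed.

Lemma least_measurable (P : nat -> Om -> Prop) (j : nat) :
  (forall n, G [set w | P n w]) -> G [set w | least (P ^~ w) = j].
Proof.
move=> mP; apply: (@sa_ext _ G (fun w => (P j w /\ forall m, P m w -> (j <= m)%N) \/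
   ((forall n, ~ P n w) /\ j = 0%N))).
  move=> w; split=> [[[Pj hj]|[nP ->]]|<-].
  - have [|Pl hl] := @least_spec (P ^~ w); first by exists j.
    by apply/eqP; rewrite eqn_leq hl// hj.
  - by rewrite /least; apply: xgetPN => n [/nP].
  - have [[n Pn]|/forallNP nP] := pselect (exists n, P n w).
      by left; apply: (@least_spec (P ^~ w)); exists n.
    by right; split=> //; rewrite /least; apply: xgetPN => n [/nP].
apply: sa_or => //; apply: sa_and => //.
- by apply: sa_all => // m; apply: sa_imp => //; exact: sa_const.
- by apply: sa_all => // m; exact: sa_not.
- exact: sa_const.
Qed.

Lemma half_pow_small (a e : R) : 0 < e -> exists n : nat, a * 2^-1 ^+ n < e.
Proof.
move=> e0; have [n0 /(_ _ (leqnn _)) h] := @small_natV R e `|a| e0.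
exists n0; apply: le_lt_trans h; apply: le_trans (ler_norm _) _.
rewrite normrM ler_wpM2l// ger0_norm ?exprn_ge0 ?invr_ge0//.
by rewrite exprVn lef_pV2 ?posrE ?exprn_gt0// -natrX ler_nat; exact: ltn_expl.
Qed.

(* The index sequence of Kuratowski and Ryll-Nardzewski: the ball of radius
   [2^-n] about [q (krn_index w n)] meets [S w] and its predecessor. *)
Fixpoint krn_index (q : nat -> V) (S : Om -> set V) (w : Om) (n : nat) : nat :=
  if n is m.+1 then
    least (fun j => exists z, S w z /\ (`|q (krn_index q S w m) - z| < 2^-1 ^+ m /\
                                       `|q j - z| < 2^-1 ^+ m.+1))
  else least (fun j => exists z, S w z /\ `|q j - z| < 1).

(** The approximating points form a Cauchy sequence with a geometric rate that does not depend on
    [w], and their limit lies in the closed set [S w]. Where [S w] is empty the selection is [0], so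
    that it is measurable on the whole space. *)
Lemma measurable_selection (S : Om -> set V) : random_set G S ->
  exists x : Om -> V, measurable_wrt G x /\ forall w, S w !=set0 -> S w (x w).
Proof using sG pV.
move=> rS; have [cS mS] := rS.
have [q hq] := @dense_seq _ _ pV.
pose idx := krn_index q S.
have nball p r : [set y : V | `|p - y| < r] = [set y | `|y - p| < r].
  by apply/seteqP; split=> y /=; rewrite distrC.
have midx n j : G [set w | idx w n = j].
  elim: n j => [|n IH] j.
    apply: least_measurable => i; have := mS _ (open_nball (q i) 1).
    by rewrite -nball.
  apply: (@sa_ext _ G (fun w => exists i, idx w n = i /\
     least (fun j => exists z, S w z /\ (`|q i - z| < 2^-1 ^+ n /\
                                       `|q j - z| < 2^-1 ^+ n.+1)) = j)).
    by move=> w; split=> [[i [<- <-]]|<-] //; exists (idx w n).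
  apply: sa_ex => // i; apply: sa_and => //; apply: least_measurable => k.
  have := mS _ (openI (open_nball (q i) (2^-1 ^+ n)) (open_nball (q k) (2^-1 ^+ n.+1))).
  by rewrite -!nball.
have p0 n : 0 < (2^-1 ^+ n : R) by rewrite exprn_gt0// invr_gt0.
have near w n : S w !=set0 -> exists z, S w z /\ `|q (idx w n) - z| < 2^-1 ^+ n.
  move=> [z Sz]; elim: n => [|n [y [Sy qy]]].
    rewrite expr0; have [|h _] := @least_spec (fun j => exists z, S w z /\ `|q j - z| < 1); last exact: h.
    by have [j hj] := hq z 1 ltr01; exists j; exists z; rewrite distrC.
  have [|[y' [Sy' [_ qy']]] _] := @least_spec (fun j => exists z, S w z /\
    (`|q (krn_index q S w n) - z| < 2^-1 ^+ n /\ `|q j - z| < 2^-1 ^+ n.+1)).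
    by have [j hj] := hq y _ (p0 n.+1); exists j; exists y; rewrite (distrC (q j)).
  by exists y'.
(* Consecutive points are close to a common point of [S w]: [2^-n + 2^-(n+1)] is at most
   [2 * 2^-n]. *)
have step w n : S w !=set0 -> `|q (idx w n) - q (idx w n.+1)| <= 2 * 2^-1 ^+ n.
  move=> /near-/(_ n)[y [Sy qy]].
  have [|[y' [Sy' [qn qn1]]] _] := @least_spec (fun j => exists z, S w z /\
    (`|q (krn_index q S w n) - z| < 2^-1 ^+ n /\ `|q j - z| < 2^-1 ^+ n.+1)).
    by have [j hj] := hq y _ (p0 n.+1); exists j; exists y; rewrite (distrC (q j)).
  apply: le_trans (ler_distD y' _ _) _.
  have {}qn : `|q (idx w n) - y'| < 2^-1 ^+ n by [].
  have {}qn1 : `|y' - q (idx w n.+1)| < 2^-1 ^+ n.+1 by rewrite distrC.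
  have := exprS (2^-1 : R) n; have := p0 n.
  move: (2^-1 ^+ n) (2^-1 ^+ n.+1) qn qn1; clear; move: (idx w n.+1) => i b c.
  norm_lra.
(* The steps [2 * 2^-j] sum to [4 * 2^-n] over all [j] from [n] on. *)
have dist w n k : S w !=set0 ->
    `|q (idx w n) - q (idx w (n + k)%N)| <= 4 * 2^-1 ^+ n - 4 * 2^-1 ^+ (n + k).
  move=> S0; elim: k => [|k IH]; first by rewrite addn0 !subrr normr0.
  apply: le_trans (ler_distD (q (idx w (n + k)%N)) _ _) _.
  have := step w (n + k)%N S0; rewrite -addnS !addnS exprS.
  by move: (2^-1 ^+ n) (2^-1 ^+ (n + k)) IH => b c; norm_lra.
have lim w : exists v, (S w !=set0 -> forall n, `|v - q (idx w n)| <= 4 * 2^-1 ^+ n) /\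
    (~ (S w !=set0) -> v = 0).
  have [S0|S0] := pselect (S w !=set0); last by exists 0; split.
  have [|n m nm|v hv] := @cauchy_lim R V pV (fun n => q (idx w n)) (fun n => 4 * 2^-1 ^+ n).
  - by move=> r; exact: half_pow_small.
  - have := dist w n (m - n)%N S0; rewrite subnKC// => /le_trans; apply.
    by rewrite gerBl mulr_ge0// ltW.
  - by exists v; split.
have /choice[x hx] := lim; exists x; split; last first.
  move=> w S0; have [/(_ S0) xq _] := hx w.
  apply/(closed_normE (S w)).1 => // e e0.
  (* [5] is [4] for the distance to the limit plus [1] for the distance to [S w]. *)
  have [n hn] := half_pow_small 5 e0; have [z [Sz qz]] := near w n S0.
  exists z => //; apply: le_lt_trans (ler_distD (q (idx w n)) _ _) _.
  have := xq n; move: (2^-1 ^+ n) hn qz => b; norm_lra.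
move=> O /open_normE oO.
apply: (@sa_ext _ G (fun w => (S w !=set0 /\ exists nj : nat * nat,
  idx w nj.1 = nj.2 /\ forall y, `|y - q nj.2| <= 4 * 2^-1 ^+ nj.1 -> O y) \/
  (~ (S w !=set0) /\ O 0))).
  move=> w; split=> [[[S0 [[n j] /= [idxj hO]]]|[S0 O0]]|Oxw].
  - by have [/(_ S0 n) xq _] := hx w; apply: hO; rewrite -idxj.
  - by have [_ /(_ S0)] := hx w; rewrite /preimage/= => ->.
  - have [S0|S0] := pselect (S w !=set0); last first.
      by right; split=> //; have [_ /(_ S0) <-] := hx w.
    have [e e0 he] := oO _ Oxw; left; split=> //.
    (* [8] is twice the error [4]: once for [x w] and once for [y], about the same dense point. *)
    have [n hn] := half_pow_small 8 e0; have [/(_ S0 n) xq _] := hx w.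
    exists (n, idx w n); split=> //= y hy; apply: he.
    apply: le_lt_trans (ler_distD (q (idx w n)) _ _) _; rewrite (distrC _ y).
    by move: (2^-1 ^+ n) hn hy xq => b; norm_lra.
apply: sa_or => //; apply: sa_and => //.
- exact: random_set_nonempty rS.
- apply: sa_ex => // -[n j]; apply: sa_and => //; exact: sa_const.
- by apply: sa_not => //; exact: random_set_nonempty rS.
- exact: sa_const.
Qed.

(** For every small ball about a dense point, a selection of the part of [S] inside it is taken,
    with a fixed selection of [S] where the ball is missed. The part is closed up to be a random
    set, whence the non-strict bound in [sel]. *)
Lemma castaing (S : Om -> set V) : random_set G S ->
  exists x : nat -> Om -> V, [/\ forall n, measurable_wrt G (x n),
    forall w n, S w !=set0 -> S w (x n w) &
    forall w v (e : R), S w v -> 0 < e -> exists n, `|v - x n w| < e].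
Proof using sG pV.
move=> rS; have [cS mS] := rS.
have [q hq] := @dense_seq _ _ pV.
have [x0 [mx0 hx0]] := measurable_selection rS.
pose B i k : set V := [set y | `|y - q i| < k.+1%:R^-1].
pose S' i k w := closure (id @` (S w `&` B i k)).
have rS' i k : random_set G (S' i k).
  split=> [w|O oO]; first exact: closed_closure.
  have := mS _ (openI (open_nball (q i) k.+1%:R^-1) oO); apply: sa_ext => w.
  split=> [[y [Sy [By Oy]]]|[y [clS Oy]]].
    by exists y; split => //; apply: subset_closure; exists y.
  have [_ [[z [Sz Bz] <-] Oz]] := clS _ (open_nbhs_nbhs (conj oO Oy)).
  by exists z.
have sel (ik : nat * nat) : exists x : Om -> V, measurable_wrt G x /\
    forall w, (S w !=set0 -> S w (x w)) /\
    (S w `&` B ik.1 ik.2 !=set0 -> `|x w - q ik.1| <= ik.2.+1%:R^-1).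
  case: ik => i k /=; have [x [mx hx]] := measurable_selection (rS' i k).
  exists (fun w => if pselect (S w `&` B i k !=set0) then x w else x0 w).
  split; first by apply: mwrt_if => //; exact: (mS _ (open_nball _ _)).
  move=> w; case: pselect => [SB|SB] /=; last by split=> [/hx0|/SB].
  have [y [Sy By]] := SB.
  have /closure_normE xcl : S' i k w (x w).
    by apply: hx; exists y; apply: subset_closure; exists y.
  split=> [_|_].
    apply/(closed_normE (S w)).1 => // e /xcl[_ [z [Sz _] <-]] xz.
    by exists z.
  apply/ler_addgt0Pr => e /xcl[_ [z [Sz Bz] <-]] xz.
  apply: le_trans (ler_distD z _ _) _; rewrite /B/= in Bz; norm_lra.
have /choice[x hx] := sel.
exists (fun n => x (odflt (0%N, 0%N) (unpickle n))); split.
- by move=> n; have [] := hx (odflt (0%N, 0%N) (unpickle n)).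
- by move=> w n; have [_ /(_ w)[]] := hx (odflt (0%N, 0%N) (unpickle n)).
- move=> w v e Sv e0.
  have [k /(_ _ (leqnn k)) hk] := small_inv (half_gt0 e0).
  have [i hi] := hq v _ (inv_gt0 k); exists (pickle (i, k)); rewrite pickleK /=.
  have [_ /(_ w)[_ /=]] := hx (i, k).
  have SB : S w `&` B i k !=set0 by exists v.
  move=> /(_ SB) h; apply: le_lt_trans (ler_distD (q i) _ _) _.
  by rewrite (distrC (q i)); norm_lra.
Qed.

End selection.

(** * Random variables with values in the extended reals *)

Section measurable_wrt_ereal.
Context {R : realType} {d : measure_display} {Om : measurableType d}.
Variables (G : set (set Om)) (sG : sigma_algebra setT G).
Local Open Scope ereal_scope.

Lemma mwrt_ereal_lt (Y : Om -> \bar R) a : measurable_wrt G Y -> G [set w | Y w < a].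
Proof. by move=> /(_ _ (@open_ereal_lt_ereal _ a)). Qed.

Lemma mwrt_ereal_gt (Y : Om -> \bar R) a : measurable_wrt G Y -> G [set w | a < Y w].
Proof. by move=> /(_ _ (@open_ereal_gt_ereal _ a)). Qed.

Lemma mwrt_ereal_le (Y : Om -> \bar R) a : measurable_wrt G Y -> G [set w | Y w <= a].
Proof.
move=> /(mwrt_ereal_gt a)/(sa_not sG); apply: sa_ext => w.
by split=> [/negP|/le_gtF ->//]; rewrite -leNgt.
Qed.

Lemma mwrt_ereal_ge (Y : Om -> \bar R) a : measurable_wrt G Y -> G [set w | a <= Y w].
Proof.
move=> /(mwrt_ereal_lt a)/(sa_not sG); apply: sa_ext => w.
by split=> [/negP|/le_gtF ->//]; rewrite -leNgt.
Qed.

Lemma rat_between (x y : \bar R) : x < y -> exists q : rat, x < (ratr q)%:E < y.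
Proof.
have rr (a b : R) : (a < b)%R -> exists q : rat, a%:E < (ratr q)%:E < b%:E.
  by move=> /rat_in_itvoo[q]; rewrite in_itv/= => h; exists q; rewrite !lte_fin.
case: x y => [x| |] [y| |] //=; first by rewrite lte_fin; exact: rr.
- move=> _; have [|q /andP[h _]] := rr x (x + 1)%R; first by rewrite ltrDl.
  by exists q; rewrite h ltry.
- move=> _; have [|q /andP[_ h]] := rr (y - 1)%R y; first by rewrite gtrDl oppr_lt0.
  by exists q; rewrite h ltNyr.
- by move=> _; exists 0%R; rewrite ltry ltNyr.
Qed.

Lemma mwrt_ereal (Y : Om -> \bar R) :
  (forall a : R, G [set w | Y w <= a%:E]) -> measurable_wrt G Y.
Proof.
move=> mY O oO.
have gt (a : R) : G [set w | a%:E < Y w].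
  by apply: sa_ext (sa_not sG (mY a)) => w; rewrite ltNge; split=> /negP.
have lt (a : R) : G [set w | Y w < a%:E].
  apply: (@sa_ext _ G (fun w => exists q : rat, (ratr q < a)%R /\ Y w <= (ratr q)%:E)).
    move=> w; split=> [[q [qa /le_lt_trans]]|/rat_between[q /andP[/ltW Yq qa]]].
      by apply; rewrite lte_fin.
    by exists q; split.
  by apply: sa_ex => // q; apply: sa_and => //; exact: sa_const.

pose P (pq : rat * rat) w := (ratr pq.1)%:E < Y w /\ Y w < (ratr pq.2)%:E.
apply: (@sa_ext _ G (fun w => (exists pq : rat * rat,
   (forall y, (ratr pq.1)%:E < y -> y < (ratr pq.2)%:E -> O y) /\ P pq w) \/
   ((exists q : rat, (forall y, (ratr q)%:E < y -> O y) /\ (ratr q)%:E < Y w) \/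
   (exists q : rat, (forall y, y < (ratr q)%:E -> O y) /\ Y w < (ratr q)%:E)))); last first.
  apply: sa_or => //; last apply: sa_or => //; apply: sa_ex => // q; apply: sa_and => //;
    try exact: sa_const.
  exact: (sa_and sG (gt _) (lt _)).
move=> w; split=> [[[pq [h [p q]]]|[[q [h p]]|[q [h p]]]]|OY]; try exact: h.
have := open_nbhs_nbhs (conj oO OY); case E : (Y w) => [y| |].
- move=> nO; have /nbhs_ballP[e /= e0 he] : nbhs (y : R) [set z | O z%:E] by exact: nO.
  left.
  have [|p] := @rat_in_itvoo R (y - e) y; first by rewrite gtrDl oppr_lt0.
  have [|q] := @rat_in_itvoo R y (y + e); first by rewrite ltrDl.
  rewrite !in_itv/= => /andP[q1 q2] /andP[p1 p2].
  exists (p, q); split; last by rewrite /P E !lte_fin.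
  move=> [z| |] //=; rewrite !lte_fin => pz zq; apply: he => /=.
  by rewrite /ball/= ltr_norml; apply/andP; split; lra.
- move=> [M [_ hM]]; right; left.
  have [q /andP[Mq _]] := @rat_between M%:E +oo (ltry _).
  exists q; split; last by rewrite ltry.
  by move=> y qy; apply: hM; exact: lt_trans qy.
- move=> [M [_ hM]]; right; right.
  have [q /andP[_ Mq]] := @rat_between -oo M%:E (ltNyr _).
  exists q; split; last by rewrite ltNyr.
  by move=> y qy; apply: hM; exact: lt_trans Mq.
Qed.

Lemma mwrt_le (Y Z : Om -> \bar R) : measurable_wrt G Y -> measurable_wrt G Z ->
  G [set w | Y w <= Z w].
Proof.
move=> mY mZ; have h : G [set w | exists q : rat, (ratr q)%:E < Y w /\ Z w < (ratr q)%:E].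
  by apply: sa_ex => // q; apply: sa_and => //; [exact: mwrt_ereal_gt|exact: mwrt_ereal_lt].
apply: sa_ext (sa_not sG h) => w; split=> [nYZ|YZ [q [qY Zq]]].
  rewrite leNgt; apply/negP => /rat_between[q /andP[Zq qY]]; apply: nYZ.
  by exists q; split.
by have := lt_le_trans (lt_trans Zq qY) YZ; rewrite ltxx.
Qed.

End measurable_wrt_ereal.

Section measurable_wrt_sub.
Context {R : realType} {d : measure_display} {Om : measurableType d}.
Variables (G : set (set Om)) (sG : sigma_algebra setT G) (GF : G `<=` measurable).
Local Open Scope ereal_scope.

Lemma sub_mwrt {V : topologicalType} (H : set (set Om)) (Y : Om -> V) :
  G `<=` H -> measurable_wrt G Y -> measurable_wrt H Y.
Proof. by move=> GH mY O /mY/GH. Qed.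

Lemma mwrt_measurable_ereal (Y : Om -> \bar R) : measurable_wrt G Y ->
  measurable_fun setT Y.
Proof.
move=> mY; apply: (measurability (@ErealGenCInfty.G R)).
  exact: ErealGenCInfty.measurableE.
move=> _ [_ [x ->] <-]; rewrite setTI; apply: GF.
have := mwrt_ereal_ge sG x%:E mY; congr G; apply/seteqP.
by split=> w /=; rewrite in_itv/= andbT.
Qed.

Lemma mwrt_measurable (Y : Om -> R^o) : measurable_wrt G Y ->
  measurable_fun setT (Y : Om -> R).
Proof.
move=> mY; apply: (measurability (@RGenOInfty.G R)).
  exact: RGenOInfty.measurableE.
move=> _ [_ [x ->] <-]; rewrite setTI; apply: GF.
have : open [set y : R^o | (x < y)%R] by exact: open_gt.
move=> /mY; congr G; apply/seteqP.
by split=> w /=; rewrite in_itv/= andbT.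
Qed.

End measurable_wrt_sub.

Section measurable_fun_mwrt.
Context {R : realType} {d : measure_display} {Om : measurableType d}.
Local Open Scope ereal_scope.

Lemma sigma_algebra_measurable_sets : sigma_algebra setT (@measurable d Om).
Proof. exact: sigma_algebra_measurable. Qed.

Lemma measurable_mwrt_ereal (Y : Om -> \bar R) : measurable_fun setT Y ->
  measurable_wrt measurable Y.
Proof.
move=> mY; apply: mwrt_ereal; first exact: sigma_algebra_measurable_sets.
move=> a; have := mY measurableT _ (emeasurable_itv `]-oo, a%:E]).
by rewrite setTI; congr measurable; apply/seteqP; split=> w /=; rewrite in_itv.
Qed.

End measurable_fun_mwrt.

Lemma mwrt_EFin {R : realType} {d : measure_display} {Om : measurableType d}
    (G : set (set Om)) (Y : Om -> R^o) :
  sigma_algebra setT G -> measurable_wrt G Y <-> measurable_wrt G (EFin \o Y).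
Proof.
move=> sG; split=> mY.
  apply: (mwrt_ereal sG) => a.
  have : G [set w | ~ (a < Y w)%R].
    by apply: sa_not => //; exact: (mY _ (@open_gt _ a)).
  by congr G; apply/seteqP; split=> w /=; rewrite lee_fin leNgt => /negP.
move=> O oO; have := mY [set y | exists2 x, O x & y = x%:E].
have h : open [set y | exists2 x, O x & y = x%:E].
  rewrite openE => _ [x Ox ->]; have := open_nbhs_nbhs (conj oO Ox).
  by apply: filterS => y Oy; exists y.
move=> /(_ h); congr G; apply/seteqP; split=> w /=; last by exists (Y w).
by move=> [x Ox [->]].
Qed.

(** * Conditional expectation of random variables *)

Section lower_bounded_integrals.
Context {R : realType} {d : measure_display} {Om : measurableType d}.
Variable P : probability Om R.
Local Open Scope ereal_scope.
Implicit Types f g : Om -> \bar R.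

(** Only the negative part is controlled: integrals take values in []-oo, +oo]], and additivity
    holds even when one of them is [+oo]. *)
Definition integrably_bounded f : Prop :=
  exists2 m : Om -> R, P.-integrable setT (EFin \o m) & {ae P, forall w, (m w)%:E <= f w}.

Lemma ae_le_integral (D : set Om) f g : measurable D ->
  measurable_fun D f -> measurable_fun D g ->
  {ae P, forall w, D w -> f w <= g w} ->
  \int[P]_(w in D) f w <= \int[P]_(w in D) g w.
Proof.
move=> mD mf mg fg; rewrite integralE (integralE _ _ g) leeB//.
  apply: ae_ge0_le_integral => //; try exact: measurable_funepos.
  by apply: filterS fg => w h /h fgw; rewrite !funeposE ge_max !le_max fgw lexx orbT.
apply: ae_ge0_le_integral => //; try exact: measurable_funeneg.
by apply: filterS fg => w h /h fgw; rewrite !funenegE ge_max !le_max leeN2 fgw lexx orbT.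
Qed.

Lemma integrably_bounded_integrable f g (D : set Om) : measurable D ->
  integrably_bounded f -> measurable_fun D f -> P.-integrable D g ->
  {ae P, forall w, D w -> f w <= g w} -> P.-integrable D f.
Proof.
move=> mD [m im mlf] mf ig fg; have mg := measurable_int _ ig.
have im' : P.-integrable D (EFin \o m) by exact: integrableS im.
have h : P.-integrable D (fun w => `|g w| + `|(m w)%:E|).
  by apply: integrableD => //; exact: integrable_abse.
apply/integrableP; split=> //; move/integrableP : h => [mh]; apply: le_lt_trans.
apply: ae_le_integral => //; try exact: measurableT_comp.
apply: filterS2 fg mlf => w h1 h2 Dw; have {}h1 := h1 Dw.
rewrite [leRHS]gee0_abs ?adde_ge0//.
have [f0|f0] := leP 0 (f w).
  by rewrite gee0_abs// (le_trans h1)// (le_trans (lee_abs _))// leeDl.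
rewrite lte0_abs// (@le_trans _ _ (- (m w)%:E))// ?leeN2//.
by rewrite (le_trans (lee_abs _))// abseN leeDr.
Qed.

Lemma integrably_bounded_pinfty f (D : set Om) : measurable D ->
  integrably_bounded f -> measurable_fun D f -> ~ P.-integrable D f ->
  \int[P]_(w in D) f w = +oo.
Proof.
move=> mD [m im mlf] mf nf.
have im' : P.-integrable D (EFin \o m) by exact: integrableS im.
have neg : \int[P]_(w in D) f^\- w < +oo.
  have /integrableP[_] := im'; apply: le_lt_trans.
  apply: ae_ge0_le_integral => //; try exact: measurable_funeneg.
    by apply: measurableT_comp => //; exact: measurable_int im'.
  apply: filterS mlf => w h Dw; rewrite funenegE ge_max abse_ge0 andbT.
  by rewrite (@le_trans _ _ (- (m w)%:E))// ?leeN2// (le_trans (lee_abs _))// abseN.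
have neg0 : 0 <= \int[P]_(w in D) f^\- w by exact: integral_ge0.
have pos : \int[P]_(w in D) f^\+ w = +oo.
  apply: contrapT => /eqP; rewrite -ltey => pos; apply: nf; apply/integrableP; split=> //.
  under eq_integral do rewrite -[`|_|]/((abse \o f) _) fune_abse.
  rewrite ge0_integralD//.
  - by rewrite lte_add_pinfty.
  - exact: measurable_funepos.
  - exact: measurable_funeneg.
rewrite integralE pos addye//; move: neg neg0; case: (integral _ _ _) => //.
Qed.

Lemma integrably_bounded_gtNy f (D : set Om) : measurable D ->
  integrably_bounded f -> measurable_fun D f -> -oo < \int[P]_(w in D) f w.
Proof.
move=> mD lf mf; have [/integrable_fin_num|] := pselect (P.-integrable D f).
  by move=> /(_ mD)/fineK <-; rewrite ltNyr.
by move=> /(integrably_bounded_pinfty mD lf mf) ->.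
Qed.

Lemma integrably_bounded_ae_gtNy f : integrably_bounded f -> {ae P, forall w, -oo < f w}.
Proof. by move=> [m _]; apply: filterS => w; apply: lt_le_trans; rewrite ltNyr. Qed.

Lemma integrably_boundedD f g : integrably_bounded f -> integrably_bounded g ->
  integrably_bounded (fun w => f w + g w).
Proof.
move=> [m im mlf] [m' im' mlg]; exists (fun w => m w + m' w)%R.
  by rewrite (_ : _ \o _ = (EFin \o m) \+ (EFin \o m'))//; exact: integrableD.
by apply: filterS2 mlf mlg => w h h'; rewrite EFinD leeD.
Qed.

(** If [f] is not integrable, neither is the sum, because the sum minus an integrable minorant of
    [g] dominates [f]; both sides are then [+oo]. *)
Lemma integralD_integrably_bounded f g (D : set Om) : measurable D ->
  integrably_bounded f -> integrably_bounded g ->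
  measurable_fun D f -> measurable_fun D g ->
  \int[P]_(w in D) (f w + g w) = \int[P]_(w in D) f w + \int[P]_(w in D) g w.
Proof.
move=> mD; wlog nf : f g / ~ P.-integrable D f.
  move=> W lf lg mf mg; have [if_|nf] := pselect (P.-integrable D f); last exact: W.
  have [ig|ng] := pselect (P.-integrable D g); first exact: integralD.
  by under eq_integral do rewrite addeC; rewrite W// addeC.
move=> lf lg mf mg; rewrite (integrably_bounded_pinfty mD lf mf nf) addye; last first.
  by rewrite -ltNye integrably_bounded_gtNy.
have mfg : measurable_fun D (fun w => f w + g w) by exact: emeasurable_funD.
apply: integrably_bounded_pinfty => //; first exact: integrably_boundedD.
move=> ifg; apply: nf; have [m im mlg] := lg.
have im' : P.-integrable D (EFin \o m) by exact: integrableS im.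
apply: (@integrably_bounded_integrable _ (fun w => (f w + g w) - (m w)%:E)) => //.
  exact: integrableB.
have := integrably_bounded_ae_gtNy lf; apply: filterS2 mlg => w mg' f0 _.
by rewrite leeBrDr// leeD2l.
Qed.

End lower_bounded_integrals.

Section conditional_expectation.
Context {R : realType} {d : measure_display} {Om : measurableType d}.
Variable P : probability Om R.
Variables (G : set (set Om)) (sG : sigma_algebra setT G) (GF : G `<=` measurable).
Local Open Scope ereal_scope.

Lemma ae_all_count {I : countType} (Q : I -> Om -> Prop) :
  (forall i, {ae P, forall w, Q i w}) -> {ae P, forall w, forall i, Q i w}.
Proof.
move=> h; have : {ae P, forall w, forall n : nat, if unpickle n is Some i then Q i w else True}.
  by apply: ae_foralln => n; case: (unpickle n) => [i|]; [exact: h|exact: aeW].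
by apply: filterS => w hw i; have := hw (pickle i); rewrite pickleK.
Qed.

(** On the part of [B] where [V <= q < r <= U], with rational [q] and [r], the hypothesis gives
    [r P(A) <= q P(A)], so this event is null, and countably many such events cover [V < U].
    Comparison with constants keeps infinite integrals out of the argument. *)
Lemma ae_le_of_integral (B : Om -> Prop) (U V : Om -> \bar R) :
  measurable_wrt G U -> measurable_wrt G V -> G [set w | B w] ->
  (forall A, G A -> (forall w, A w -> B w) ->
     \int[P]_(w in A) U w <= \int[P]_(w in A) V w) ->
  {ae P, forall w, B w -> U w <= V w}.
Proof using sG GF.
move=> mU mV mB h.
have key (q r : rat) : (ratr q < ratr r :> R)%R ->
    {ae P, forall w, B w -> V w <= (ratr q)%:E -> ~ (ratr r)%:E <= U w}.
  move=> qr; pose A := [set w | B w /\ (V w <= (ratr q)%:E /\ (ratr r)%:E <= U w)].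
  have GA : G A.
    by apply: sa_and => //; apply: sa_and => //; [exact: mwrt_ereal_le|exact: mwrt_ereal_ge].
  have mA := GF GA.
  have PA : P A = 0.
    have hU : (ratr r)%:E * P A <= \int[P]_(w in A) U w.
      rewrite -integral_cst//; apply: ae_le_integral => //.
        by apply: measurable_funTS; exact: mwrt_measurable_ereal mU.
      by apply: aeW => w [_ []].
    have hV : \int[P]_(w in A) V w <= (ratr q)%:E * P A.
      rewrite -integral_cst//; apply: ae_le_integral => //.
        by apply: measurable_funTS; exact: mwrt_measurable_ereal mV.
      by apply: aeW => w [_ []].
    have := le_trans hU (le_trans (h A GA (fun w h => h.1)) hV).
    have fA : P A \is a fin_num by exact: fin_num_measure.
    rewrite -(fineK fA) -!EFinM lee_fin => hA; congr (_%:E); apply/eqP.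
    rewrite eq_le fine_ge0// andbT leNgt; apply/negP => A0.
    by move: hA; rewrite leNgt ltr_pM2r// qr.
  exists A; split=> // w /= hw; apply: contrapT => nA; apply: hw => Bw Vq rU.
  by apply: nA.
have {}key (qr : rat * rat) : {ae P, forall w, (ratr qr.1 < ratr qr.2 :> R)%R ->
    B w -> V w <= (ratr qr.1)%:E -> ~ (ratr qr.2)%:E <= U w}.
  have [qr'|/negbTE n] := boolP (ratr qr.1 < ratr qr.2 :> R)%R; last by exact: aeW.
  by have := key _ _ qr'; apply: filterS => w.
apply: filterS (ae_all_count key) => w hw Bw; rewrite leNgt; apply/negP => VU.
have [r /andP[Vr rU]] := rat_between VU; have [q /andP[Vq qr]] := rat_between Vr.
exact: (hw (q, r) qr Bw (ltW Vq) (ltW rU)).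
Qed.

(** [Y] is the Radon-Nikodym derivative of the signed measure with density [Z], restricted to [G],
    with respect to [P] restricted to [G]. Both restrictions are images under the identity map onto
    the space equipped with [G]. *)
Lemma cond_expectation_integrable (Z : Om -> R) : P.-integrable setT (EFin \o Z) ->
  exists Y : Om -> R^o, [/\ measurable_wrt G Y, P.-integrable setT (EFin \o Y) &
    cond_expectation P G (EFin \o Z) (EFin \o Y)].
Proof using sG GF.
move=> iZ; pose GT := g_sigma_algebraType G.
have mGE : @measurable _ GT = G by exact: sigma_algebra_id.
have mid : measurable_fun setT (id : Om -> GT).
  by move=> _ A; rewrite mGE setTI preimage_id; exact: GF.
pose phi_mixin := isMeasurableFun.Build _ _ _ _ (id : Om -> GT) mid.
pose phi : {mfun Om >-> GT} := HB.pack (id : Om -> GT) phi_mixin.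
pose mu : probability GT R := distribution P phi.
pose nu : {charge set GT -> \bar R} :=
  measure_function_pushforward__canonical__charge_Charge (induced_charge iZ) mid.
have numu : nu `<< mu.
  apply/null_content_dominatesP => A mA muA.
  have mA' : measurable (A : set Om) by apply: GF; rewrite -mGE.
  apply: null_set_integral => //.
  by apply: measurable_funTS; exact: measurable_int iZ.
pose Y := Radon_Nikodym nu mu.
have Yfin w : Y w \is a fin_num by exact: Radon_Nikodym_fin_num.
have iY : mu.-integrable setT Y by exact: Radon_Nikodym_integrable.
have mY : measurable_fun setT Y := measurable_int _ iY.
have GY : measurable_wrt G Y.
  by have := @measurable_mwrt_ereal R _ GT Y mY; rewrite mGE.
have YE : EFin \o (fine \o Y) = Y by apply/funext => w /=; rewrite fineK.
have iPY : P.-integrable setT (Y : Om -> \bar R).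
  have /integrableP[_ hi] := iY; apply/integrableP; split.
    exact: (mwrt_measurable_ereal sG GF GY).
  move: hi; rewrite /mu/distribution ge0_integral_pushforward//.
  exact: measurableT_comp.
exists (fine \o Y); rewrite YE; split=> //.
  by apply/(mwrt_EFin _ sG); rewrite YE.
split=> // A GA; have mA : @measurable _ GT A by rewrite mGE.
have iPA : P.-integrable (phi @^-1` A) (Y \o phi).
  by apply: integrableS iPY => //; exact: GF.
have := @Radon_Nikodym_integral _ GT R nu mu A numu mA.
rewrite /mu /distribution.
by rewrite (@integral_pushforward _ _ Om GT R id mid P A Y mY iPA mA) => <-.
Qed.

End conditional_expectation.

(** * Caratheodory maps and composition with normal integrands *)

Section caratheodory.
Context {R : realType} {d : measure_display} {Om : measurableType d}.
Variables (G : set (set Om)) (sG : sigma_algebra setT G).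

Lemma mwrt_real_le (f : Om -> R^o) :
  (forall a : R, G [set w | f w <= a]) -> measurable_wrt G f.
Proof.
move=> h; apply/(mwrt_EFin _ sG); apply: (mwrt_ereal sG) => a.
by have := h a; congr G; apply/seteqP; split=> w /=; rewrite lee_fin.
Qed.

(** The complement of an open set is a constant random closed set, its preimage under [f] is a
    random closed set as well, and membership of a measurable point in such a set is an event. *)
Lemma mwrt_caratheodory {V W : normedModType R} {pV : proper V} {pW : proper W}
    (f : V -> Om -> W) (x : Om -> V) : (forall w, continuous (f ^~ w)) ->
  (forall v, measurable_wrt G (f v)) -> measurable_wrt G x ->
  measurable_wrt G (fun w => f (x w) w).
Proof.
move=> cf mf mx O oO; have cl : closed (~` O) by exact: open_closedC.
have rO : random_set G (fun w => [set v | (~` O) (f v w)]).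
  exact: (random_set_preimage sG (random_set_cst sG cl) cf mf).
have h : G [set w | (~` O) (f (x w) w)] by exact: (random_set_mem sG rO mx).
move: h => /(sa_not sG); apply: sa_ext => w /=.
by split; [exact: contrapT|move=> ? ?].
Qed.

Lemma normal_integrand_mwrt {V : normedModType R} {pV : proper V}
    (h : V -> Om -> \bar R) (x : Om -> V) :
  normal_integrand G h -> measurable_wrt G x ->
  measurable_wrt G (fun w => h (x w) w).
Proof.
move=> nh mx; apply: (mwrt_ereal sG) => a.
have rh : random_set G (fun w => epi (h ^~ w)) by exact: nh.
exact: (random_set_mem sG rh (mwrt_pair sG mx (mwrt_cst sG (a : R^o)))).
Qed.

End caratheodory.

Section conditional_expectation_bounded.
Context {R : realType} {d : measure_display} {Om : measurableType d}.
Variable P : probability Om R.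
Variables (G : set (set Om)) (sG : sigma_algebra setT G) (GF : G `<=` measurable).

Lemma integrable_bounded_fun (f : Om -> R) (k : R) (D : set Om) : measurable D ->
  measurable_fun setT f -> (forall w, 0 <= f w <= k) -> P.-integrable D (EFin \o f).
Proof.
move=> mD mf hf; apply: measurable_bounded_integrable => //.
- by rewrite (le_lt_trans (probability_le1 _ _))// ltry.
- exact: measurable_funTS.
- exists k; split; first exact: num_real.
  by move=> M kM w _ /=; have /andP[f0 fk] := hf w; rewrite ger0_norm// (le_trans fk)// ltW.
Qed.

(** Truncation makes the bounds hold at every outcome; the extension from a dense sequence relies on
    that. *)
Lemma cond_expectation_bounded (Z : Om -> R) (k : R) : measurable_fun setT Z ->
  (forall w, 0 <= Z w <= k) ->
  exists Y : Om -> R^o, [/\ measurable_wrt G Y, forall w, 0 <= Y w <= k &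
    forall A, G A -> (\int[P]_(w in A) (Y w)%:E = \int[P]_(w in A) (Z w)%:E)%E].
Proof using sG GF.
move=> mZ hZ; have iZ := integrable_bounded_fun measurableT mZ hZ.
have [Y [mY iY [_ hY]]] := cond_expectation_integrable sG GF iZ.
have k0 : 0 <= k by have /andP[] := hZ point; exact: le_trans.
have mYE : measurable_wrt G (EFin \o Y) by apply/(mwrt_EFin _ sG).
have [mF mk] : measurable_wrt G (fun=> 0%E : \bar R) /\ measurable_wrt G (fun=> k%:E).
  by split; exact: mwrt_cst.
have mZT A : measurable_fun A (EFin \o Z).
  by apply: measurable_funTS; exact/measurable_EFinP.
have mYT A : measurable_fun A (EFin \o Y).
  by apply: measurable_funTS; exact: mwrt_measurable_ereal mYE.
have Y0 : {ae P, forall w, True -> (0 <= (Y w)%:E)%E}.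
  apply: (ae_le_of_integral sG GF mF mYE); first exact: sa_const.
  move=> A GA _; rewrite hY//; apply: ae_le_integral => //; first exact: GF.
  by apply: aeW => w _ /=; rewrite lee_fin; have /andP[] := hZ w.
have Yk : {ae P, forall w, True -> ((Y w)%:E <= k%:E)%E}.
  apply: (ae_le_of_integral sG GF mYE mk); first exact: sa_const.
  move=> A GA _; rewrite hY//; apply: ae_le_integral => //; first exact: GF.
  by apply: aeW => w _ /=; rewrite lee_fin; have /andP[] := hZ w.
exists (fun w => Num.min k (Num.max 0 (Y w))); split.
- apply: (mwrt_real_le sG) => a.
  have := sa_or sG (sa_const sG (k <= a)) (sa_and sG (sa_const sG (0 <= a)) (mwrt_ereal_le sG a%:E mYE)).
  apply: sa_ext => w /=; rewrite lee_fin ge_min ge_max.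
  by split=> [[->//|[-> ->]]|/orP[ka|/andP[a0 ya]]]; rewrite ?orbT; [|left|right].
- by move=> w; rewrite le_min k0 le_max lexx/= ge_min lexx.
- move=> A GA; rewrite -hY//; have mA := GF GA.
  have h : {ae P, forall w, Num.min k (Num.max 0 (Y w)) = Y w}.
    apply: filterS2 Y0 Yk => w /(_ I) + /(_ I); rewrite !lee_fin => y0 yk.
    by rewrite max_r// min_r.
  apply: ae_eq_integral => //.
    apply: measurable_funTS; apply/measurable_EFinP.
    apply: measurable_minr => //; apply: measurable_maxr => //.
    exact (mwrt_measurable GF mY).
  by apply: filterS h => w -> _.
Qed.

(** A random point is replaced by the first dense point within [1/(n+1)]. The latter takes countably
    many values, so the identity holds for it piecewise, and the Lipschitz bounds control the error
    by [k/(n+1)] on either side. *)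
Lemma integral_lipschitz_eq {V : normedModType R} {pV : proper V} (q : nat -> V)
    (f g : V -> Om -> R^o) (k : nat) :
  (forall x e, 0 < e -> exists n, `|x - q n| < e) ->
  (forall w x y, `|f x w - f y w| <= k%:R * `|x - y|) ->
  (forall w x y, `|g x w - g y w| <= k%:R * `|x - y|) ->
  (forall w x, 0 <= f x w <= k%:R) -> (forall w x, 0 <= g x w <= k%:R) ->
  (forall x, measurable_wrt G (f x)) -> (forall x, measurable_wrt measurable (g x)) ->
  (forall A i, G A -> \int[P]_(w in A) (f (q i) w)%:E = \int[P]_(w in A) (g (q i) w)%:E)%E ->
  forall (x : Om -> V) A, measurable_wrt G x -> G A ->
    (\int[P]_(w in A) (f (x w) w)%:E = \int[P]_(w in A) (g (x w) w)%:E)%E.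
Proof using sG GF.
move=> hq lf lg bf bg mf mg fg x A mx GA; have mA := GF GA.
have sF := @sigma_algebra_measurable_sets _ Om.
have lip_cont (u : V -> Om -> R^o) w : (forall w x y, `|u x w - u y w| <= k%:R * `|x - y|) ->
    continuous (u ^~ w).
  by move=> lu; exact: lipschitz_continuous_norm (lu w).
have mx' : measurable_wrt measurable x := sub_mwrt GF mx.
have mfx y : measurable_wrt G y -> measurable_fun setT (fun w => f (y w) w : R).
  move=> my; refine (mwrt_measurable GF _); apply: mwrt_caratheodory => // w.
  exact: lip_cont.
have mgx y : measurable_wrt G y -> measurable_fun setT (fun w => g (y w) w : R).
  move=> my; refine (mwrt_measurable (@subset_refl _ _) _).
  by apply: mwrt_caratheodory => // [w|]; [exact: lip_cont|exact: sub_mwrt my].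
pose idx (n : nat) w := least (fun i => `|x w - q i| < n.+1%:R^-1).
have midx n j : G [set w | idx n w = j].
  by apply: least_measurable => // i; exact: (mx _ (open_nball (q i) n.+1%:R^-1)).
have idxP n w : `|x w - q (idx n w)| < n.+1%:R^-1.
  have [|h _] := @least_spec (fun i => `|x w - q i| < n.+1%:R^-1); last exact: h.
  exact/hq/inv_gt0.
have mqidx n : measurable_wrt G (fun w => q (idx n w)).
  move=> O oO; apply: (@sa_ext _ G (fun w => exists i, idx n w = i /\ O (q i))).
    by move=> w; split=> [[i [<-]]|]//; exists (idx n w).
  by apply: sa_ex => // i; apply: sa_and => //; exact: sa_const.
have split_int (u : V -> Om -> R^o) n : (forall w x, 0 <= u x w <= k%:R) ->
    measurable_fun setT (fun w => u (q (idx n w)) w : R) ->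
    (\int[P]_(w in A) (u (q (idx n w)) w)%:E =
     \sum_(0 <= i <oo) \int[P]_(w in A `&` [set w | idx n w = i]) (u (q i) w)%:E)%E.
  move=> bu mu; have AE : A = \bigcup_i (A `&` [set w | idx n w = i]).
    apply/seteqP; split=> w; last by move=> [i _ []].
    by move=> Aw; exists (idx n w).
  rewrite [in LHS]AE ge0_integral_bigcup//.
  - apply: eq_eseriesr => i _; apply: eq_integral => w.
    by rewrite inE/= => -[_ <-].
  - by move=> i; apply: measurableI => //; exact/GF/midx.
  - by apply: measurable_funTS; exact/measurable_EFinP.
  - by move=> w _; rewrite lee_fin; have /andP[] := bu w (q (idx n w)).
  - by apply/trivIsetP => i j _ _ ij; apply/seteqP; split=> w //= [[_ ->] [_ /eqP]]; rewrite (negbTE ij).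
have step n : (\int[P]_(w in A) (f (q (idx n w)) w)%:E = \int[P]_(w in A) (g (q (idx n w)) w)%:E)%E.
  rewrite split_int ?split_int//; [|exact: mgx|exact: mfx].
  apply: eq_eseriesr => i _; apply: fg.
  exact: (sa_and sG GA (midx n i)).
have close (u : V -> Om -> R^o) n : (forall w x y, `|u x w - u y w| <= k%:R * `|x - y|) ->
    (forall w x, 0 <= u x w <= k%:R) ->
    (forall y, measurable_wrt G y -> measurable_fun setT (fun w => u (y w) w : R)) ->
    (`|\int[P]_(w in A) (u (x w) w)%:E - \int[P]_(w in A) (u (q (idx n w)) w)%:E|
      <= (k%:R * n.+1%:R^-1)%:E)%E.
  move=> lu bu mu; have i1 := integrable_bounded_fun mA (mu _ mx) (fun w => bu w (x w)).
  have i2 := integrable_bounded_fun mA (mu _ (mqidx n)) (fun w => bu w (q (idx n w))).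
  rewrite -integralB// (le_trans (le_abse_integral _ _ _))//.
    by apply: emeasurable_funB; [exact: measurable_int i1|exact: measurable_int i2].
  apply: (@le_trans _ _ (\int[P]_(w in A) (k%:R * n.+1%:R^-1)%:E)%E).
    apply: ge0_le_integral => //.
      apply: measurableT_comp => //.
      by apply: emeasurable_funB; [exact: measurable_int i1|exact: measurable_int i2].
    move=> w _; rewrite -EFinB abse_EFin lee_fin (le_trans (lu _ _ _))//.
    by rewrite ler_wpM2l// ltW// idxP.
  rewrite integral_cst// muleC gee_pMl ?lee_fin ?mulr_ge0//; first exact: fin_num_measure.
  exact: probability_le1.
have fin (u : V -> Om -> R^o) y : measurable_wrt G y -> (forall w x, 0 <= u x w <= k%:R) ->
    (forall y, measurable_wrt G y -> measurable_fun setT (fun w => u (y w) w : R)) ->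
    (\int[P]_(w in A) (u (y w) w)%:E)%E \is a fin_num.
  move=> my bu mu; apply: integrable_fin_num => //.
  exact: (integrable_bounded_fun mA (mu _ my) (fun w => bu w (y w))).
rewrite -(fineK (fin f _ mx bf mfx)) -(fineK (fin g _ mx bg mgx)); congr (_%:E).
apply/eqP; rewrite -subr_eq0 -normr_le0; apply/ler_addgt0Pr => e e0; rewrite add0r.
have [n /(_ _ (leqnn n)) hn] := @small_natV R (e / 2) k%:R (half_gt0 e0).
have := close f n lf bf mfx; have := close g n lg bg mgx.
rewrite -(fineK (fin f _ mx bf mfx)) -(fineK (fin g _ mx bg mgx)) (step n).
rewrite -(fineK (fin g _ (mqidx n) bg mgx)) -!EFinB !abse_EFin !lee_fin.
move: (fine _) (fine _) (fine _) => a b c.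
have := ler_distD b a c; rewrite (distrC b c).
by move: (k%:R * _) hn => z; norm_lra.
Qed.

End conditional_expectation_bounded.

(** * Conditional expectation of normal integrands *)

Section lipschitz_regularization.
Context {R : realType} {d : measure_display} {Om : measurableType d}.
Variables (G : set (set Om)) (sG : sigma_algebra setT G).
Context {V : normedModType R} {pV : proper V}.

(** These are the Pasch-Hausdorff envelopes [inf_y (h y + k |x - y|)], truncated at [k]. They
    increase to [h] because [h] is lower semicontinuous and nonnegative. *)
Lemma lipschitz_regularization (h : V -> Om -> \bar R) :
  normal_integrand G h -> (forall x w, (0 <= h x w)%E) ->
  exists f : nat -> V -> Om -> R^o,
    [/\ forall k w x, 0 <= f k x w <= k%:R,
        forall k w x y, `|f k x w - f k y w| <= k%:R * `|x - y|,
        forall k x w, f k x w <= f k.+1 x w,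
        forall k x, measurable_wrt G (f k x) &
        forall x w, h x w = ereal_sup (range (fun k => (f k x w)%:E))].
Proof using sG.
move=> [ch mh] h0.
(* The extra element [k] performs the truncation and keeps the infimum meaningful where [h] is
   identically [+oo]. *)
pose A (k : nat) x w : set R :=
  [set r | r = k%:R \/ exists y b, (h y w <= b%:E)%E /\ r = b + k%:R * `|x - y|].
pose f (k : nat) x w : R^o := inf (A k x w).
have Ak k x w : A k x w k%:R by left.
have A0 k x w r : A k x w r -> 0 <= r.
  move=> [->//|[y [b [hb ->]]]]; rewrite addr_ge0//.
  by rewrite -lee_fin; exact: le_trans hb.
have lbA k x w : has_lbound (A k x w) by exists 0 => r; exact: A0.
have iA k x w : has_inf (A k x w) by split=> //; exists k%:R; exact: Ak.
have f_le k x w r : A k x w r -> f k x w <= r by move=> Ar; exact: ge_inf.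
have f_ge k x w r : (forall a, A k x w a -> r <= a) -> r <= f k x w.
  by move=> h'; apply: lb_le_inf => //; exists k%:R.
exists f; split.
- move=> k w x; rewrite f_le//= andbT; apply: f_ge; exact: A0.
- move=> k w; have half x y : f k x w - f k y w <= k%:R * `|x - y|.
    rewrite lerBlDr -lerBlDl; apply: f_ge => a [->|[z [b [hz ->]]]].
      by rewrite lerBlDl (le_trans (f_le _ _ _ _ (Ak k x w)))// lerDr mulr_ge0.
    rewrite lerBlDl; apply: le_trans (_ : b + k%:R * `|x - z| <= _).
      by apply: f_le; right; exists z, b.
    by rewrite addrCA lerD2l -mulrDr ler_wpM2l// ler_distD.
  by move=> x y; rewrite ler_norml half andbT lerNl opprB distrC half.
- move=> k x w; apply: f_ge => a [->|[y [b [hy ->]]]].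
    by rewrite (le_trans (f_le _ _ _ _ (Ak k x w)))// ler_nat.
  rewrite (@le_trans _ _ (b + k%:R * `|x - y|))//; first by apply: f_le; right; exists y, b.
  by rewrite lerD2l ler_wpM2r// ler_nat.
- move=> k x; apply: (mwrt_real_le sG) => a.
  have lt (r : R) : G [set w | f k x w < r].
    apply: (@sa_ext _ G (fun w => k%:R < r \/
      epi (h ^~ w) `&` [set p : V * R^o | p.2 + k%:R * `|x - p.1| < r] !=set0)).
      move=> w; split=> [[kr|[[y b] [/= hy br]]]|/(inf_lt (iA k x w).1)[s [->|[y [b [hy ->]]]] sr]].
      + exact: le_lt_trans (f_le _ _ _ _ (Ak k x w)) kr.
      + by apply: le_lt_trans br; apply: f_le; right; exists y, b.
      + by left.
      + by right; exists (y, b).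
    apply: sa_or => //; first exact: sa_const.
    apply: mh; apply/open_normE => -[y b] /= yr.
    (* Moving [(y, b)] by less than [e] raises [b + k |x - y|] by less than [e + k e], which is the
       available slack. *)
    pose e := (r - (b + k%:R * `|x - y|)) / k.+1%:R.
    have ek : e + k%:R * e = r - (b + k%:R * `|x - y|).
      by rewrite -[X in X + _]mul1r -mulrDl addrC natr1 mulrC divfK.
    exists e; first by rewrite divr_gt0// subr_gt0.
    move=> [z c]; rewrite prod_normE gt_max /= => /andP[yz bc].
    have h1 := ler_norm (c - b); rewrite distrC in h1.
    have : k%:R * `|x - z| <= k%:R * (`|x - y| + `|y - z|) by rewrite ler_wpM2l// ler_distD.
    have : k%:R * `|y - z| <= k%:R * e by rewrite ler_wpM2l// ltW.
    rewrite mulrDr; move: (k%:R * e) (k%:R * `|x - y|) (k%:R * `|y - z|) (k%:R * `|x - z|) ek.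
    by clear -h1 bc; clearbody e => *; norm_lra.
  apply: (@sa_ext _ G (fun w => forall n, f k x w < a + n.+1%:R^-1)); last exact: sa_all.
  move=> w; split=> [h'|fa n]; last by rewrite (le_lt_trans fa)// ltrDl invr_gt0.
  apply/ler_addgt0Pr => e e0; have [n /(_ _ (leqnn n)) hn] := small_inv e0.
  by rewrite ltW// (lt_trans (h' n))// ltrD2l.
- move=> x w; apply/eqP; rewrite eq_le; apply/andP; split; last first.
    apply: ge_ereal_sup => _ [k _ <-].
    case E : (h x w) => [b| |]; last by have := h0 x w; rewrite E.
      rewrite lee_fin; apply: f_le; right; exists x, b; rewrite E lexx; split=> //.
      by rewrite subrr normr0 mulr0 addr0.
    by rewrite leey.
  rewrite leNgt; apply/negP => /rat_between[q /andP[sq qh]]; set a : R := ratr q in sq qh.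
  have /closed_normE clh := ch w.
  have [e e0 he] : exists2 e, 0 < e & forall y b, `|x - y| < e -> b <= a -> ~ (h y w <= b%:E)%E.
    apply: contrapT => /forall2NP he; have : epi (h^~ w) (x, a).
      apply: clh => e e0; have [//|] := he e.
      move=> /existsNP[y /existsNP[b /not_implyP[xy /not_implyP[ba /contrapT hy]]]].
      exists (y, a); first by rewrite /epi/= (le_trans hy)// lee_fin.
      by rewrite prod_normE /= subrr normr0 gt_max xy e0.
    by rewrite /epi/= leNgt qh.
  (* Beyond distance [e] the penalty alone reaches [a], and within it [h] exceeds [a]; [a <= k]
     keeps the truncation out of the way. *)
  have [k hk] : exists k : nat, a <= k%:R /\ a <= k%:R * e.
    exists (Num.truncn (Num.max a (a / e))).+1.
    have := truncnS_gt (Num.max a (a / e)); rewrite gt_max => /andP[/ltW -> /ltW].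
    by rewrite ler_pdivrMr.
  have : a <= f k x w.
    apply: f_ge => r [->|[y [b [hy ->]]]]; first by have [] := hk.
    have [xy|xy] := ltP `|x - y| e.
      have [/(he y b xy)//|/ltW ab] := leP b a.
      by rewrite (le_trans ab)// lerDl mulr_ge0.
    have [_ ake] := hk; rewrite (le_trans ake)// (@le_trans _ _ (k%:R * `|x - y|))//.
      by rewrite ler_wpM2l.
    by rewrite lerDr -lee_fin; exact: le_trans hy.
  move=> af; move: sq; rewrite ltNge => /negP; apply.
  by apply: le_ereal_sup_tmp; exists (f k x w)%:E; [exists k|rewrite lee_fin].
Qed.

End lipschitz_regularization.

Lemma random_set_normal_integrand {R : realType} {d : measure_display}
    {Om : measurableType d} {V : topologicalType} (G : set (set Om))
    (S : Om -> set (V * R^o)) (h : V -> Om -> \bar R) :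
  (forall w p, S w p <-> epi (h ^~ w) p) -> random_set G S -> normal_integrand G h.
Proof.
move=> SE; rewrite (_ : S = fun w => epi (h ^~ w))//.
by apply/funext => w; apply/seteqP; split=> p /SE.
Qed.

Section conditional_integrand_existence.
Context {R : realType} {d : measure_display} {Om : measurableType d}.
Variable P : probability Om R.
Variables (G : set (set Om)) (sG : sigma_algebra setT G) (GF : G `<=` measurable).
Context {V : normedModType R} {pV : proper V}.

(* Conditional expectations are only taken at the points of a dense sequence, and
   modified on a null set to be [k]-Lipschitz there; this extends them to [V]. *)
Lemma lipschitz_extension (q : nat -> V) (k : R) (c : nat -> Om -> R^o) : 0 <= k ->
  (forall x e, 0 < e -> exists n, `|x - q n| < e) ->
  (forall i w, 0 <= c i w <= k) ->
  (forall i j w, c i w - c j w <= k * `|q i - q j|) ->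
  (forall i, measurable_wrt G (c i)) ->
  let g (x : V) w : R^o := sup (range (fun i => c i w - k * `|x - q i|)) in
  [/\ forall w x, 0 <= g x w <= k,
      forall w x y, `|g x w - g y w| <= k * `|x - y|,
      forall i w, g (q i) w = c i w &
      forall x, measurable_wrt G (g x)].
Proof using sG.
move=> k0 hq bc lc mc g.
pose B (x : V) w : set R := range (fun i => c i w - k * `|x - q i|).
have ubB x w : has_ubound (B x w).
  exists k => _ [i _ <-]; have /andP[_ ck] := bc i w.
  by rewrite lerBlDr (le_trans ck)// lerDl mulr_ge0.
have B0 x w : B x w !=set0 by exists (c 0%N w - k * `|x - q 0%N|); exists 0%N.
have g_ge x w i : c i w - k * `|x - q i| <= g x w.
  by apply: (@ub_le_sup R (B x w)) => //; exists i.
have g_le x w r : (forall i, c i w - k * `|x - q i| <= r) -> g x w <= r.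
  by move=> h; apply: (@ge_sup R (B x w)) => // _ [i _ <-].
split.
- move=> w x; apply/andP; split.
    apply/ler_addgt0Pr => e e0; have e1 : 0 < e / (k + 1) by rewrite divr_gt0// ltr_wpDl.
    have [i /ltW hi] := hq x _ e1; have := g_ge x w i.
    have /andP[+ _] := bc i w.
    have : k * `|x - q i| <= e.
      rewrite (@le_trans _ _ (k * (e / (k + 1))))// ?ler_wpM2l//.
      by rewrite mulrA ler_pdivrMr ?ltr_wpDl// mulrDr mulr1 (mulrC k) lerDl ltW.
    by move: (k * _) => z; norm_lra.
  apply: g_le => i; have /andP[_ ck] := bc i w.
  by rewrite lerBlDr (le_trans ck)// lerDl mulr_ge0.
- move=> w; have half x y : g x w - g y w <= k * `|x - y|.
    rewrite lerBlDr; apply: g_le => i; have := g_ge y w i.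
    have : k * `|y - q i| <= k * (`|x - y| + `|x - q i|).
      by rewrite ler_wpM2l// (distrC x y) ler_distD.
    rewrite mulrDr; move: (k * `|y - _|) (k * `|x - y|) (k * `|x - q i|).
    by move=> *; norm_lra.
  by move=> x y; rewrite ler_norml half andbT lerNl opprB distrC half.
- move=> i w; apply/eqP; rewrite eq_le; apply/andP; split.
    by apply: g_le => j; rewrite lerBlDr -lerBlDl distrC lc.
  by have := g_ge (q i) w i; rewrite subrr normr0 mulr0 subr0.
- move=> x; apply: (mwrt_real_le sG) => a.
  apply: (@sa_ext _ G (fun w => forall i, c i w - k * `|x - q i| <= a)).
    by move=> w; split=> [|ga i]; [exact: g_le|exact: le_trans (g_ge x w i) ga].
  apply: sa_all => // i.
  have /(_ (a + k * `|x - q i|)%:E) := @mwrt_ereal_le _ _ _ G sG (EFin \o c i) _.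
  move=> /(_ ((mwrt_EFin _ sG).1 (mc i))); apply: sa_ext => w.
  by rewrite /= lee_fin lerBlDr.
Qed.

Lemma ereal_sup_cvg_monotone (A : set Om) (f : nat -> Om -> R) : measurable A ->
  (forall k, measurable_fun setT (f k)) -> (forall k w, 0 <= f k w) ->
  (forall k w, f k w <= f k.+1 w) ->
  (\int[P]_(w in A) (f k w)%:E)%E @[k --> \oo] -->
    (\int[P]_(w in A) ereal_sup (range (fun k => (f k w)%:E)))%E.
Proof.
move=> mA mf f0 fS.
have nd w : nondecreasing_seq (fun k => (f k w)%:E).
  by apply/nondecreasing_seqP => k; rewrite lee_fin.
have -> : (\int[P]_(w in A) ereal_sup (range (fun k => (f k w)%:E)) =
   \int[P]_(w in A) limn (fun k => (f k w)%:E))%E.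
  apply: eq_integral => w _; apply/esym/cvg_lim => //.
  exact: ereal_nondecreasing_cvgn.
apply: (@cvg_monotone_convergence _ _ _ _ _ _ (fun k w => (f k w)%:E)) => //.
- by move=> k; apply: measurable_funTS; exact/measurable_EFinP.
- by move=> k w _; rewrite lee_fin.
Qed.

(** Besides the Lipschitz bounds, the conditional expectations must increase in [k] at every
    outcome, so both properties are imposed through the [G]-event [good] of full probability.
    Monotone convergence on either side then passes from the regularisations to [h]. *)
Lemma cond_integrand_nonneg (h : V -> Om -> \bar R) :
  normal_integrand measurable h -> (forall x w, (0 <= h x w)%E) ->
  exists2 g : V -> Om -> \bar R, cond_integrand P G h g & forall x w, (0 <= g x w)%E.
Proof using sG GF pV.
move=> nh h0; have sF := @sigma_algebra_measurable_sets _ Om.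
have [f [bf lf ndf mf fE]] := lipschitz_regularization sF nh h0.
have [q hq] := @dense_seq _ _ pV.
have ex (ki : nat * nat) : exists Y : Om -> R^o, [/\ measurable_wrt G Y,
    forall w, 0 <= Y w <= ki.1%:R & forall A, G A ->
    (\int[P]_(w in A) (Y w)%:E = \int[P]_(w in A) (f ki.1 (q ki.2) w)%:E)%E].
  apply: cond_expectation_bounded => //.
  exact (mwrt_measurable (@subset_refl _ _) (mf _ _)).
have /choice[c0 hc0] := ex.
pose good w := (forall k i j, c0 (k, i) w - c0 (k, j) w <= k%:R * `|q i - q j|) /\
  (forall k i, c0 (k, i) w <= c0 (k.+1, i) w).
have mc0 ki : measurable_wrt G (EFin \o c0 ki).
  by apply/(mwrt_EFin _ sG); have [] := hc0 ki.
have mc0F ki A : measurable_fun A (EFin \o c0 ki).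
  by apply: measurable_funTS; exact: mwrt_measurable_ereal (mc0 ki).
have mfq k i A : measurable_fun A (fun w => (f k (q i) w)%:E).
  apply: measurable_funTS; apply/measurable_EFinP.
  exact (mwrt_measurable (@subset_refl _ _) (mf _ _)).
have mcD (ki : nat * nat) (a : R) : measurable_wrt G (fun w => (c0 ki w + a)%:E).
  apply: (mwrt_ereal sG) => b.
  have := mwrt_ereal_le sG (b - a)%:E (mc0 ki); apply: sa_ext => w.
  by rewrite /= !lee_fin lerBrDr.
have Ggood : G [set w | good w].
  apply: sa_and => //.
    apply: sa_all => // k; apply: sa_all => // i; apply: sa_all => // j.
    have := mwrt_le sG (mc0 (k, i)) (mcD (k, j) (k%:R * `|q i - q j|)).
    by apply: sa_ext => w; rewrite /= lee_fin lerBlDl.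
  apply: sa_all => // k; apply: sa_all => // i.
  have := mwrt_le sG (mc0 (k, i)) (mc0 (k.+1, i)).
  by apply: sa_ext => w; rewrite /= lee_fin.
have aegood : {ae P, forall w, good w}.
  have h1 : {ae P, forall w, forall kij : nat * nat * nat,
      ((c0 (kij.1.1, kij.1.2) w)%:E <=
       (c0 (kij.1.1, kij.2) w + kij.1.1%:R * `|q kij.1.2 - q kij.2|)%:E)%E}.
    apply: ae_all_count => -[[k i] j] /=.
    have : {ae P, forall w, True -> ((c0 (k, i) w)%:E <=
       (c0 (k, j) w + k%:R * `|q i - q j|)%:E)%E}; last by apply: filterS => w; exact.
    apply: (ae_le_of_integral sG GF (mc0 _) (mcD _ _) (sa_const sG True)).
    move=> A GA _; have mA := GF GA; have [_ _ hi] := hc0 (k, i); have [_ bj hj] := hc0 (k, j).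
    under [leRHS]eq_integral do rewrite EFinD.
    rewrite ge0_integralD//; last first.
    - exact: mc0F.
    - by move=> w _; rewrite lee_fin; have /andP[] := bj w.
    rewrite hi// hj// -ge0_integralD//; last first.
    - by move=> w _; rewrite lee_fin; have /andP[] := bf k w (q j).
    apply: ge0_le_integral => //.
    - by move=> w _; rewrite lee_fin; have /andP[] := bf k w (q i).
    - by apply: emeasurable_funD => //; exact: mfq.
    - move=> w _; rewrite -EFinD lee_fin -lerBlDl.
      exact: le_trans (ler_norm _) (lf _ _ _ _).
  have h2 : {ae P, forall w, forall ki : nat * nat,
      ((c0 (ki.1, ki.2) w)%:E <= (c0 (ki.1.+1, ki.2) w)%:E)%E}.
    apply: ae_all_count => -[k i] /=.
    have : {ae P, forall w, True -> ((c0 (k, i) w)%:E <= (c0 (k.+1, i) w)%:E)%E};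
      last by apply: filterS => w; exact.
    apply: (ae_le_of_integral sG GF (mc0 _) (mc0 _) (sa_const sG True)).
    move=> A GA _; have mA := GF GA; have [_ _ hi] := hc0 (k, i); have [_ _ hj] := hc0 (k.+1, i).
    rewrite hi// hj//; apply: ge0_le_integral => //.
    - by move=> w _; rewrite lee_fin; have /andP[] := bf k w (q i).
    - by move=> w _; rewrite lee_fin.
  apply: filterS2 h1 h2 => w h1 h2; split=> [k i j|k i].
    by have := h1 (k, i, j); rewrite /= lee_fin lerBlDl.
  by have := h2 (k, i); rewrite /= lee_fin.
pose c k i w : R^o := if pselect (good w) then c0 (k, i) w else 0.
have bc k i w : 0 <= c k i w <= k%:R.
  rewrite /c; case: pselect => _ /=; last by rewrite lexx ler0n.
  by have [_ /(_ w)] := hc0 (k, i).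
have lc k i j w : c k i w - c k j w <= k%:R * `|q i - q j|.
  rewrite /c; case: pselect => /= [[h1 _]|_]; first exact: h1.
  by rewrite subr0 mulr_ge0.
have mc k i : measurable_wrt G (c k i).
  apply: mwrt_if => //; last exact: mwrt_cst.
  by have [] := hc0 (k, i).
have ic k i A : G A -> (\int[P]_(w in A) (c k i w)%:E = \int[P]_(w in A) (f k (q i) w)%:E)%E.
  move=> GA; have mA := GF GA; have [_ _ <- //] := hc0 (k, i).
  apply: ae_eq_integral => //.
    apply: measurable_funTS; apply: (mwrt_measurable_ereal sG GF).
    by apply/(mwrt_EFin _ sG); exact: mc.
    exact: mc0F.
  by apply: filterS aegood => w gw _; rewrite /c; case: pselect.
pose g k (x : V) w : R^o := sup (range (fun i => c k i w - k%:R * `|x - q i|)).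
have ext k : [/\ forall w x, 0 <= g k x w <= k%:R,
      forall w x y, `|g k x w - g k y w| <= k%:R * `|x - y|,
      forall i w, g k (q i) w = c k i w & forall x, measurable_wrt G (g k x)].
  exact: (lipschitz_extension (ler0n R k) hq (bc k) (lc k) (mc k)).
have bg k w x : 0 <= g k x w <= k%:R by have [] := ext k.
have lg k w x y : `|g k x w - g k y w| <= k%:R * `|x - y| by have [] := ext k.
have gq k i w : g k (q i) w = c k i w by have [] := ext k.
have mg k x : measurable_wrt G (g k x) by have [] := ext k.
have lip_cont k w : continuous (g k ^~ w) by exact: lipschitz_continuous_norm (lg k w).
(* Monotonicity in [k] is known at the dense points and passes to the others by the two Lipschitz
   bounds, whose constants add up to [k + (k+1)]. *)
have ndg k x w : g k x w <= g k.+1 x w.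
  apply/ler_addgt0Pr => e e0; have e1 : 0 < e / (k%:R + k.+1%:R) by rewrite divr_gt0// ltr_wpDl.
  have [i hi] := hq x _ e1.
  have h1 := lg k w x (q i); have h2 := lg k.+1 w (q i) x.
  have h3 : g k (q i) w <= g k.+1 (q i) w.
    by rewrite !gq /c; case: pselect => //= -[_].
  have h4 : k%:R * `|x - q i| + k.+1%:R * `|x - q i| <= e.
    by rewrite -mulrDl mulrC -ler_pdivlMr ?ltW// ltr_wpDl.
  rewrite (distrC (q i)) in h2.
  have := le_trans (ler_norm _) h1; have := le_trans (ler_norm _) h2.
  move: (k%:R * _) (k.+1%:R * _) h4 => u v; clear -h3; clearbody g => *; norm_lra.
have eqfg k x A : measurable_wrt G x -> G A ->
    (\int[P]_(w in A) (g k (x w) w)%:E = \int[P]_(w in A) (f k (x w) w)%:E)%E.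
  move=> mx GA; apply: (integral_lipschitz_eq sG GF hq (lg k) (lf k) (bg k) (bf k) (mg k) (mf k)) => //.
  by move=> A' i GA'; under eq_integral do rewrite gq; exact: ic.
exists (fun x w => ereal_sup (range (fun k => (g k x w)%:E))); last first.
  move=> x w; apply: le_ereal_sup_tmp; exists (g 0%N x w)%:E; first by exists 0%N.
  by rewrite lee_fin; have /andP[] := bg 0%N w x.
have supE x w (a : R) : (ereal_sup (range (fun k => (g k x w)%:E)) <= a%:E)%E <->
    forall k, g k x w <= a.
  split=> [h' k|h'].
    by rewrite -lee_fin; apply: le_trans h'; apply: ereal_sup_ubound; exists k.
  by apply: ge_ereal_sup => _ [k _ <-]; rewrite lee_fin.
split.
  have cl : closed [set y : R^o | 0 <= y] by exact: closed_ge.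
  have cg k w : continuous (fun xa : V * R^o => xa.2 - g k xa.1 w : R^o).
    move=> xa; apply: cvgB; first exact: cvg_snd.
    by apply: (cvg_comp fst (g k ^~ w)); [exact: cvg_fst|exact: lip_cont].
  have mgk k (xa : V * R^o) : measurable_wrt G (fun w => xa.2 - g k xa.1 w : R^o).
    have : continuous (fun r : R^o => xa.2 - r : R^o).
      by move=> r; apply: cvgB; [exact: cvg_cst|exact: cvg_id].
    by move=> /mwrt_comp; apply; exact: mg.
  have : random_set G (fun w => [set xa : V * R^o |
      forall k : nat, [set y : R^o | 0 <= y] (xa.2 - g k xa.1 w)]).
    exact: (@random_set_preimages R d Om G sG _ _ _ _ (fun _ _ => [set y : R^o | 0 <= y])
      (fun k (xa : V * R^o) w => xa.2 - g k xa.1 w) (fun=> random_set_cst sG cl) cg mgk).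
  apply: random_set_normal_integrand => w [x a]; split=> [h'|/supE h' k].
    by apply/supE => k; rewrite -subr_ge0; exact: h'.
  by rewrite /= subr_ge0; exact: h'.
move=> x mx; have mgx k : measurable_wrt G (fun w => g k (x w) w).
  exact: mwrt_caratheodory.
have mxF : measurable_wrt measurable x := sub_mwrt GF mx.
split.
  apply: (mwrt_ereal sG) => a.
  apply: (@sa_ext _ G (fun w => forall k, g k (x w) w <= a)); first by move=> w; rewrite supE.
  apply: sa_all => // k.
  have := mwrt_ereal_le sG a%:E ((mwrt_EFin _ sG).1 (mgx k)).
  by apply: sa_ext => w; rewrite /= lee_fin.
move=> A GA; have mA := GF GA.
have c1 := @ereal_sup_cvg_monotone A (fun k w => g k (x w) w) mA
  (fun k => mwrt_measurable GF (mgx k)).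
have c2 := @ereal_sup_cvg_monotone A (fun k w => f k (x w) w) mA.
under [RHS]eq_integral do rewrite fE.
have g0 k w : 0 <= g k (x w) w by have /andP[] := bg k w (x w).
have f0 k w : 0 <= f k (x w) w by have /andP[] := bf k w (x w).
have mfx k : measurable_fun setT (fun w => f k (x w) w : R).
  refine (mwrt_measurable (@subset_refl _ _) _).
  by apply: mwrt_caratheodory => // w; exact: lipschitz_continuous_norm (lf k w).
have {}c1 := c1 g0 (fun k w => ndg k (x w) w).
have {}c2 := c2 mfx f0 (fun k w => ndf k (x w) w).
have E : (fun k => \int[P]_(w in A) (g k (x w) w)%:E)%E =
    (fun k => \int[P]_(w in A) (f k (x w) w)%:E)%E by apply/funext => k; exact: eqfg.
by rewrite E in c1; rewrite -(cvg_lim _ c1)// -(cvg_lim _ c2).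
Qed.

End conditional_integrand_existence.

(** * Existence, uniqueness and lower bounds of conditional integrands *)

Section conditional_integrand_properties.
Context {R : realType} {d : measure_display} {Om : measurableType d}.
Variable P : probability Om R.
Variables (G : set (set Om)) (sG : sigma_algebra setT G) (GF : G `<=` measurable).
Context {V : normedModType R} {pV : proper V}.

Lemma random_set_epi (h : V -> Om -> \bar R) (H : set (set Om)) :
  normal_integrand H h -> random_set H (fun w => epi (h ^~ w)).
Proof. by []. Qed.

Lemma normal_integrand_shift (H : set (set Om)) (h : V -> Om -> \bar R) (m : Om -> R^o) :
  sigma_algebra setT H -> normal_integrand H h -> measurable_wrt H m ->
  normal_integrand H (fun x w => h x w + (m w)%:E)%E.
Proof using pV.
move=> sH nh mm.
apply: (@random_set_normal_integrand _ _ _ _ H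
  (fun w => [set xa : V * R^o | epi (h ^~ w) (xa.1, xa.2 - m w)])).
  by move=> w [x a]; rewrite /epi/= EFinB leeBrDr.
apply: (@random_set_preimage _ _ _ H sH _ _ _ _ (fun w => epi (h ^~ w))
  (fun (xa : V * R^o) w => (xa.1, xa.2 - m w) : V * R^o)) => //.
  move=> w; apply: continuous_pair; first exact: continuous_fst.
  by apply: continuousB; [exact: continuous_snd|exact: continuous_cst].
move=> [x a] /=; apply: mwrt_pair => //; first exact: mwrt_cst.
have c : continuous (fun r : R^o => a - r : R^o).
  by apply: continuousB; [exact: continuous_cst|exact: continuous_id].
exact: (mwrt_comp c mm).
Qed.

Lemma normal_integrand_maxr0 (H : set (set Om)) (h : V -> Om -> \bar R) :
  sigma_algebra setT H -> normal_integrand H h ->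
  normal_integrand H (fun x w => maxe (h x w) 0).
Proof using pV.
move=> sH nh; have cl : closed [set y : R^o | 0 <= y] by exact: closed_ge.
apply: (@random_set_normal_integrand _ _ _ _ H (fun w => [set xa : V * R^o |
   (epi (h ^~ w) `*` [set y : R^o | 0 <= y]) (xa, xa.2)])).
  by move=> w [x a]; rewrite /epi/= ge_max; split=> [[->]|/andP[]//].
apply: (@random_set_preimage _ _ _ H sH (V * R^o)%type ((V * R^o) * R^o)%type _ _
    (fun w => epi (h ^~ w) `*` [set y : R^o | 0 <= y]) (fun (xa : V * R^o) w => (xa, xa.2))).
- by apply: random_set_prod => //; exact: random_set_cst.
- by move=> w; apply: continuous_pair; [exact: continuous_id|exact: continuous_snd].
- by move=> xa; exact: mwrt_cst.
Qed.

Lemma mwrt_of_integrable (m : Om -> R) : P.-integrable setT (EFin \o m) ->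
  measurable_wrt measurable (m : Om -> R^o).
Proof.
move=> /measurable_int im; apply/(mwrt_EFin _ (@sigma_algebra_measurable_sets _ Om)).
exact: measurable_mwrt_ereal.
Qed.

Lemma lower_bounded_comp (h : V -> Om -> \bar R) (x : Om -> V) :
  lower_bounded P h -> integrably_bounded P (fun w => h (x w) w).
Proof. by move=> [m im mh]; exists m => //; apply: filterS mh => w; exact. Qed.

Lemma normal_measurable_comp (h : V -> Om -> \bar R) (x : Om -> V) (A : set Om) :
  normal_integrand measurable h -> measurable_wrt measurable x ->
  measurable_fun A (fun w => h (x w) w).
Proof using pV.
move=> nh mx; have sF := @sigma_algebra_measurable_sets _ Om.
apply: measurable_funTS; apply: (mwrt_measurable_ereal sF (@subset_refl _ _)).
exact: normal_integrand_mwrt.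
Qed.

(** The integrable minorant is subtracted and its conditional expectation added back. As [m] is a
    minorant only almost surely, the maximum with [0] ensures nonnegativity at every outcome. *)
Theorem cond_integrand_exists (h : V -> Om -> \bar R) :
  normal_integrand measurable h -> lower_bounded P h ->
  exists g, cond_integrand P G h g.
Proof using sG GF pV.
move=> nh [m im mh]; have sF := @sigma_algebra_measurable_sets _ Om.
have mm := mwrt_of_integrable im.
have mNm : measurable_wrt measurable (fun w => - m w : R^o) by exact: mwrtN mm.
pose h0 x w := maxe (h x w + (- m w)%:E)%E 0%E.
have nh0 : normal_integrand measurable h0.
  exact: (normal_integrand_maxr0 sF (normal_integrand_shift sF nh mNm)).
have [|g0 [ng0 hg0] g00] := cond_integrand_nonneg P sG GF nh0.
  by move=> x w; rewrite /h0 le_max lexx orbT.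
have [M [mM iM [_ hM]]] := cond_expectation_integrable sG GF im.
exists (fun x w => g0 x w + (M w)%:E)%E; split; first exact: normal_integrand_shift.
move=> x mx; have mxF : measurable_wrt measurable x := sub_mwrt GF mx.
split; first exact: normal_integrand_mwrt (normal_integrand_shift sG ng0 mM) mx.
move=> A GA; have mA := GF GA.
have bm : integrably_bounded P (EFin \o m) by exists m => //; exact: aeW.
have bM : integrably_bounded P (EFin \o M) by exists M => //; exact: aeW.
have b0 (u : Om -> \bar R) : (forall w, 0 <= u w)%E -> integrably_bounded P u.
  move=> u0; exists (fun=> 0); first by have := integrable0 P (@setT Om); congr integrable.
  exact: aeW.
have mg0 : measurable_fun A (fun w => g0 (x w) w).
  apply: measurable_funTS; apply: (mwrt_measurable_ereal sG GF).
  exact: normal_integrand_mwrt.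
have mh0 : measurable_fun A (fun w => h0 (x w) w) by exact: normal_measurable_comp.
have mmA : measurable_fun A (EFin \o m).
  by apply: measurable_funTS; exact: measurable_int im.
have mMA : measurable_fun A (EFin \o M).
  by apply: measurable_funTS; exact: measurable_int iM.
rewrite (integralD_integrably_bounded mA (b0 _ (fun w => g00 (x w) w)) bM)//.
have [_ ->//] := hg0 x mx; rewrite hM//.
rewrite -(integralD_integrably_bounded mA _ bm)//; last first.
  by apply: b0 => w; rewrite /h0 le_max lexx orbT.
apply: ae_eq_integral => //; first by apply: emeasurable_funD.
  exact: normal_measurable_comp.
apply: filterS mh => w hw _; rewrite /h0 /= max_l.
  by rewrite EFinN subeK.
by rewrite EFinN sube_ge0// hw.
Qed.

Lemma cond_expectation_bounded_below (Z Y : Om -> \bar R) (m : Om -> R) :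
  measurable_fun setT Z -> P.-integrable setT (EFin \o m) ->
  {ae P, forall w, (m w)%:E <= Z w}%E ->
  forall M : Om -> R^o, measurable_wrt G M -> cond_expectation P G (EFin \o m) (EFin \o M) ->
  cond_expectation P G Z Y -> {ae P, forall w, (M w)%:E <= Y w}%E.
Proof using sG GF.
move=> mZ im mZm M mM [_ hM] [mY hY].
have : {ae P, forall w, True -> (EFin \o M) w <= Y w}%E; last by apply: filterS => w; exact.
apply: (ae_le_of_integral sG GF _ mY (sa_const sG True)); first exact/(mwrt_EFin _ sG).
move=> A GA _; rewrite hM// hY//; have mA := GF GA.
apply: ae_le_integral => //; try exact: measurable_funTS.
- by apply: measurable_funTS; exact: measurable_int im.
- by apply: filterS mZm.
Qed.

Lemma lee_real (x y : \bar R) : (forall a : R, (y <= a%:E -> x <= a%:E)%E) -> (x <= y)%E.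
Proof.
move=> h; rewrite leNgt; apply/negP => /rat_between[q /andP[yq qx]].
by have := h _ (ltW yq); rewrite leNgt qx.
Qed.

(* A Castaing representation of the epigraph reduces an almost sure inequality
   between functions to countably many inequalities between random variables. *)
Lemma ae_le_of_selection (g g' : V -> Om -> \bar R) :
  normal_integrand G g -> normal_integrand G g' ->
  (forall x, measurable_wrt G x -> {ae P, forall w, g' (x w) w <= g (x w) w}%E) ->
  {ae P, forall w, forall x, g' x w <= g x w}%E.
Proof using sG pV.
move=> ng ng' hgg; have [p [mp Sp dp]] := castaing sG (random_set_epi ng).
have h n : {ae P, forall w, g' (p n w).1 w <= g (p n w).1 w}%E.
  apply: (hgg (fun w => (p n w).1)).
  exact: (mwrt_comp (fun z => @cvg_fst _ _ _ _ _) (mp n)).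
apply: filterS (ae_foralln h) => w hw x; apply: lee_real => a gxa.
have [cl' _] := ng'; apply: ((closed_normE _).1 (cl' w) (x, a)) => e e0.
have [n hn] := dp w (x, a) e gxa e0; exists (p n w) => //.
rewrite /epi/=; apply: le_trans (hw n) _.
by apply: (Sp w n); exists (x, a).
Qed.

Lemma cond_integrand_unique (h h' g g' : V -> Om -> \bar R) :
  normal_integrand measurable h -> normal_integrand measurable h' ->
  {ae P, forall w, forall x, h x w = h' x w} ->
  cond_integrand P G h g -> cond_integrand P G h' g' ->
  {ae P, forall w, forall x, g x w = g' x w}.
Proof using sG GF pV.
move=> nh nh' hh' [ng hg] [ng' hg'].
have le (x : Om -> V) : measurable_wrt G x -> forall A, G A ->
    (\int[P]_(w in A) g (x w) w = \int[P]_(w in A) g' (x w) w)%E.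
  move=> mx A GA; have mA := GF GA.
  have mxF : measurable_wrt measurable x := sub_mwrt GF mx.
  have [_ ->//] := hg x mx; have [_ ->//] := hg' x mx.
  apply: ae_eq_integral => //; try exact: normal_measurable_comp.
  by apply: filterS hh' => w hw _; exact: hw.
have l1 : {ae P, forall w, forall x, g' x w <= g x w}%E.
  apply: ae_le_of_selection => // x mx.
  have : {ae P, forall w, True -> g' (x w) w <= g (x w) w}%E; last by apply: filterS => w; exact.
  apply: (ae_le_of_integral sG GF _ _ (sa_const sG True)); try exact: normal_integrand_mwrt.
  by move=> A GA _; rewrite le.
have l2 : {ae P, forall w, forall x, g x w <= g' x w}%E.
  apply: ae_le_of_selection => // x mx.
  have : {ae P, forall w, True -> g (x w) w <= g' (x w) w}%E; last by apply: filterS => w; exact.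
  apply: (ae_le_of_integral sG GF _ _ (sa_const sG True)); try exact: normal_integrand_mwrt.
  by move=> A GA _; rewrite le.
by apply: filterS2 l1 l2 => w h1 h2 x; apply/eqP; rewrite eq_le h1 h2.
Qed.

Lemma cond_integrand_lower_bounded (h g : V -> Om -> \bar R) :
  normal_integrand measurable h -> lower_bounded P h -> cond_integrand P G h g ->
  lower_bounded P g.
Proof using sG GF pV.
move=> nh [m im mh] [ng hg]; have [M [mM iM hM]] := cond_expectation_integrable sG GF im.
exists M => //.
(* [M], as a function constant in [x], is a shift of the zero integrand, whence the summand [0]. *)
have nM : normal_integrand G (fun (x : V) w => 0 + (M w)%:E)%E.
  apply: normal_integrand_shift => //.
  have cl : closed ((snd : V * R^o -> R^o) @^-1` [set y | 0 <= y]).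
    by apply: preimage_closed => [x _|]; [exact: continuous_snd|exact: closed_ge].
  by apply: random_set_normal_integrand (random_set_cst sG cl) => w [x a]; rewrite /epi/= lee_fin.
have := ae_le_of_selection ng nM; move=> h1.
have {}h1 : {ae P, forall w, forall x, 0 + (M w)%:E <= g x w}%E.
  apply: h1 => x mx; have mxF : measurable_wrt measurable x := sub_mwrt GF mx.
  have := cond_expectation_bounded_below (normal_measurable_comp nh mxF) im _ mM hM (hg x mx).
  have h2 : {ae P, forall w, (m w)%:E <= h (x w) w}%E by apply: filterS mh => w; exact.
  by move=> /(_ h2); apply: filterS => w; rewrite add0e.
by apply: filterS h1 => w h1 x; have := h1 x; rewrite add0e.
Qed.

End conditional_integrand_properties.

(** * Convexity and recession of conditional expectations *)

Lemma convex_efunE {R : realType} {V : normedModType R} (g : V -> \bar R) :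
  convex_efun g <-> convexS (epi g).
Proof.
split=> [cg x y t gx gy /andP[t0 t1]|cg x y t /set_mem gx /set_mem gy].
  have t01 : Itv.spec (Itv.num_sem (R := R)) (Itv.Real `[0%Z, 1%Z]) t.
    by rewrite /Itv.spec/= /Itv.num_sem/= num_real in_itv/= t0.
  by have := cg x y (Itv.mk t01); rewrite !inE => /(_ gx gy).
by apply/mem_set; apply: (cg x y t%:num) => //; rewrite ge0 le1.
Qed.

(** This is the form in which convexity can be derived from countably many almost sure
    inequalities. *)
Lemma convexS_dense_rat {R : realType} {V : normedModType R} (C : set V) (p : nat -> V) :
  closed C -> (forall v (e : R), C v -> 0 < e -> exists n, `|v - p n| < e) ->
  (forall n m (q : rat), 0 < (ratr q : R) < 1 -> C (ratr q *: p n + (1 - ratr q) *: p m)) ->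
  convexS C.
Proof.
move=> clC dp hC x y t Cx Cy /andP[]; rewrite le_eqVlt => /predU1P[<- _|t0].
  by rewrite scale0r add0r subr0 scale1r.
rewrite le_eqVlt => /predU1P[->|t1]; first by rewrite subrr scale0r addr0 scale1r.
apply/(closed_normE C).1 => // e e0.
(* The rational weight exceeds [t] by less than [r]: it stays below [1] and costs at most [e/2]
   through the factor [|x - y|]. *)
pose r := Num.min ((e / 2) / (`|x - y| + 1)) (1 - t).
have r0 : 0 < r by rewrite lt_min subr_gt0 t1 andbT divr_gt0 ?half_gt0// ltr_wpDl.
have [q] := @rat_in_itvoo R t (t + r) ltac:(by rewrite ltrDl).
rewrite in_itv/= => /andP[tq qr].
have q0 : 0 < (ratr q : R) by exact: lt_trans tq.
have q1 : (ratr q : R) < 1.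
  by apply: lt_le_trans qr _; rewrite -lerBrDl ge_min lexx orbT.
have [n hn] := dp x _ Cx (half_gt0 e0); have [m hm] := dp y _ Cy (half_gt0 e0).
have : C (ratr q *: p n + (1 - ratr q) *: p m) by apply: hC; rewrite q0.
move: (ratr q) tq qr q0 q1 => s tq qr q0 q1 Cs.
exists (s *: p n + (1 - s) *: p m) => //.
have -> : t *: x + (1 - t) *: y - (s *: p n + (1 - s) *: p m) =
    (t - s) *: (x - y) + (s *: (x - p n) + (1 - s) *: (y - p m)).
  have -> : t *: x + (1 - t) *: y = (t - s) *: (x - y) + (s *: x + (1 - s) *: y).
    by rewrite !conv_combE addrCA -scalerDl subrK.
  by rewrite -addrA; congr (_ + _); rewrite opprD addrACA -!scalerBr.
have h1 : `|(t - s) *: (x - y)| < e / 2.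
  rewrite normrZ ltr0_norm ?subr_lt0// opprB.
  have : (s - t) * (`|x - y| + 1) < e / 2.
    rewrite -ltr_pdivlMr ?ltr_wpDl//; rewrite ltrBlDl (lt_le_trans qr)// lerD2l.
    by rewrite ge_min lexx.
  apply: le_lt_trans; rewrite ler_wpM2l ?subr_ge0 ?(ltW tq)// lerDl//.
have h2 : `|s *: (x - p n) + (1 - s) *: (y - p m)| <= e / 2.
  apply: le_trans (ler_normD _ _) _; rewrite !normrZ !gtr0_norm ?subr_gt0//.
  rewrite (@le_trans _ _ (s * (e / 2) + (1 - s) * (e / 2)))//.
    by rewrite lerD// ler_wpM2l ?subr_ge0// ltW.
  by rewrite -mulrDl subrKC mul1r.
rewrite (splitr e); apply: le_lt_trans (ler_normD _ _) _.
exact: ltr_leD.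
Qed.

Lemma convex_efun_le {R : realType} {V : normedModType R} (g : V -> \bar R) (x y : V) (t : R) :
  convex_efun g -> 0 < t < 1 -> -oo%E != g x -> -oo%E != g y ->
  (g (t *: x + (1 - t) *: y)%R <= t%:E * g x + (1 - t)%:E * g y)%E.
Proof.
move=> /convex_efunE cg /andP[t0 t1]; have t1' : 0 < 1 - t by rewrite subr_gt0.
case Ex : (g x) => [a| |//]; case Ey : (g y) => [b| |//] _ _.
- have := cg (x, a) (y, b) t; rewrite /epi/= Ex Ey => /(_ (lexx _) (lexx _)).
  by rewrite (ltW t0) (ltW t1) => /(_ isT); rewrite -EFinM -EFinD.
- by rewrite gt0_muley ?lte_fin// addey ?leey.
- by rewrite gt0_muley ?lte_fin// addye ?leey.
- by rewrite !gt0_muley ?lte_fin// addye ?leey.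
Qed.

Section measurable_wrt_operations.
Context {R : realType} {d : measure_display} {Om : measurableType d}.
Variables (G : set (set Om)) (sG : sigma_algebra setT G).
Local Open Scope ereal_scope.

(** On the space equipped with the sigma-algebra [G], the usual arithmetic of measurable functions
    becomes available for [measurable_wrt]. *)
Lemma mwrt_erealE (Y : Om -> \bar R) :
  measurable_wrt G Y <-> measurable_fun setT (Y : g_sigma_algebraType G -> \bar R).
Proof.
have E : @measurable _ (g_sigma_algebraType G) = G by exact: sigma_algebra_id.
split=> [mY|/measurable_mwrt_ereal]; last by rewrite E.
have sE := @sigma_algebra_measurable_sets _ (g_sigma_algebraType G).
apply: (mwrt_measurable_ereal sE (@subset_refl _ _)).
by rewrite E.
Qed.

Lemma mwrt_ereal_add (Y Z : Om -> \bar R) : measurable_wrt G Y -> measurable_wrt G Z ->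
  measurable_wrt G (fun w => Y w + Z w).
Proof. by move=> /mwrt_erealE mY /mwrt_erealE mZ; apply/mwrt_erealE; exact: emeasurable_funD. Qed.

Lemma mwrt_ereal_scale (Y : Om -> \bar R) (t : R) : measurable_wrt G Y ->
  measurable_wrt G (fun w => t%:E * Y w).
Proof. by move=> /mwrt_erealE mY; apply/mwrt_erealE; exact: emeasurable_funM. Qed.

End measurable_wrt_operations.

Section conditional_integrand_convex.
Context {R : realType} {d : measure_display} {Om : measurableType d}.
Variable P : probability Om R.
Variables (G : set (set Om)) (sG : sigma_algebra setT G) (GF : G `<=` measurable).
Context {V : normedModType R} {pV : proper V}.

Lemma integrably_boundedZ (f : Om -> \bar R) (t : R) : 0 < t ->
  integrably_bounded P f -> integrably_bounded P (fun w => t%:E * f w)%E.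
Proof.
move=> t0 [m im mf]; exists (fun w => t * m w).
  by have := integrableZl measurableT t im; congr integrable.
by apply: filterS mf => w h; rewrite EFinM lee_pmul2l ?lte_fin.
Qed.

Lemma integralZl_integrably_bounded (f : Om -> \bar R) (t : R) (A : set Om) : 0 < t ->
  measurable A -> integrably_bounded P f -> measurable_fun A f ->
  (\int[P]_(w in A) (t%:E * f w) = t%:E * \int[P]_(w in A) f w)%E.
Proof.
move=> t0 mA bf mf; have [if_|nf] := pselect (P.-integrable A f); first exact: integralZl.
rewrite (integrably_bounded_pinfty mA bf mf nf) gt0_muley ?lte_fin//.
apply: integrably_bounded_pinfty => //.
- exact: integrably_boundedZ.
- exact: emeasurable_funM.
- move=> /(integrableZl mA t^-1) itf; apply: nf; move: itf; congr integrable.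
  by apply/funext => w; rewrite muleA -EFinM mulVf ?mul1e// gt_eqF.
Qed.

(** The convexity inequality between two selections from a Castaing representation, with a rational
    weight, is integrated over the events of [G]; the lower bounds make these integrals additive. *)
Lemma cond_integrand_convex (h g : V -> Om -> \bar R) :
  normal_integrand measurable h -> lower_bounded P h -> convex_integrand h ->
  cond_integrand P G h g -> {ae P, forall w, convex_efun (g ^~ w)}.
Proof using sG GF pV.
move=> nh lh ch [ng hg]; have [p [mp Sp dp]] := castaing sG (random_set_epi ng).
have lg : lower_bounded P g by exact: (cond_integrand_lower_bounded sG GF nh lh (conj ng hg)).
pose y n w := (p n w).1.
have my n : measurable_wrt G (y n) := mwrt_comp continuous_fst (mp n).
pose z n m (t : R) w := t *: y n w + (1 - t) *: y m w.
have mz n m t : measurable_wrt G (z n m t).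
  have c : continuous (fun u : V * V => t *: u.1 + (1 - t) *: u.2).
    by move=> u; apply: cvgD; apply: cvgZl_tmp; [exact: cvg_fst|exact: cvg_snd].
  exact: (mwrt_comp c (mwrt_pair sG (my n) (my m))).
have key (i : nat * nat * rat) : {ae P, forall w, (0 < (ratr i.2 : R) < 1)%R ->
    g (z i.1.1 i.1.2 (ratr i.2) w) w <= (ratr i.2)%:E * g (y i.1.1 w) w +
      (1 - ratr i.2)%:E * g (y i.1.2 w) w}%E.
  case: i => -[n m] q /=; set t : R := ratr q.
  have [t01|nt] := pselect (0 < t < 1)%R; last by apply: aeW => w /nt.
  have /andP[t0 t1] := t01; have t1' : 0 < 1 - t by rewrite subr_gt0.
  have msum : measurable_wrt G (fun w => t%:E * g (y n w) w + (1 - t)%:E * g (y m w) w)%E.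
    by apply: mwrt_ereal_add => //; apply: mwrt_ereal_scale => //; exact: normal_integrand_mwrt.
  have bfun (x : Om -> V) : measurable_wrt G x -> integrably_bounded P (fun w => g (x w) w).
    by move=> _; exact: lower_bounded_comp.
  have hfun (x : Om -> V) : integrably_bounded P (fun w => h (x w) w) by exact: lower_bounded_comp.
  have mfun (x : Om -> V) A : measurable_wrt G x -> measurable_fun A (fun w => h (x w) w).
    by move=> mx; apply: normal_measurable_comp => //; exact: sub_mwrt mx.
  have mgfun (x : Om -> V) A : measurable_wrt G x -> measurable_fun A (fun w => g (x w) w).
    move=> mx; apply: measurable_funTS; apply: (mwrt_measurable_ereal sG GF).
    exact: normal_integrand_mwrt.
  have : {ae P, forall w, True -> g (z n m t w) w <= t%:E * g (y n w) w + (1 - t)%:E * g (y m w) w}%E;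
    last by apply: filterS => w h1 _; exact: h1.
  apply: (ae_le_of_integral sG GF _ msum (sa_const sG True)).
    exact: normal_integrand_mwrt.
  move=> A GA _; have mA := GF GA.
  rewrite integralD_integrably_bounded//; last first.
  - by apply: emeasurable_funM => //; exact: mgfun.
  - by apply: emeasurable_funM => //; exact: mgfun.
  - by apply: integrably_boundedZ => //; exact: bfun.
  - by apply: integrably_boundedZ => //; exact: bfun.
  rewrite !integralZl_integrably_bounded//; try exact: mgfun; try exact: bfun.
  have [_ ->//] := hg _ (mz n m t); have [_ ->//] := hg _ (my n); have [_ ->//] := hg _ (my m).
  rewrite -!integralZl_integrably_bounded//; try exact: mfun.
  rewrite -integralD_integrably_bounded//; last first.
  - by apply: emeasurable_funM => //; exact: mfun.
  - by apply: emeasurable_funM => //; exact: mfun.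
  - by apply: integrably_boundedZ => //; exact: hfun.
  - by apply: integrably_boundedZ => //; exact: hfun.
  apply: ae_le_integral => //; first exact: mfun.
    by apply: emeasurable_funD; apply: emeasurable_funM => //; exact: mfun.
  have [m0 _] := lh; apply: filterS => w hw _.
  have ny x : -oo%E != h x w by rewrite eq_sym gt_eqF// (lt_le_trans _ (hw x)) ?ltNyr.
  exact: (convex_efun_le (g := h ^~ w)).
apply: filterS (ae_all_count key) => w hw; apply/convex_efunE => u v t gu gv.
have [cl _] := ng; apply: (convexS_dense_rat (cl w) (dp w)) => // n m q q01.
have S0 : epi (g ^~ w) !=set0 by exists u.
have := Sp w n S0; have := Sp w m S0; rewrite /epi/= => hm hn.
apply: le_trans (hw (n, m, q) q01) _ => /=; have /andP[q0 q1] := q01.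
rewrite -[leRHS]/((ratr q)%:E * ((p n w).2 : R)%:E + (1 - ratr q)%:E * ((p m w).2 : R)%:E)%E.
by apply: leeD; rewrite lee_pmul2l ?lte_fin ?subr_gt0.
Qed.

End conditional_integrand_convex.

(** A variant of [rec_base] for infinitely many [n]: Fatou's lemma bounds the integrand along
    infinitely many indices, not along all of them. *)
Lemma rec_frequently {R : realType} {V : normedModType R} (C : set V) (c v : V) :
  closed C -> convexS C ->
  (forall n0, exists2 n, (n0 <= n)%N & C (c + n%:R *: v)) -> rec C v.
Proof.
move=> clC cC h c' Cc'; apply/(closed_normE C).1 => // e e0.
have [n0 hn] := @small_natV R e `|c' - c| e0.
have [[//|n] nn Cn] := h n0.+1.
exists (n.+1%:R^-1 *: (c + n.+1%:R *: v) + (1 - n.+1%:R^-1) *: c').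
  by apply: cC => //; rewrite invr_ge0 ler0n invf_le1// ler1n.
rewrite add_conv_combE scalerDr scalerA mulVf ?pnatr_eq0// scale1r.
rewrite opprD [v + _]addrCA subrr addr0 -scalerBr.
by rewrite normrZ ger0_norm ?invr_ge0// mulrC; exact: hn.
Qed.

Definition convex_cone {R : realType} {V : lmodType R} (K : set V) : Prop :=
  [/\ K 0, forall u v, K u -> K v -> K (u + v) &
      forall (t : R) v, 0 <= t -> K v -> K (t *: v)].

Lemma convex_cone_rec {R : realType} {V : normedModType R} (K : set V) :
  convex_cone K -> rec K = K.
Proof.
move=> [K0 KD KZ]; apply/seteqP; split=> v; last by move=> Kv u Ku; exact: KD.
by move/(_ 0 K0); rewrite add0r.
Qed.

Lemma convex_cone_convex {R : realType} {V : normedModType R} (K : set V) :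
  convex_cone K -> convexS K.
Proof.
by move=> [K0 KD KZ] x y t Kx Ky /andP[t0 t1]; apply: KD; apply: KZ; rewrite ?subr_ge0.
Qed.

Lemma convex_cone_dense {R : realType} {V : normedModType R} (K : set V) (p : nat -> V) :
  closed K -> (forall v (e : R), K v -> 0 < e -> exists n, `|v - p n| < e) ->
  K 0 -> (forall n m, K (p n + p m)) ->
  (forall n (q : rat), 0 <= (ratr q : R) -> K (ratr q *: p n)) -> convex_cone K.
Proof.
move=> clK dp K0 KD KZ; split=> //.
- move=> u v Ku Kv; apply/(closed_normE K).1 => // e e0.
  have [n hn] := dp u _ Ku (half_gt0 e0); have [m hm] := dp v _ Kv (half_gt0 e0).
  exists (p n + p m) => //; rewrite opprD addrACA (splitr e).
  by apply: le_lt_trans (ler_normD _ _) _; exact: ltrD.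
- move=> t v t0 Kv; apply/(closed_normE K).1 => // e e0.
  pose r := Num.min 1 ((e / 2) / (`|v| + 1)).
  have r0 : 0 < r by rewrite lt_min ltr01/= divr_gt0 ?half_gt0// ltr_wpDl.
  have [q] := @rat_in_itvoo R t (t + r) ltac:(by rewrite ltrDl).
  rewrite in_itv/= => /andP[tq qr].
  have q0 : 0 <= (ratr q : R) by exact: le_trans (ltW tq).
  have t2 : 0 < t + 1 by rewrite ltr_wpDl.
  have [n hn] := dp v _ Kv (divr_gt0 (half_gt0 e0) t2).
  exists (ratr q *: p n); first exact: KZ.
  move: (ratr q) tq qr q0 => s ts sr s0.
  have -> : t *: v - s *: p n = (t - s) *: v + s *: (v - p n).
    by rewrite scalerBl scalerBr addrA subrK.
  apply: le_lt_trans (ler_normD _ _) _; rewrite !normrZ (ger0_norm s0).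
  rewrite ltr0_norm ?subr_lt0// opprB (splitr e); apply: ler_ltD.
    have : (s - t) * (`|v| + 1) <= e / 2.
      rewrite -ler_pdivlMr ?ltr_wpDl// lerBlDl (le_trans (ltW sr))// lerD2l.
      by rewrite ge_min lexx orbT.
    by apply: le_trans; rewrite ler_wpM2l ?subr_ge0 ?(ltW ts)// lerDl.
  apply: (@le_lt_trans _ _ ((t + 1) * `|v - p n|)).
    by rewrite ler_wpM2r// (le_trans (ltW sr))// lerD2l ge_min lexx.
  by rewrite mulrC -ltr_pdivlMr.
Qed.

Section random_core.
Context {R : realType} {d : measure_display} {Om : measurableType d}.
Variable P : probability Om R.
Variables (G : set (set Om)) (sG : sigma_algebra setT G) (GF : G `<=` measurable).
Context {V : normedModType R} {pV : proper V}.

(* [K'] is the sublevel set at [0] of the conditional expectation of the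
   indicator function of [K], in the sense of convex analysis. *)
Lemma random_core (K : Om -> set V) : random_set measurable K ->
  exists2 K' : Om -> set V, random_set G K' & forall x, measurable_wrt G x ->
    ({ae P, forall w, K' w (x w)} <-> {ae P, forall w, K w (x w)}).
Proof using sG GF pV.
move=> rK; have sF := @sigma_algebra_measurable_sets _ Om.
pose h (x : V) w : \bar R := if pselect (K w x) then 0%E else +oo%E.
have cl : closed [set y : R^o | 0 <= y] by exact: closed_ge.
have nh : normal_integrand measurable h.
  apply: (random_set_normal_integrand _ (random_set_prod sF rK (random_set_cst sF cl))).
  move=> w [x a]; rewrite /epi/h/=; case: pselect => Kx /=.
    by rewrite lee_fin; split=> [[]|].
  by split=> [[/Kx]|].
have h0 x w : (0 <= h x w)%E by rewrite /h; case: pselect => Kx //=; rewrite leey.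
have [g [ng hg] g0] := cond_integrand_nonneg P sG GF nh h0.
exists (fun w => [set x | epi (g ^~ w) (x, 0)]).
  apply: (@random_set_preimage _ _ _ G sG _ _ _ _ (fun w => epi (g ^~ w)) (fun x w => (x, 0) : V * R^o)) => //.
    by move=> w; apply: continuous_pair; [exact: continuous_id|exact: continuous_cst].
  by move=> x; exact: mwrt_cst.
move=> x mx; have mxF : measurable_wrt measurable x := sub_mwrt GF mx.
have mg : measurable_fun setT (fun w => g (x w) w).
  apply: (mwrt_measurable_ereal sG GF); exact: normal_integrand_mwrt.
have mh : measurable_fun setT (fun w => h (x w) w) by exact: normal_measurable_comp.
have [_ /(_ setT)] := hg x mx; have GT : G setT by have := sa_const sG True; congr G; apply/seteqP.
move=> /(_ GT) E; split=> Kx.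
  have E0 : (\int[P]_w h (x w) w = 0)%E.
    rewrite -E; have : ae_eq P setT (fun w => g (x w) w) (cst 0%E).
      by apply: filterS Kx => w gw _; apply/eqP; rewrite eq_le g0 andbT.
    by move=> /ae_eq_integral ->//; rewrite integral0.
  have : ae_eq P setT (fun w => h (x w) w) (cst 0%E).
    apply/ae_eq_integral_abs => //; rewrite -E0; apply: eq_integral => w _.
    by rewrite gee0_abs.
  by apply: filterS => w /(_ I); rewrite /h; case: pselect.
have E0 : (\int[P]_w g (x w) w = 0)%E.
  rewrite E; have : ae_eq P setT (fun w => h (x w) w) (cst 0%E).
    by apply: filterS Kx => w Kw _; rewrite /h; case: pselect.
  by move=> /ae_eq_integral ->//; rewrite integral0.
have : ae_eq P setT (fun w => g (x w) w) (cst 0%E).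
  apply/ae_eq_integral_abs => //; rewrite -E0; apply: eq_integral => w _.
  by rewrite gee0_abs.
by apply: filterS => w /(_ I) gw; rewrite /epi/= gw.
Qed.

(** The cone properties are checked on a Castaing representation of [K'], where the defining
    property of [K'] transfers them from [K]. *)
Lemma random_core_cone (K K' : Om -> set V) : random_set G K' ->
  (forall x, measurable_wrt G x ->
    ({ae P, forall w, K' w (x w)} <-> {ae P, forall w, K w (x w)})) ->
  {ae P, forall w, convex_cone (K w)} -> {ae P, forall w, convex_cone (K' w)}.
Proof using sG pV.
move=> rK' hK cK; have [v [mv Sv dv]] := castaing sG rK'.
have K'0 : {ae P, forall w, K' w 0}.
  apply/hK; first exact: mwrt_cst.
  by apply: filterS cK => w [].
have K'v n : {ae P, forall w, K w (v n w)}.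
  by apply/hK => //; apply: filterS K'0 => w K0; apply: Sv; exists 0.
have K'D (nm : nat * nat) : {ae P, forall w, K' w (v nm.1 w + v nm.2 w)}.
  apply/hK.
    exact: (mwrtD sG (mv nm.1) (mv nm.2)).
  by apply: filterS3 (K'v nm.1) (K'v nm.2) cK => w h1 h2 [_ KD _]; exact: KD.
have K'Z (nq : nat * rat) : {ae P, forall w, 0 <= (ratr nq.2 : R) -> K' w (ratr nq.2 *: v nq.1 w)}.
  have [q0|nq0] := pselect (0 <= (ratr nq.2 : R)); last by apply: aeW => w /nq0.
  suff : {ae P, forall w, K' w (ratr nq.2 *: v nq.1 w)} by apply: filterS.
  apply/hK.
    have c : continuous (fun z : V => ratr nq.2 *: z) by move=> z; exact: cvgZl_tmp.
    exact: (mwrt_comp c (mv nq.1)).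
  by apply: filterS2 (K'v nq.1) cK => w h1 [_ _ KZ]; exact: KZ.
have [cl _] := rK'.
apply: filterS3 K'0 (ae_all_count K'D) (ae_all_count K'Z) => w h0 hD hZ.
apply: (convex_cone_dense (cl w) (dv w)) => // [n m|n q q0]; first exact: (hD (n, m)).
exact: (hZ (n, q)).
Qed.

End random_core.

Section conditional_recession.
Context {R : realType} {d : measure_display} {Om : measurableType d}.
Variable P : probability Om R.
Variables (G : set (set Om)) (sG : sigma_algebra setT G) (GF : G `<=` measurable).
Context {V : normedModType R} {pV : proper V}.
Variables (h g : V -> Om -> \bar R).
Hypotheses (nh : normal_integrand measurable h) (lh : lower_bounded P h).
Hypothesis hg : cond_integrand P G h g.

Lemma cond_integrand_le_comp (x y : Om -> V) :
  measurable_wrt G x -> measurable_wrt G y ->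
  {ae P, forall w, h (x w) w <= h (y w) w}%E ->
  {ae P, forall w, g (x w) w <= g (y w) w}%E.
Proof using sG GF pV nh hg.
move=> mx my hxy; have [ng cg] := hg.
have : {ae P, forall w, True -> g (x w) w <= g (y w) w}%E; last by apply: filterS => w; exact.
apply: (ae_le_of_integral sG GF _ _ (sa_const sG True)); try exact: normal_integrand_mwrt.
move=> A GA _; have mA := GF GA; have [_ ->//] := cg x mx; have [_ ->//] := cg y my.
apply: ae_le_integral => //; try by apply: normal_measurable_comp => //; exact: sub_mwrt GF _.
by apply: filterS hxy.
Qed.

(* Fatou's lemma bounds the integral over [B] of the lower limit of [h (x j)]. *)
Lemma cond_integrand_bounded_frequently (x : nat -> Om -> V) (a : Om -> R^o) (B : Om -> Prop) :
  (forall j, measurable_wrt G (x j)) -> measurable_wrt G a -> G [set w | B w] ->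
  {ae P, forall w, B w -> forall j, g (x j w) w <= (a w : R)%:E}%E ->
  {ae P, forall w, B w -> exists M : R, forall j0, exists2 j, (j0 <= j)%N &
    (h (x j w) w <= M%:E)%E}.
Proof using sG GF pV nh lh hg.
move=> mx ma GB hB; have [m im hm] := lh; have [ng cg] := hg.
pose f j w := maxe (h (x j w) w + (- m w)%:E)%E 0%E.
have mhx j A : measurable_fun A (fun w => h (x j w) w).
  by apply: normal_measurable_comp => //; exact: sub_mwrt GF (mx j).
have imN : P.-integrable setT (EFin \o (fun w => - m w)).
  by have := integrableN im; congr integrable.
have mm A : measurable_fun A (EFin \o (fun w => - m w)).
  by apply: measurable_funTS; exact: measurable_int imN.
have mf j A : measurable_fun A (f j).
  by apply: measurable_maxe => //; exact: emeasurable_funD.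
have f0 j w : (0 <= f j w)%E by rewrite /f le_max lexx orbT.
(* The level [a] need not be integrable, so the argument runs on the events where it is at most a
   natural number [c]. *)
suff key (c : nat) : {ae P, forall w, (B w /\ a w <= c%:R) -> (limn_einf (f^~ w) < +oo)%E}.
  apply: filterS2 hm (ae_all_count key) => w hmw hw Bw.
  have ac : a w <= (Num.truncn (a w)).+1%:R by apply: ltW; exact: truncnS_gt.
  have := hw _ (conj Bw ac); set l := limn_einf _ => ly.
  have [M lM] : exists M : R, (l < M%:E)%E.
    by have [q /andP[lq _]] := rat_between ly; exists (ratr q).
  exists (M + m w) => j0.
  have : (einfs (f^~ w) j0 < M%:E)%E.
    apply: le_lt_trans lM; rewrite /l limn_einf_lim (cvg_lim _ (@cvg_einfs_sup _ _))//.
    by apply: ereal_sup_ubound; exists j0.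
  move=> /ereal_inf_lt[_ [j jj0 <-]] fM; exists j => //.
  have : (h (x j w) w + (- m w)%:E <= M%:E)%E.
    by apply: le_trans (ltW fM); rewrite /f le_max lexx.
  by rewrite EFinN EFinD leeBlDr.
have GA : G [set w | B w /\ a w <= c%:R].
  apply: sa_and => //.
  by have := mwrt_ereal_le sG (c%:R)%:E ((mwrt_EFin _ sG).1 ma); apply: sa_ext => w; rewrite /= lee_fin.
set A := mkset _ in GA *; have mA : measurable A := GF GA.
have bm : integrably_bounded P (EFin \o (fun w => - m w)).
  by exists (fun w => - m w) => //; exact: aeW.
pose C := (\int[P]_(w in A) (c%:R)%:E + \int[P]_(w in A) (- m w)%:E)%E.
have Cy : (C < +oo)%E.
  apply: lte_add_pinfty.
    by rewrite integral_cst// ltey_eq fin_numM// fin_num_measure.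
  have := integrable_fin_num mA (integrableS measurableT mA (@subsetT _ _) imN).
  by rewrite ltey_eq => ->.
have fC j : (\int[P]_(w in A) f j w <= C)%E.
  have -> : (\int[P]_(w in A) f j w = \int[P]_(w in A) (h (x j w) w + (- m w)%:E))%E.
    apply: ae_eq_integral => //; first exact: emeasurable_funD.
    apply: filterS hm => w hw _; rewrite /f max_l//.
    by rewrite EFinN sube_ge0// hw.
  rewrite integralD_integrably_bounded//; last exact: lower_bounded_comp.
  have [_ <-//] := cg _ (mx j); rewrite leeD2r//.
  apply: ae_le_integral => //.
    by apply: measurable_funTS; apply: (mwrt_measurable_ereal sG GF); exact: normal_integrand_mwrt.
  apply: filterS hB => w hw [Bw ac]; apply: le_trans (hw Bw j) _.
  by rewrite lee_fin.
have fat : (\int[P]_(w in A) limn_einf (f^~ w) < +oo)%E.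
  apply: le_lt_trans (fatou P mA (fun j => mf j A) (fun j w _ => f0 j w)) _.
  apply: le_lt_trans Cy; rewrite limn_einf_lim (cvg_lim _ (@cvg_einfs_sup _ _))//.
  apply: ge_ereal_sup => _ [n _ <-]; apply: le_trans (fC n).
  by apply: ereal_inf_lbound; exists n => //=.
have lim0 w : (0 <= limn_einf (f^~ w))%E.
  rewrite limn_einf_lim (cvg_lim _ (@cvg_einfs_sup _ _))//.
  apply: le_ereal_sup_tmp; exists (einfs (f^~ w) 0%N); first by exists 0%N.
  by apply: le_ereal_inf_tmp => _ [n _ <-]; exact: f0.
have ilim : P.-integrable A (fun w => limn_einf (f^~ w)).
  apply/integrableP; split.
    apply: measurableT_comp => //.
    apply: (@measurable_fun_limn_esup _ _ _ _ (fun n w => - f n w)%E) => n.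
    exact: measurableT_comp.
  by under eq_integral do rewrite gee0_abs//.
by apply: filterS (integrable_ae mA ilim) => w hw Aw; rewrite ltey_eq hw.
Qed.

(** [K] stands for the recession cone of [h], with values of its own where [h] is identically [+oo].
    The two inclusions are proved along Castaing representations of [K'] and of the recession cone
    of [g]. *)
Lemma cond_integrand_recession (K K' : Om -> set V) :
  convex_integrand h -> random_set G K' ->
  (forall x, measurable_wrt G x ->
    ({ae P, forall w, K' w (x w)} <-> {ae P, forall w, K w (x w)})) ->
  {ae P, forall w, K w 0} ->
  {ae P, forall w, epi (h ^~ w) !=set0 -> forall v, K w v <-> rec (epi (h ^~ w)) (v, 0)} ->
  {ae P, forall w, epi (g ^~ w) !=set0 -> forall v, K' w v <-> rec (epi (g ^~ w)) (v, 0)}.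
Proof using sG GF pV nh lh hg.
move=> ch rK' hK K0 hrec; have [ng cg] := hg.
have K'0 : {ae P, forall w, K' w 0} by apply/hK => //; exact: mwrt_cst.
have [p [mp Sp dp]] := castaing sG (random_set_epi ng).
pose y n w := (p n w).1.
have my n : measurable_wrt G (y n) := mwrt_comp continuous_fst (mp n).
have cD : continuous (fun z : V * V => z.1 + z.2).
  by apply: continuousD; [exact: continuous_fst|exact: continuous_snd].
have sub : {ae P, forall w, forall v, K' w v -> rec (epi (g ^~ w)) (v, 0)}.
  have [v [mv Sv dv]] := castaing sG rK'.
  have Kv n : {ae P, forall w, K w (v n w)}.
    by apply/hK => //; apply: filterS K'0 => w h0; apply: Sv; exists 0.
  have key (nm : nat * nat) : {ae P, forall w,
      (g (y nm.1 w + v nm.2 w)%R w <= g (y nm.1 w) w)%E}.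
    apply: cond_integrand_le_comp => //.
      exact: (mwrt_comp cD (mwrt_pair sG (my nm.1) (mv nm.2))).
    apply: filterS2 (Kv nm.2) hrec => w hv hr; apply: lee_real => b hb.
    have h0 : epi (h ^~ w) !=set0 by exists (y nm.1 w, b).
    by have := (hr h0 _).1 hv (y nm.1 w, b) hb; rewrite /epi/= addr0.
  apply: filterS (ae_all_count key) => w hw u K'u [x a] gxa.
  have [cl _] := ng; apply/(closed_normE _).1 => [|e e0]; first exact: cl.
  have [n hn] := dp w _ _ gxa (half_gt0 e0); have [m hm] := dv w _ _ K'u (half_gt0 e0).
  exists (p n w + (v m w, 0)).
    have := Sp w n (ex_intro _ _ gxa); rewrite /epi/= addr0.
    exact: le_trans (hw (n, m)).
  rewrite opprD addrACA (splitr e); apply: le_lt_trans (ler_normD _ _) _.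
  apply: ltrD => //; rewrite prod_normE gt_max /= hm/= subrr normr0.
  exact: half_gt0.
(* The recession cone of [g] where its epigraph is nonempty, tested on a Castaing representation of
   the epigraph so as to be a random set. *)
pose Rg w := [set v : V | forall n, epi (g ^~ w) (p n w + (v, 0))].
have rRg : random_set G Rg.
  apply: (@random_set_preimages _ _ _ G sG V (V * R^o)%type _ _ (fun _ w => epi (g ^~ w))
    (fun n v w => p n w + (v, 0))).
  - by move=> _; exact: random_set_epi.
  - move=> n w; apply: continuousD; first exact: continuous_cst.
    by apply: continuous_pair; [exact: continuous_id|exact: continuous_cst].
  - move=> n v; have c : continuous (fun z : V * R^o => z + (v, 0)).
      by apply: continuousD; [exact: continuous_id|exact: continuous_cst].
    exact: (mwrt_comp c (mp n)).
have RgE w v : Rg w v -> rec (epi (g ^~ w)) (v, 0).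
  move=> Rv xa gxa; have [cl _] := ng; apply/(closed_normE _).1 => [|e e0]; first exact: cl.
  have [n hn] := dp w _ _ gxa e0; exists (p n w + (v, 0)); first exact: Rv.
  by rewrite opprD addrACA subrr addr0.
have [v [mv Sv dv]] := castaing sG rRg.
pose B w := epi (g ^~ w) !=set0.
have GB : G [set w | B w] by exact: random_set_nonempty (random_set_epi ng).
(* Off [B] the epigraph of [g] is empty; the zero direction is taken there, which lies in [K] almost
   surely. *)
pose v' n w := if pselect (B w) then v n w else 0.
have mv' n : measurable_wrt G (v' n) by apply: mwrt_if => //; exact: mwrt_cst.
have Rv' n w : B w -> Rg w (v' n w).
  move=> Bw; rewrite /v'; case: pselect => //= _; apply: Sv.
  by exists 0 => k; rewrite addr0; exact: Sp.
have Kv' n : {ae P, forall w, K' w (v' n w)}.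
  apply/hK => //.
  (* Along this ray [g] stays below the height of the starting point, so [h] is bounded at
     infinitely many points of the ray. *)
  pose x j w := y 0%N w + j%:R *: v' n w.
  have mx j : measurable_wrt G (x j).
    have c : continuous (fun z : V * V => z.1 + j%:R *: z.2).
      apply: continuousD; first exact: continuous_fst.
      by move=> z; apply: cvgZl_tmp; exact: continuous_snd.
    exact: (mwrt_comp c (mwrt_pair sG (my 0%N) (mv' n))).
  have ma : measurable_wrt G (fun w => (p 0%N w).2) := mwrt_comp continuous_snd (mp 0%N).
  have bd : {ae P, forall w, B w -> forall j, g (x j w) w <= ((p 0%N w).2 : R)%:E}%E.
    apply: aeW => w Bw j; have := rec_nat j (RgE _ _ (Rv' n w Bw)).
    by move=> /(_ _ (Sp w 0%N Bw)); rewrite /epi/= scaler0 addr0.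
  have := cond_integrand_bounded_frequently mx ma GB bd.
  apply: filterS3 K0 hrec => w K0w hr hf.
  have [Bw|nB] := pselect (B w); last by rewrite /v'; case: pselect.
  have [M hM] := hf Bw.
  have [j _ hj] := hM 0%N.
  have /hr hr' : epi (h ^~ w) !=set0 by exists (x j w, M).
  apply/hr'; apply: (@rec_frequently _ _ _ (y 0%N w, M : R^o)).
  - by have [cl _] := nh; exact: cl.
  - exact/convex_efunE.
  - move=> j0; have [k kj hk] := hM j0; exists k => //.
    by rewrite /epi/= scaler0 addr0.
apply: filterS2 sub (ae_foralln Kv') => w hs hv Bw u; split=> [|ru]; first exact: hs.
have [cl _] := rK'; apply/(closed_normE _).1 => [|e e0]; first exact: cl.
have Ru : Rg w u by move=> n; apply: ru; exact: Sp.
have [n hn] := dv w u e Ru e0; exists (v n w) => //.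
by have := hv n; rewrite /v'; case: pselect.
Qed.

End conditional_recession.

(** * Infimal composition *)

Definition efun_of {R : realType} {V : Type} (E : set (V * R^o)) (x : V) : \bar R :=
  ereal_inf [set (a : R)%:E | a in [set a | E (x, a)]].

Lemma epi_efun_of {R : realType} {V : normedModType R} (E : set (V * R^o)) :
  closed E -> (forall x (a b : R), E (x, a) -> a <= b -> E (x, b)) ->
  epi (efun_of E) = E.
Proof.
move=> clE upE; apply/seteqP; split=> -[x a]; rewrite /epi/= => h; last first.
  by apply: ereal_inf_lbound; exists a.
apply/(closed_normE E).1 => // e e0.
have : (efun_of E x < (a + e / 2)%:E)%E.
  by apply: le_lt_trans h _; rewrite lte_fin ltrDl half_gt0.
move=> /ereal_inf_lt[_ [b Eb <-]]; rewrite lte_fin => /ltW ba.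
exists (x, a + e / 2); first exact: upE ba.
rewrite prod_normE /= subrr normr0 gt_max e0/= opprD addNKr normrN.
by rewrite ger0_norm ?ltW ?half_gt0// gtr_pMr// invf_lt1// ltr1n.
Qed.

Lemma closure_upward {R : realType} {V : normedModType R} (E : set (V * R^o)) :
  (forall x (a b : R), E (x, a) -> a <= b -> E (x, b)) ->
  forall x (a b : R), closure E (x, a) -> a <= b -> closure E (x, b).
Proof.
move=> upE x a b /closure_normE h ab; apply/closure_normE => e /h[[y c] Eyc].
rewrite prod_normE /= gt_max => /andP[xy ac].
exists (y, c + (b - a)); first by apply: upE Eyc _; rewrite lerDl subr_ge0.
have E' : b - (c + (b - a)) = a - c :> R by ring.
by rewrite prod_normE /= gt_max xy/= -[`|_|]/(`|b - (c + (b - a)) : R|) E'.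
Qed.

Lemma convexS_closure {R : realType} {V : normedModType R} (C : set V) :
  convexS C -> convexS (closure C).
Proof.
move=> cC x y t /closure_normE hx /closure_normE hy /andP[t0 t1].
apply/closure_normE => e e0; have [u Cu xu] := hx _ e0; have [v Cv yv] := hy _ e0.
exists (t *: u + (1 - t) *: v); first by apply: cC => //; rewrite t0.
rewrite opprD addrACA -!scalerBr; apply: le_lt_trans (ler_normD _ _) _.
rewrite !normrZ (ger0_norm t0) ger0_norm ?subr_ge0//.
have [->|t0'] := eqVneq t 0; first by rewrite mul0r add0r subr0 mul1r.
have -> : e = t * e + (1 - t) * e by ring.
by apply: ltr_leD; [rewrite ltr_pM2l// lt_neqAle eq_sym t0'|rewrite ler_wpM2l ?subr_ge0// ltW].
Qed.

Lemma rec_epi_ge0 {R : realType} {V : normedModType R} (g : V -> \bar R) (m : R) v (b : R) :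
  (forall x, m%:E <= g x)%E -> epi g !=set0 -> rec (epi g) (v, b) -> 0 <= b.
Proof.
move=> gm [[x a] gxa] rv; rewrite leNgt; apply/negP => b0.
have h n : m <= a + n%:R * b.
  have := rec_nat n rv gxa; rewrite /epi/= => /(le_trans (gm _)).
  by rewrite lee_fin.
(* A descending direction brings the height below [m] after more than [(a - m) / -b] steps. *)
have := h (Num.truncn ((a - m) / - b)).+1.
have := truncnS_gt ((a - m) / - b); rewrite ltr_pdivrMr ?oppr_gt0// mulrN.
by move: (_ * b) => c; lra.
Qed.

Section infimal_composition.
Context {R : realType} {X Y U : normedModType R}.
Context {pX : proper X} {pY : proper Y} {pU : proper U}.
Variables (L : Y * U -> \bar R) (J : X -> \bar R) (A : Y * U -> X) (x0 : X).
Hypotheses (lA : linear A) (cA : continuous A).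
Hypotheses (clL : closed (epi L)) (clJ : closed (epi J)).
Hypotheses (cL : convexS (epi L)) (cJ : convexS (epi J)).

(** A point [(y, u, a, b)] splits the total height [a] into [b] for [L] and [a - b] for [J]. This
    avoids sums of extended reals and exhibits the set as the preimage of a product of epigraphs
    under a continuous affine map. *)
Definition sum_epi : set ((Y * U) * R^o * R^o) :=
  [set p | epi L (p.1.1, p.2) /\ epi J (A p.1.1 + x0, p.1.2 - p.2)].

Definition inf_epi : set (Y * R^o) := [set (p.1.1.1, p.1.2) | p in sum_epi].

Let A0 : A 0 = 0.
Proof. by have := lA (-1) 0 0; rewrite scaler0 addr0 scaleN1r addNr. Qed.
Let AZ a x : A (a *: x) = a *: A x.
Proof. by have := lA a x 0; rewrite A0 !addr0. Qed.
Let AD x y : A (x + y) = A x + A y.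
Proof. by have := lA 1 x y; rewrite !scale1r. Qed.

Lemma closed_sum_epi : closed sum_epi.
Proof using cA clL clJ.
apply: closedI.
  apply: (@preimage_closed _ _ (fun p : (Y * U) * R^o * R^o => (p.1.1, p.2))) => // p _.
  apply: continuous_pair; last exact: continuous_snd.
  by apply: continuous_comp2; exact: continuous_fst.
apply: (@preimage_closed _ _ (fun p : (Y * U) * R^o * R^o => (A p.1.1 + x0, p.1.2 - p.2))) => // p _.
have c1 : continuous (fun p : (Y * U) * R^o * R^o => p.1.1).
  by apply: continuous_comp2; exact: continuous_fst.
apply: continuous_pair.
  by apply: continuousD; [exact: continuous_comp2 c1 cA|exact: continuous_cst].
apply: continuousB; last exact: continuous_snd.
by apply: continuous_comp2; [exact: continuous_fst|exact: continuous_snd].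
Qed.

Lemma convex_sum_epi : convexS sum_epi.
Proof using lA cL cJ.
move=> [[z a] b] [[z' a'] b'] t [/= L1 J1] [/= L2 J2] t01; split=> /=.
  exact: (cL L1 L2 t01).
have -> : t *: a + (1 - t) *: a' - (t *: b + (1 - t) *: b') =
    t *: (a - b) + (1 - t) *: (a' - b') by rewrite opprD addrACA -!scalerBr.
have -> : A (t *: z + (1 - t) *: z') + x0 = t *: (A z + x0) + (1 - t) *: (A z' + x0).
  by rewrite AD !AZ !scalerDr addrACA -scalerDl subrKC scale1r.
exact: (cJ J1 J2 t01).
Qed.

Lemma inf_epi_upward y (a b : R) : inf_epi (y, a) -> a <= b -> inf_epi (y, b).
Proof.
move=> [[[z a'] c] [/= h1 h2] [<- <-]] ab; exists (z, b : R^o, c) => //; split=> //=.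
by move: h2; rewrite /epi/= => /le_trans; apply; rewrite lee_fin lerD2r.
Qed.

(** The closure makes the function lower semicontinuous whatever the data. In the random setting the
    kernel condition, under which [inf_epi] is already closed, is known only almost surely. *)
Definition inf_fun : Y -> \bar R := efun_of (closure inf_epi).

Lemma epi_inf_fun : epi inf_fun = closure inf_epi.
Proof. by apply: epi_efun_of; [exact: closed_closure|exact: closure_upward inf_epi_upward]. Qed.

Lemma convex_inf_fun : convexS (epi inf_fun).
Proof using lA cL cJ.
rewrite epi_inf_fun; apply: convexS_closure => _ _ t [p Ep <-] [p' Ep' <-] t01.
exists (t *: p + (1 - t) *: p'); first exact: convex_sum_epi.
by case: p p' {Ep Ep'} => [[[y u] a] b] [[[y' u'] a'] b'].
Qed.

Section lower_bounds.
Variables (m m' : R) (Lm : forall z, (m%:E <= L z)%E) (Jm : forall x, (m'%:E <= J x)%E).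

Lemma inf_epiE y (a : R) :
  inf_epi (y, a) <-> exists u, (L (y, u) + J (A (y, u) + x0)%R <= a%:E)%E.
Proof using Lm Jm.
split=> [[[[[y' u] a'] b] [/= h1 h2] [<- <-]]|[u h]].
  exists u; move: h1 h2; rewrite /epi/= => h1 h2.
  have -> : a'%:E = (b%:E + (a' - b)%:E)%E by rewrite -EFinD subrKC.
  exact: leeD.
have : (L (y, u) < +oo)%E.
  rewrite ltey; apply/eqP => E; move: h; rewrite E addye ?leye_eq//.
  by rewrite gt_eqF// (lt_le_trans _ (Jm _))// ltNyr.
have := Lm (y, u); case E : (L (y, u)) => [b| |]// _ _.
exists (y, u, a : R^o, b : R^o) => //; split; rewrite /epi/= ?E//.
by move: h; rewrite E EFinB leeBrDl.
Qed.

Hypothesis ker_rec : epi L !=set0 -> epi J !=set0 ->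
  forall u, rec (epi L) ((0, u), 0) -> rec (epi J) (A (0, u), 0) ->
    rec (epi L) ((0, - u), 0) /\ rec (epi J) (A (0, - u), 0).

Lemma rec_sum_epi : sum_epi !=set0 -> forall v (a b : R),
  rec sum_epi (v, a, b) -> rec (epi L) (v, b) /\ rec (epi J) (A v, a - b).
Proof using lA clL clJ cL cJ.
move=> [[[z c] e] [/= h1 h2]] v a b rv.
have Ep : sum_epi (z, c, e) by [].
split.
  apply: (@rec_base _ _ _ (z, e)) => // n.
  by have [] := rec_nat n.+1 rv Ep.
apply: (@rec_base _ _ _ (A z + x0, c - e)) => // n.
have [_] := rec_nat n.+1 rv Ep; rewrite /epi/=.
by rewrite AD AZ addrAC opprD addrACA -scalerBr.
Qed.

Lemma rec_sum_epiW v (a b : R) : rec (epi L) (v, b) -> rec (epi J) (A v, a - b) ->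
  rec sum_epi (v, a, b).
Proof using lA.
move=> rL rJ [[z c] e] [/= /rL h1 /rJ h2]; split => //=.
by move: h2; rewrite /epi/= AD addrAC opprD addrACA.
Qed.

Lemma sum_epi_nonempty : sum_epi !=set0 -> epi L !=set0 /\ epi J !=set0.
Proof. by move=> [p [h1 h2]]; split; [exists (p.1.1, p.2)|exists (A p.1.1 + x0, p.1.2 - p.2)]. Qed.

(** The slopes [b] along [L] and [0 - b] along [J] are both nonnegative by the lower bounds, so both
    vanish. *)
Lemma rec_sum_epi0 v (b : R) : sum_epi !=set0 -> rec sum_epi (v, 0, b) ->
  [/\ b = 0, rec (epi L) (v, 0) & rec (epi J) (A v, 0)].
Proof using lA clL clJ cL cJ Lm Jm.
move=> E0 /(rec_sum_epi E0)[h1 h2]; have [L0 J0] := sum_epi_nonempty E0.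
have b0 := rec_epi_ge0 Lm L0 h1; have b1 := rec_epi_ge0 Jm J0 h2.
have E : b = 0 by apply/eqP; rewrite eq_le b0 andbT -oppr_ge0 -[- b]add0r.
by move: h1 h2; rewrite E subr0.
Qed.

Let f (p : (Y * U) * R^o * R^o) : Y * R^o := (p.1.1.1, p.1.2).
Let lf : linear f.
Proof. by move=> t [[[y u] a] b] [[[y' u'] a'] b']. Qed.
Let cf : continuous f.
Proof.
apply: continuous_pair; last by apply: continuous_comp2; [exact: continuous_fst|exact: continuous_snd].
apply: continuous_comp2; last exact: continuous_fst.
by apply: continuous_comp2; exact: continuous_fst.
Qed.

(** A direction killed by the projection has zero [y] and zero total height, so [rec_sum_epi0]
    reduces it to the horizontal directions covered by [ker_rec]. *)
Let ker_sum_epi : sum_epi !=set0 -> forall v, rec sum_epi v -> f v = 0 -> rec sum_epi (- v).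
Proof.
move=> E0 [[[y u] a] b] rv [y0 a0].
have [L0 J0] := sum_epi_nonempty E0.
rewrite y0 a0 in rv *; have [-> rL rJ] := rec_sum_epi0 E0 rv.
have [rL' rJ'] := ker_rec L0 J0 rL rJ.
rewrite -[- _]/(((- 0 : Y), - u), - 0, - 0) !oppr0.
by apply: rec_sum_epiW => //; rewrite subr0.
Qed.

Lemma closed_inf_epi : closed inf_epi.
Proof using lA cA clL clJ cL cJ Lm Jm ker_rec pX pY pU.
have [E0|E0] := pselect (sum_epi !=set0); last first.
  rewrite (_ : inf_epi = set0); first exact: closed0.
  by apply/seteqP; split=> // p [q Eq _]; apply: E0; exists q.
exact: (closed_proj lf cf closed_sum_epi convex_sum_epi (ker_sum_epi E0)).
Qed.

(** Closedness of the projected set amounts to attainment of the infimum at real levels. *)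
Lemma inf_fun_leP y (a : R) :
  (inf_fun y <= a%:E)%E <-> exists u, (L (y, u) + J (A (y, u) + x0)%R <= a%:E)%E.
Proof using lA cA clL clJ cL cJ Lm Jm ker_rec pX pY pU.
rewrite -inf_epiE; have := epi_inf_fun; rewrite -(closure_id _).1; last exact: closed_inf_epi.
by move=> <-.
Qed.

Lemma inf_funE y :
  inf_fun y = ereal_inf (range (fun u => L (y, u) + J (A (y, u) + x0)%R)%E).
Proof using lA cA clL clJ cL cJ Lm Jm ker_rec pX pY pU.
apply/eqP; rewrite eq_le; apply/andP; split.
  apply: le_ereal_inf_tmp => _ [u _ <-]; apply: lee_real => a ha.
  by apply/inf_fun_leP; exists u.
apply: lee_real => a /inf_fun_leP[u hu]; apply: le_trans hu.
by apply: ereal_inf_lbound; exists u.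
Qed.

Lemma rec_inf_fun : epi inf_fun !=set0 -> forall v,
  rec (epi inf_fun) (v, 0) <->
  exists u, rec (epi L) ((v, u), 0) /\ rec (epi J) (A (v, u), 0).
Proof using lA cA clL clJ cL cJ Lm Jm ker_rec pX pY pU.
rewrite epi_inf_fun -(closure_id _).1; last exact: closed_inf_epi.
move=> [_ [p0 Ep0 _]] v; have E0 : sum_epi !=set0 by exists p0.
split=> [rv|[u [rL rJ]]].
  have [[[[y u] a] b] rp [Ey Ea]] :=
    rec_proj lf cf closed_sum_epi convex_sum_epi (ker_sum_epi E0) E0 rv.
  rewrite Ey Ea in rp; exists u.
  by have [_ ? ?] := rec_sum_epi0 E0 rp.
move=> _ [p Ep <-]; exists (p + (v, u, 0, 0)).
  by apply: rec_sum_epiW Ep => //; rewrite subr0.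
by case: p {Ep} => [[[y u'] a] b].
Qed.

End lower_bounds.

End infimal_composition.

(** * Infimal composition of normal integrands *)

Section random_infimal_composition.
Context {R : realType} {d : measure_display} {Om : measurableType d}.
Context {X Y U : normedModType R}.
Context {pX : proper X} {pY : proper Y} {pU : proper U}.
Variables (H : set (set Om)) (sH : sigma_algebra setT H).

Lemma normal_inf_fun (L : Y * U -> Om -> \bar R) (J : X -> Om -> \bar R)
    (A : Om -> Y * U -> X) (x0 : Om -> X) :
  normal_integrand H L -> normal_integrand H J -> (forall w, continuous (A w)) ->
  (forall z, measurable_wrt H (A ^~ z)) -> measurable_wrt H x0 ->
  normal_integrand H (fun y w => inf_fun (L ^~ w) (J ^~ w) (A w) (x0 w) y).
Proof using sH pX pY pU.
move=> nL nJ cA mA mx0.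
have rE : random_set H (fun w => sum_epi (L ^~ w) (J ^~ w) (A w) (x0 w)).
  pose f (p : (Y * U) * R^o * R^o) w : ((Y * U) * R^o) * (X * R^o) :=
    ((p.1.1, p.2), (A w p.1.1 + x0 w, p.1.2 - p.2)).
  apply: (@random_set_preimage _ _ _ H sH _ _ _ _
    (fun w => epi (L ^~ w) `*` epi (J ^~ w)) f).
  - exact: random_set_prod.
  - have c1 : continuous (fun p : (Y * U) * R^o * R^o => p.1.1).
      by apply: continuous_comp2; exact: continuous_fst.
    move=> w; apply: continuous_pair.
      by apply: continuous_pair; [exact: c1|exact: continuous_snd].
    apply: continuous_pair.
      by apply: continuousD; [exact: continuous_comp2 c1 (cA w)|exact: continuous_cst].
    apply: continuousB; last exact: continuous_snd.
    by apply: continuous_comp2; [exact: continuous_fst|exact: continuous_snd].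
  - move=> p; apply: mwrt_pair => //; first exact: mwrt_cst.
    apply: mwrt_pair => //; last exact: mwrt_cst.
    exact: (mwrtD sH (mA p.1.1) mx0).
have cf : continuous (fun p : (Y * U) * R^o * R^o => (p.1.1.1, p.1.2)).
  apply: continuous_pair; last by apply: continuous_comp2; [exact: continuous_fst|exact: continuous_snd].
  apply: continuous_comp2; last exact: continuous_fst.
  by apply: continuous_comp2; exact: continuous_fst.
apply: (random_set_normal_integrand _ (random_set_closure cf rE)) => w p.
by rewrite -[epi _]/(epi (inf_fun (L ^~ w) (J ^~ w) (A w) (x0 w))) epi_inf_fun.
Qed.

End random_infimal_composition.

Lemma inf_fun_ge {R : realType} {X Y U : normedModType R} (L : Y * U -> \bar R)
    (J : X -> \bar R) (A : Y * U -> X) (x0 : X) (m m' : R) :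
  (forall z, m%:E <= L z)%E -> (forall x, m'%:E <= J x)%E ->
  forall y, ((m + m')%:E <= inf_fun L J A x0 y)%E.
Proof.
move=> Lm Jm y; apply: lee_real => a hy.
have : epi (inf_fun L J A x0) (y, a) by [].
rewrite epi_inf_fun => /closure_normE h; rewrite lee_fin; apply/ler_addgt0Pr => e /h.
move=> [_ [[[[y' u] b] c] [/= h1 h2] <-]]; rewrite prod_normE gt_max => /andP[_ /=].
rewrite distrC => /(le_lt_trans (ler_norm _)) ba.
have := le_trans (Lm _) h1; have := le_trans (Jm _) h2; rewrite /= !lee_fin.
by move: ba; rewrite -[_ + _]/((b : R) - (a : R)); lra.
Qed.

(** * The zero integrand and random recession cones *)

Section normal_integrand_zero.
Context {R : realType} {d : measure_display} {Om : measurableType d}.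
Context {V : normedModType R} {pV : proper V}.
Variables (H : set (set Om)) (sH : sigma_algebra setT H).

Lemma normal_integrand0 : normal_integrand H (fun (_ : V) (_ : Om) => 0%E : \bar R).
Proof using sH.
have cl : closed ((snd : V * R^o -> R^o) @^-1` [set y | 0 <= y]).
  by apply: preimage_closed => [x _|]; [exact: continuous_snd|exact: closed_ge].
by apply: (random_set_normal_integrand _ (random_set_cst sH cl)) => w [x a]; rewrite /epi/= lee_fin.
Qed.

Lemma rec_epi0 (v : V) : rec (epi (fun _ : V => 0%E : \bar R)) (v, 0).
Proof. by move=> [x a]; rewrite /epi/= addr0. Qed.

Lemma convex_efun0 : convex_efun (fun _ : V => 0%E : \bar R).
Proof.
apply/convex_efunE => x y t; rewrite /epi/= !lee_fin => x0 y0 /andP[t0 t1].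
by rewrite addr_ge0// mulr_ge0// subr_ge0.
Qed.

Lemma random_set_imp {W : topologicalType} (S : Om -> set W) (A : Om -> Prop) :
  H [set w | A w] -> random_set H S -> random_set H (fun w => [set x | A w -> S w x]).
Proof using sH.
move=> HA [cS mS]; split=> [w|O oO].
  have [Aw|nA] := pselect (A w).
    by rewrite (_ : mkset _ = S w)//; apply/seteqP; split=> x /=; tauto.
  rewrite (_ : mkset _ = setT); first exact: closedT.
  by apply/seteqP; split=> x /=; tauto.
have := sa_or sH (sa_and sH HA (mS O oO)) (sa_and sH (sa_not sH HA) (sa_const sH (O !=set0))).
apply: sa_ext => w; split=> [[[Aw [x [Sx Ox]]]|[nA [x Ox]]]|[x [Sx Ox]]].
- by exists x; split.
- by exists x; split.
- by have [Aw|nA] := pselect (A w); [left; split=> //; exists x; split=> //; exact: Sx|right; split=> //; exists x].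
Qed.

(** Recession directions are tested at countably many points of the epigraph. An empty epigraph
    imposes no test, its cone being the whole space, hence the implication. *)
Lemma random_rec (h : V -> Om -> \bar R) : normal_integrand H h ->
  random_set H (fun w => [set v : V | rec (epi (h ^~ w)) (v, 0)]).
Proof using sH pV.
move=> nh; have rh := random_set_epi nh; have [p [mp Sp dp]] := castaing sH rh.
have rE := random_set_imp (random_set_nonempty rh) rh.
rewrite (_ : (fun w => _) = (fun w => [set v : V | forall n, epi (h ^~ w) !=set0 ->
    epi (h ^~ w) (p n w + (v, 0))])).
  apply: (@random_set_preimages _ _ _ H sH V (V * R^o)%type _ _ (fun _ w =>
    [set x | epi (h ^~ w) !=set0 -> epi (h ^~ w) x]) (fun n v w => p n w + (v, 0))).
  - by move=> _.
  - move=> n w; apply: continuousD; first exact: continuous_cst.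
    by apply: continuous_pair; [exact: continuous_id|exact: continuous_cst].
  - move=> n v; have c : continuous (fun z : V * R^o => z + (v, 0)).
      by apply: continuousD; [exact: continuous_id|exact: continuous_cst].
    exact: (mwrt_comp c (mp n)).
apply/funext => w; apply/seteqP; split=> [v rv n h0|v Rv xa gxa]; first by apply: rv; exact: Sp.
have [cl _] := nh; apply/(closed_normE _).1 => [|e e0]; first exact: cl.
have [n hn] := dp w _ _ gxa e0; exists (p n w + (v, 0)); first by apply: Rv; exists xa.
by rewrite opprD addrACA subrr addr0.
Qed.

Lemma convex_cone_rec_epi (g : V -> \bar R) : convexS (epi g) ->
  convex_cone [set v | rec (epi g) (v, 0)].
Proof.
move=> cg; split=> [|u v ru rv|t v t0 rv] /=.
- by move=> c; rewrite -[(0, 0)]/(0 : V * R^o) addr0.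
- by have := recD ru rv; rewrite -[(_, _) + _]/(u + v, 0 + 0 : R^o) addr0.
- by have := rec_scale cg rv t0; rewrite -[_ *: _]/(t *: v, t *: 0 : R^o) scaler0.
Qed.

(** Linearity is assumed for processes. This lemma turns symmetry of measurable selections into
    symmetry of almost every value of [S], which the pointwise projection arguments require. *)
Lemma random_set_opp (P : probability Om R) (S : Om -> set V) : random_set H S ->
  {ae P, forall w, S w 0} ->
  (forall v, measurable_wrt H v -> {ae P, forall w, S w (v w)} -> {ae P, forall w, S w (- v w)}) ->
  {ae P, forall w, forall v, S w v -> S w (- v)}.
Proof using sH pV.
move=> rS S0 hS; have [v [mv Sv dv]] := castaing sH rS.
have SN n : {ae P, forall w, S w (- v n w)}.
  by apply: hS => //; apply: filterS S0 => w h0; apply: Sv; exists 0.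
apply: filterS (ae_foralln SN) => w hw u Su; have [cl _] := rS.
apply/(closed_normE _).1 => [|e e0]; first exact: cl.
have [n hn] := dv w u e Su e0; exists (- v n w) => //.
by rewrite -opprD normrN.
Qed.

End normal_integrand_zero.

Section conditional_integrand_convex_version.
Context {R : realType} {d : measure_display} {Om : measurableType d}.
Variable P : probability Om R.
Variables (G : set (set Om)) (sG : sigma_algebra setT G) (GF : G `<=` measurable).
Context {V : normedModType R} {pV : proper V}.

(** [convex_integrand] asks for convexity at every outcome, whereas [cond_integrand_convex] gives it
    almost surely. Rational combinations of a Castaing representation test convexity through an
    event [D] of [G], off which [g] is replaced by [0]. *)
Lemma cond_integrand_exists_convex (h : V -> Om -> \bar R) :
  normal_integrand measurable h -> lower_bounded P h -> convex_integrand h ->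
  exists2 g, cond_integrand P G h g & convex_integrand g.
Proof using sG GF pV.
move=> nh lh ch; have [g hg] := cond_integrand_exists sG GF nh lh; have [ng cg] := hg.
have aecg : {ae P, forall w, convex_efun (g ^~ w)}.
  exact: (cond_integrand_convex sG GF nh lh ch hg).
have [p [mp Sp dp]] := castaing sG (random_set_epi ng).
pose D w := forall n m (q : rat), 0 < (ratr q : R) < 1 ->
  epi (g ^~ w) !=set0 -> epi (g ^~ w) (ratr q *: p n w + (1 - ratr q) *: p m w).
have GD : G [set w | D w].
  apply: sa_all => // n; apply: sa_all => // m; apply: sa_all => // q.
  apply: sa_imp => //; first exact: sa_const.
  apply: sa_imp => //; first exact: random_set_nonempty (random_set_epi ng).
  have c : continuous (fun z : (V * R^o) * (V * R^o) => (ratr q : R) *: z.1 + (1 - ratr q) *: z.2).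
    apply: continuousD => z; apply: cvgZl_tmp; first exact: (@continuous_fst _ (V * R^o)%type).
    exact: (@continuous_snd _ (V * R^o)%type).
  exact: (random_set_mem sG (random_set_epi ng) (mwrt_comp c (mwrt_pair sG (mp n) (mp m)))).
have Dconv w : D w -> convex_efun (g ^~ w).
  move=> Dw; apply/convex_efunE => u v t gu gv.
  have [cl _] := ng; apply: (convexS_dense_rat (cl w) (dp w)) => // n m q q01.
  by apply: Dw => //; exists u.
have aeD : {ae P, forall w, D w}.
  apply: filterS aecg => w /convex_efunE cw n m q /andP[q0 q1] S0.
  by apply: cw; [exact: Sp|exact: Sp|rewrite (ltW q0) (ltW q1)].
exists (fun x w => if pselect (D w) then g x w else 0%E); last first.
  move=> w; case: (pselect (D w)) => [Dw|nD] /=; [exact: Dconv|exact: convex_efun0].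
split.
  have [c0 m0] := @normal_integrand0 R d Om V G sG; have [cl mg] := ng.
  split=> [w|O oO]; first by case: (pselect (D w)) => Dw; [exact: cl|exact: (c0 w)].
  have := sa_or sG (sa_and sG GD (mg O oO)) (sa_and sG (sa_not sG GD) (m0 O oO)).
  apply: sa_ext => w; case: (pselect (D w)) => Dw; split.
  - by case=> [[]|[]].
  - by left.
  - by case=> [[]|[]].
  - by right.
move=> x mx; have mgx : measurable_wrt G (fun w => g (x w) w) by exact: normal_integrand_mwrt.
have mif : measurable_wrt G (fun w => if pselect (D w) then g (x w) w else 0%E).
  by apply: mwrt_if => //; exact: mwrt_cst.
split=> // A GA; have mA := GF GA; have [_ <-//] := cg x mx.
apply: ae_eq_integral => //; try by apply: measurable_funTS; exact: (mwrt_measurable_ereal sG GF).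
by apply: filterS aeD => w Dw _; case: pselect.
Qed.

End conditional_integrand_convex_version.

(** * Recession functions and recession cones *)

(** By convexity the difference quotient is nondecreasing in the step, so its limit is a supremum. A
    negative supremum would drive [g] below [m], and the supremum is at most [0] exactly when [g]
    never exceeds its base value along the ray. *)
Lemma recession_sign {R : realType} {V : normedModType R} (g : V -> \bar R) (m : R) (v : V) :
  closed (epi g) -> convexS (epi g) -> (forall x, m%:E <= g x)%E -> dom g !=set0 ->
  (0 <= recession g v)%E /\ ((recession g v <= 0)%E <-> rec (epi g) (v, 0)).
Proof.
move=> cl cg gm [x0 gx0]; rewrite /recession; set xb := xget _ _.
have /= : dom g xb by exact: (xgetI 0 gx0).
rewrite /dom/=; have := gm xb; case Ec : (g xb) => [c| |]//; rewrite ?ltxx// => _ _.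
(* Replacing the step by [max a 1] makes the quotient monotone on the whole line and changes nothing
   near [+oo]. *)
pose q (a : R) : \bar R := ((g (xb + Num.max a 1 *: v)%R - c%:E) * ((Num.max a 1)^-1)%:E)%E.
have q_leP (a k : R) : (q a <= k%:E)%E <->
    (g (xb + Num.max a 1 *: v)%R <= (c + k * Num.max a 1)%:E)%E.
  have a0 : 0 < Num.max a 1 by rewrite lt_max ltr01 orbT.
  rewrite /q; have := gm (xb + Num.max a 1 *: v); case: (g _) => [r| |]// _.
    by rewrite -EFinB -EFinM !lee_fin ler_pdivrMr// lerBlDl.
  by rewrite addye// gt0_mulye ?lte_fin ?invr_gt0// !leye_eq.
have ndq : nondecreasing_fun q.
  move=> a b ab; apply: lee_real => k /q_leP hb; apply/q_leP.
  move: hb; set a' := Num.max a 1; set b' := Num.max b 1 => hb.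
  have a0 : 0 < a' by rewrite lt_max ltr01 orbT.
  have ab' : a' <= b' by rewrite ge_max le_max ab/= le_max lexx orbT.
  have b0 : 0 < b' := lt_le_trans a0 ab'.
  have Ecb : epi g (xb, c : R^o) by rewrite /epi/= Ec.
  have := cg (xb + b' *: v, c + k * b' : R^o) (xb, c : R^o) (a' / b') hb Ecb.
  rewrite divr_ge0 ?(ltW a0) ?(ltW b0)//= ler_pdivrMr// mul1r ab' => /(_ isT).
  rewrite conv_combE /epi/=.
  have -> : xb + b' *: v - xb = b' *: v by rewrite addrAC subrr add0r.
  rewrite scalerA divfK ?gt_eqF//.
  have -> : c + (a' / b') *: ((c + k * b') - c : R^o) = c + k * a' :> R.
    by rewrite -[_ *: _]/(a' / b' * _); field; rewrite gt_eqF.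
  by [].
have cvq : ((g (xb + a *: v)%R - c%:E) * (a^-1)%:E)%E @[a --> +oo%R] --> ereal_sup (range q).
  apply: cvg_trans (nondecreasing_cvge ndq); apply: near_eq_cvg.
  by near=> a; rewrite /q max_l//; near: a; exact: nbhs_pinfty_ge.
rewrite (cvg_lim _ cvq)//; split.
  apply: lee_real => k hk; rewrite lee_fin leNgt; apply/negP => k0.
  have h n : m <= c + k * Num.max n 1.
    have : (q n <= k%:E)%E by apply: le_trans hk; apply: ereal_sup_ubound; exists n.
    by move=> /q_leP/(le_trans (gm _)); rewrite lee_fin.
  (* With negative slope [k], a step of at least [(c - m) / -k + 1] takes [c] plus [k] times the
     step below [m]. *)
  have := h ((c - m) / - k + 1).
  have : (c - m) / - k + 1 <= Num.max ((c - m) / - k + 1) 1 by rewrite le_max lexx.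
  move: (Num.max _ _) => M; rewrite -lerBrDr ler_pdivrMr ?oppr_gt0// mulrN mulrBl mul1r.
  by rewrite (mulrC M); lra.
split=> [h|rv].
  apply: (@rec_base _ _ _ (xb, c : R^o)) => //; first by rewrite /epi/= Ec.
  move=> n; have : (q n.+1%:R <= 0)%E by apply: le_trans h; apply: ereal_sup_ubound; exists n.+1%:R.
  by move=> /q_leP; rewrite max_l ?ler1n// mul0r addr0 /epi/= scaler0 addr0.
apply: ge_ereal_sup => _ [a _ <-]; apply/q_leP; rewrite mul0r addr0.
have a0 : 0 <= Num.max a 1 by rewrite le_max ler01 orbT.
have := rec_scale cg rv a0; move=> /(_ (xb, c : R^o)).
by rewrite /epi/= Ec lexx scaler0 addr0; exact.
Unshelve. all: by end_near. Qed.

Lemma sub_normal_integrand {R : realType} {d : measure_display} {Om : measurableType d}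
    {V : topologicalType} (G H : set (set Om)) (h : V -> Om -> \bar R) :
  G `<=` H -> normal_integrand G h -> normal_integrand H h.
Proof. by move=> GH [cl mh]; split=> // O /mh/GH. Qed.

Lemma mwrt_fine {R : realType} {d : measure_display} {Om : measurableType d}
    (H : set (set Om)) (Y : Om -> \bar R) : sigma_algebra setT H ->
  measurable_wrt H Y -> measurable_wrt H (fun w => fine (Y w) : R^o).
Proof.
move=> sH mY; apply: (mwrt_real_le sH) => a.
have := sa_or sH (sa_and sH (sa_const sH (0 <= a))
    (sa_or sH (mwrt_ereal_ge sH +oo mY) (mwrt_ereal_le sH -oo mY)))
  (sa_and sH (mwrt_ereal_le sH a%:E mY) (mwrt_ereal_gt -oo mY)).
apply: sa_ext => w; case: (Y w) => [b| |] /=.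
- by rewrite ltNyr lee_fin leye_eq leeNy_eq; split=> [[[_ []]|[]]|]//; right.
- by rewrite leey leye_eq/=; split=> [[[]|[]]|]//; left; split => //; left.
- by rewrite lexx ltxx; split=> [[[]|[]]|]//; left; split => //; right.
Qed.

(** * Attainment and recession cones of random infimal compositions *)

Section random_infimal_composition_recession.
Context {R : realType} {d : measure_display} {Om : measurableType d}.
Variable P : probability Om R.
Context {X Y U : normedModType R}.
Context {pX : proper X} {pY : proper Y} {pU : proper U}.
Variables (H : set (set Om)) (sH : sigma_algebra setT H).
Variables (L : Y * U -> Om -> \bar R) (J : X -> Om -> \bar R).
Variables (A : Om -> Y * U -> X) (x0 : Om -> X).
Hypotheses (nL : normal_integrand H L) (nJ : normal_integrand H J).
Hypotheses (convL : convex_integrand L) (convJ : convex_integrand J).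
Hypotheses (lbL : lower_bounded P L) (lbJ : lower_bounded P J).
Hypotheses (lA : forall w, linear (A w)) (cA : forall w, continuous (A w)).
Hypotheses (mA : forall z, measurable_wrt H (A ^~ z)) (mx0 : measurable_wrt H x0).
Variables (KL : Om -> set (Y * U)) (KJ : Om -> set X).
Hypothesis recL :
  {ae P, forall w, epi (L ^~ w) !=set0 -> forall v, KL w v <-> rec (epi (L ^~ w)) (v, 0)}.
Hypothesis recJ :
  {ae P, forall w, epi (J ^~ w) !=set0 -> forall v, KJ w v <-> rec (epi (J ^~ w)) (v, 0)}.
Hypothesis ker_sym : {ae P, forall w, forall u, KL w (0, u) -> KJ w (A w (0, u)) ->
  KL w (0, - u) /\ KJ w (A w (0, - u))}.

Definition rinf_fun (y : Y) (w : Om) : \bar R :=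
  inf_fun (L ^~ w) (J ^~ w) (A w) (x0 w) y.

Lemma normal_rinf_fun : normal_integrand H rinf_fun.
Proof using sH nL nJ cA mA mx0 pX pY pU. exact: normal_inf_fun. Qed.

Lemma convex_rinf_fun : convex_integrand rinf_fun.
Proof using convL convJ lA.
move=> w; apply/convex_efunE; apply: convex_inf_fun; first exact: lA.
- exact/convex_efunE/convL.
- exact/convex_efunE/convJ.
Qed.

Lemma lower_bounded_rinf_fun : lower_bounded P rinf_fun.
Proof using lbL lbJ.
have [m im hm] := lbL; have [m' im' hm'] := lbJ; exists (fun w => m w + m' w).
  by rewrite (_ : _ \o _ = ((EFin \o m) \+ (EFin \o m'))%E)//; exact: integrableD.
by apply: filterS2 hm hm' => w; exact: inf_fun_ge.
Qed.

Let cEL w : convexS (epi (L ^~ w)). Proof. exact/convex_efunE/convL. Qed.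
Let cEJ w : convexS (epi (J ^~ w)). Proof. exact/convex_efunE/convJ. Qed.
Let clL w : closed (epi (L ^~ w)). Proof. by have [+ _] := nL; apply. Qed.
Let clJ w : closed (epi (J ^~ w)). Proof. by have [+ _] := nJ; apply. Qed.

Let lower_bounds : {ae P, forall w, exists m m' : R,
  (forall z, m%:E <= L z w)%E /\ (forall x, m'%:E <= J x w)%E}.
Proof.
have [m im hm] := lbL; have [m' im' hm'] := lbJ.
by apply: filterS2 hm hm' => w h h'; exists (m w), (m' w).
Qed.

Let ker_rec : {ae P, forall w, epi (L ^~ w) !=set0 -> epi (J ^~ w) !=set0 ->
  forall u, rec (epi (L ^~ w)) ((0, u), 0) -> rec (epi (J ^~ w)) (A w (0, u), 0) ->
    rec (epi (L ^~ w)) ((0, - u), 0) /\ rec (epi (J ^~ w)) (A w (0, - u), 0)}.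
Proof.
apply: filterS3 recL recJ ker_sym => w hL hJ hK L0 J0 u /(hL L0) rL /(hJ J0) rJ.
by have [/(hL L0) ? /(hJ J0) ?] := hK u rL rJ.
Qed.

Lemma rinf_fun_leP : {ae P, forall w, forall y (a : R),
  (rinf_fun y w <= a%:E)%E <->
  exists u, (L (y, u) w + J (A w (y, u) + x0 w)%R w <= a%:E)%E}.
Proof using lbL lbJ nL nJ convL convJ lA cA recL recJ ker_sym pX pY pU.
apply: filterS2 lower_bounds ker_rec => w [m [m' [Lm Jm]]] hk y a.
exact: (inf_fun_leP (x0 w) (lA w) (@cA w) (@clL w) (@clJ w) (@cEL w) (@cEJ w) Lm Jm hk y a).
Qed.

Lemma rinf_funE : {ae P, forall w, forall y,
  rinf_fun y w = ereal_inf (range (fun u => L (y, u) w + J (A w (y, u) + x0 w)%R w)%E)}.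
Proof using lbL lbJ nL nJ convL convJ lA cA recL recJ ker_sym pX pY pU.
apply: filterS2 lower_bounds ker_rec => w [m [m' [Lm Jm]]] hk y.
exact: (inf_funE (x0 w) (lA w) (@cA w) (@clL w) (@clJ w) (@cEL w) (@cEJ w) Lm Jm hk y).
Qed.

Lemma rec_rinf_fun : {ae P, forall w, epi (rinf_fun ^~ w) !=set0 -> forall v,
  (exists u, KL w (v, u) /\ KJ w (A w (v, u))) <-> rec (epi (rinf_fun ^~ w)) (v, 0)}.
Proof using lbL lbJ nL nJ convL convJ lA cA recL recJ ker_sym pX pY pU.
have rLJ : {ae P, forall w, epi (L ^~ w) !=set0 -> epi (J ^~ w) !=set0 -> forall v u,
    KL w (v, u) /\ KJ w (A w (v, u)) <->
    rec (epi (L ^~ w)) (v, u, 0) /\ rec (epi (J ^~ w)) (A w (v, u), 0)}.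
  by apply: filterS2 recL recJ => w hL hJ L0 J0 v u; rewrite (hL L0) (hJ J0).
apply: filterS3 lower_bounds ker_rec rLJ => w [m [m' [Lm Jm]]] hk hr h0 v.
have [L0 J0] : epi (L ^~ w) !=set0 /\ epi (J ^~ w) !=set0.
  have [p] := h0; rewrite epi_inf_fun => /closure_normE/(_ 1 ltr01)[q [r Er _] _].
  by apply: (@sum_epi_nonempty _ _ _ _ (L ^~ w) (J ^~ w) (A w) (x0 w)); exists r.
rewrite (rec_inf_fun (lA w) (@cA w) (@clL w) (@clJ w) (@cEL w) (@cEJ w) Lm Jm hk h0 v).
by split=> -[u hu]; exists u; apply/(hr L0 J0).
Qed.

(** Pairs of a control and a height for [L] are selected, the total height being the real value of
    the infimum. Where the infimum is [+oo] any control will do, so the default value of [fine] is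
    harmless. *)
Lemma rinf_fun_attained (y : Om -> Y) : measurable_wrt H y ->
  exists2 u : Om -> U, measurable_wrt H u &
    {ae P, forall w, (L (y w, u w) w + J (A w (y w, u w) + x0 w)%R w <= rinf_fun (y w) w)%E}.
Proof using sH lbL lbJ nL nJ convL convJ lA cA mA mx0 recL recJ ker_sym pX pY pU.
move=> my; pose r w : R^o := fine (rinf_fun (y w) w).
have mr : measurable_wrt H r.
  by apply: (mwrt_fine sH); apply: (normal_integrand_mwrt sH) => //; exact: normal_rinf_fun.
pose f (p : U * R^o) w : ((Y * U) * R^o) * (X * R^o) :=
  (((y w, p.1), p.2), (A w (y w, p.1) + x0 w, r w - p.2)).
have rS : random_set H (fun w => [set p | (epi (L ^~ w) `*` epi (J ^~ w)) (f p w)]).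
  have cyu w : continuous (fun p : U * R^o => (y w, p.1)).
    by apply: continuous_pair; [exact: continuous_cst|exact: continuous_fst].
  have myu (u : U) : measurable_wrt H (fun w => (y w, u)) by exact: (mwrt_pair sH my (mwrt_cst sH u)).
  apply: (@random_set_preimage _ _ _ H sH _ _ _ _ (fun w => epi (L ^~ w) `*` epi (J ^~ w)) f).
  - exact: random_set_prod.
  - move=> w; apply: continuous_pair.
      by apply: continuous_pair; [exact: cyu|exact: continuous_snd].
    apply: continuous_pair.
      apply: continuousD; last exact: continuous_cst.
      exact: (continuous_comp2 (cyu w) (@cA w)).
    by apply: continuousB; [exact: continuous_cst|exact: continuous_snd].
  - move=> p.
    have m1 : measurable_wrt H (fun w => A w (y w, p.1) + x0 w).
      have mAy : measurable_wrt H (fun w => A w (y w, p.1)).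
        exact: (mwrt_caratheodory sH cA mA (myu p.1)).
      exact: (mwrtD sH mAy mx0).
    have m2 : measurable_wrt H (fun w => r w - p.2 : R^o).
      have c : continuous (fun z : R^o => z - p.2).
        by apply: continuousB; [exact: continuous_id|exact: continuous_cst].
      exact: (mwrt_comp c mr).
    exact: (mwrt_pair sH (mwrt_pair sH (myu p.1) (mwrt_cst sH p.2)) (mwrt_pair sH m1 m2)).
have [ub [mub hub]] := measurable_selection sH rS.
exists (fun w => (ub w).1); first exact: (mwrt_comp continuous_fst mub).
apply: filterS2 lower_bounds rinf_fun_leP => w [m [m' [Lm Jm]]] hle.
have := inf_fun_ge (A w) (x0 w) Lm Jm (y w); rewrite -/(rinf_fun (y w) w).
have := hub w; rewrite /f /r /=; case E : (rinf_fun (y w) w) => [a| |] //= h _; last first.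
  by rewrite leey.
have hya : (rinf_fun (y w) w <= a%:E)%E by rewrite E.
have [[[[z u] c] b] [/= h1 h2] [zE cE]] :=
  (inf_epiE (A w) (x0 w) Lm Jm (y w) a).2 ((hle (y w) a).1 hya).
have [|/=] := h; first by exists (u, b : R^o); rewrite /= -zE -cE.
rewrite /epi/= => h3 h4; apply: le_trans (leeD h3 h4) _.
by rewrite -EFinD subrKC.
Qed.

End random_infimal_composition_recession.

(** * Recession plans *)

Section recession_plans.
Context {R : realType} {d : measure_display} {Om : measurableType d}.
Variable P : probability Om R.
Context {X B U : normedModType R} {pX : proper X} {pB : proper B} {pU : proper U}.
Variables (T : nat) (Fil : nat -> set (set Om)) (hFil : filtration T Fil).
Variables (L : nat -> X * B * U -> Om -> \bar R) (J : X -> Om -> \bar R).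
Variable Phi : nat -> Om -> X * B * U -> X.
Hypothesis nL : forall t, (t < T)%N -> normal_integrand (Fil t.+1) (L t).
Hypothesis convL : forall t, (t < T)%N -> convex_integrand (L t).
Hypotheses (nJ : normal_integrand (Fil T) J) (convJ : convex_integrand J).
Hypothesis lPhi : forall t w, linear (Phi t w).
Hypothesis cPhi : forall t w, continuous (Phi t w).
Hypothesis mPhi : forall t z, (t < T)%N -> measurable_wrt (Fil t.+1) (Phi t ^~ z).

Local Notation plan :=
  ((nat -> Om -> X) * (nat -> Om -> B) * (nat -> Om -> U))%type.
Implicit Types (Z : plan) (t : nat) (w : Om).

Lemma sigma_algebra_filtration t : (t <= T)%N -> sigma_algebra setT (Fil t).
Proof using hFil. by have [+ _] := hFil => /(_ t) + tT => /(_ tT)[]. Qed.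

Lemma filtration_measurable t : (t <= T)%N -> Fil t `<=` measurable.
Proof using hFil. by have [+ _] := hFil => /(_ t) + tT => /(_ tT)[]. Qed.

Lemma filtrationS t : (t < T)%N -> Fil t `<=` Fil t.+1.
Proof using hFil. by have [_ +] := hFil => /(_ t t.+1) + tT; apply; rewrite leqnSn. Qed.

Definition adapted_plan Z : Prop := forall t, (t <= T)%N ->
  [/\ measurable_wrt (Fil t) (Z.1.1 t), measurable_wrt (Fil t) (Z.1.2 t) &
      measurable_wrt (Fil t) (Z.2 t)].

(** Recession constraints are expressed through epigraphs; [recession_coneP] relates them to the
    recession functions of the linearity assumption. *)
Definition rec_step t Z w : Prop :=
  rec (epi (L t ^~ w)) (Z.1.1 t w, Z.1.2 t w, Z.2 t.+1 w, 0) /\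
  Z.1.1 t.+1 w = Phi t w (Z.1.1 t w, Z.1.2 t w, Z.2 t.+1 w).

Definition rec_plan t Z : Prop := adapted_plan Z /\
  {ae P, forall w, (forall s, (t <= s < T)%N -> rec_step s Z w) /\
                   rec (epi (J ^~ w)) (Z.1.1 T w, 0)}.

Definition opp_plan Z : plan :=
  (fun t w => - Z.1.1 t w, fun t w => - Z.1.2 t w, fun t w => - Z.2 t w).

Hypothesis rec_plan0_opp : forall Z, rec_plan 0 Z -> rec_plan 0 (opp_plan Z).

Let Phi0 t w : Phi t w 0 = 0.
Proof. by have := lPhi t w (-1) 0 0; rewrite scaler0 addr0 scaleN1r addNr. Qed.
Let PhiZ t w a x : Phi t w (a *: x) = a *: Phi t w x.
Proof. by have := lPhi t w a x 0; rewrite Phi0 !addr0. Qed.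
Let PhiD t w x y : Phi t w (x + y) = Phi t w x + Phi t w y.
Proof. by have := lPhi t w 1 x y; rewrite !scale1r. Qed.
(* A recession plan in state [0] at time [t] extends by [0] to earlier times. *)
Lemma rec_plan_opp t Z : (t <= T)%N -> rec_plan t Z -> Z.1.1 t = (fun=> 0) ->
  rec_plan t (opp_plan Z).
Proof using hFil rec_plan0_opp lPhi.
move=> tT [aZ rZ] X0.
(* The last component is erased up to time [t] included: its value at [t] belongs to the stage that
   ends in the state [0] at time [t]. *)
pose Z2 : plan := (fun s => if (s < t)%N then fun=> 0 else Z.1.1 s,
                   fun s => if (s < t)%N then fun=> 0 else Z.1.2 s,
                   fun s => if (s <= t)%N then fun=> 0 else Z.2 s).
have E1 s : (t <= s)%N -> Z2.1.1 s = Z.1.1 s by move=> ts; rewrite /= ltnNge ts.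
have E2 s : (t <= s)%N -> Z2.1.2 s = Z.1.2 s by move=> ts; rewrite /= ltnNge ts.
have E3 s : (t <= s)%N -> Z2.2 s.+1 = Z.2 s.+1 by move=> ts; rewrite /= ltnNge ts.
have E4 s : (s <= t)%N -> Z2.1.1 s = (fun=> 0).
  by rewrite leq_eqVlt => /predU1P[->|] /=; [rewrite ltnn|move=> ->].
have E5 s : (s < t)%N -> Z2.1.2 s = (fun=> 0) by move=> /= ->.
have E6 s : (s < t)%N -> Z2.2 s.+1 = (fun=> 0) by move=> /= ->.
have [] : rec_plan 0 (opp_plan Z2).
  apply: rec_plan0_opp; split.
    move=> s sT; have sF := sigma_algebra_filtration sT; have [m1 m2 m3] := aZ s sT.
    by split=> /=; case: ifP => // _; exact: mwrt_cst.
  apply: filterS rZ => w [hs hT]; split; last by rewrite E1.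
  move=> s /andP[_ sT]; rewrite /rec_step; have [st|ts] := ltnP s t.
    rewrite E4 ?(ltnW st)// E4// E5// E6//.
    have -> : (0, 0, 0) = 0 :> X * B * U by [].
    by rewrite Phi0; split=> // c; rewrite -[(0, 0)]/(0 : X * B * U * R^o) addr0.
  rewrite E1// E2// E3// E1 ?(leq_trans ts)//.
  by apply: hs; rewrite ts.
move=> _ hZ2; split.
  move=> s sT; have [m1 m2 m3] := aZ s sT.
  by split; exact: mwrtN.
have O1 s : (t <= s)%N -> (opp_plan Z2).1.1 s = (opp_plan Z).1.1 s.
  by move=> ts; rewrite /= ltnNge ts.
have O2 s : (t <= s)%N -> (opp_plan Z2).1.2 s = (opp_plan Z).1.2 s.
  by move=> ts; rewrite /= ltnNge ts.
have O3 s : (t <= s)%N -> (opp_plan Z2).2 s.+1 = (opp_plan Z).2 s.+1.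
  by move=> ts; rewrite /= ltnNge ts.
apply: filterS hZ2 => w [hs hT]; split; last by rewrite -O1.
move=> s /andP[ts sT]; have := hs s; rewrite sT => /(_ isT).
by rewrite /rec_step O1// O2// O3// O1// (leq_trans ts).
Qed.

(** The candidate for the recession cone of [Q_t] when [K] is the cone attached to [J_(t+1)];
    [rec_rinf_fun] confirms it almost surely where the epigraph of [Q_t] is nonempty. *)
Definition rec_stepQ t (K : Om -> set X) w : set (X * B) :=
  [set y | exists u, rec (epi (L t ^~ w)) (y, u, 0) /\ K w (Phi t w (y, u))].

(* [K] represents the states at time [t] from which a recession plan exists. *)
Definition plan_cone t (K : Om -> set X) : Prop :=
  [/\ random_set (Fil t) K, {ae P, forall w, convex_cone (K w)} &
      forall x, measurable_wrt (Fil t) x ->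
        ({ae P, forall w, K w (x w)} <-> exists2 Z, rec_plan t Z & Z.1.1 t = x)].

Lemma plan_cone_last : plan_cone T (fun w => [set v | rec (epi (J ^~ w)) (v, 0)]).
Proof using hFil nJ convJ pX.
have sF := sigma_algebra_filtration (leqnn T); split.
- exact: random_rec.
- apply: aeW => w; apply: convex_cone_rec_epi; exact/convex_efunE/convJ.
- move=> x mx; split=> [rx|[Z [_ rZ] <-]]; last by apply: filterS rZ => w [].
  exists (fun s => if s == T then x else fun=> 0, fun _ _ => 0, fun _ _ => 0); last by rewrite /= eqxx.
  split.
    move=> t tT; have sFt := sigma_algebra_filtration tT.
    by split=> /=; [case: (eqVneq t T) => [->//|_]|..]; exact: mwrt_cst.
  by apply: filterS rx => w rx; split=> [s|]; [rewrite ltnNge andbN|rewrite /= eqxx].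
Qed.

Section step.
Variables (t : nat) (tT : (t < T)%N) (K' : Om -> set X) (pK' : plan_cone t.+1 K').

Let sF := sigma_algebra_filtration (ltnW tT).
Let sF1 := sigma_algebra_filtration tT.

Let rec_plan_glue x ub u Z' : measurable_wrt (Fil t) x -> measurable_wrt (Fil t) ub ->
  measurable_wrt (Fil t.+1) u -> rec_plan t.+1 Z' ->
  {ae P, forall w, rec (epi (L t ^~ w)) (x w, ub w, u w, 0)} ->
  Z'.1.1 t.+1 = (fun w => Phi t w (x w, ub w, u w)) ->
  exists Z, [/\ rec_plan t Z, Z.1.1 t = x, Z.1.2 t = ub & Z.2 t.+1 = u].
Proof.
move=> mx mub mu [aZ' rZ'] rL EX.
pose Z : plan := (fun s => if (s < t)%N then fun=> 0 else if s == t then x else Z'.1.1 s,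
                  fun s => if (s < t)%N then fun=> 0 else if s == t then ub else Z'.1.2 s,
                  fun s => if (s <= t)%N then fun=> 0 else if s == t.+1 then u else Z'.2 s).
have E1 s : (t < s)%N -> Z.1.1 s = Z'.1.1 s by move=> ts; rewrite /= ltnNge ltnW// gtn_eqF.
have E2 s : (t < s)%N -> Z.1.2 s = Z'.1.2 s by move=> ts; rewrite /= ltnNge ltnW// gtn_eqF.
have E3 s : (t < s)%N -> Z.2 s.+1 = Z'.2 s.+1 by move=> ts; rewrite /= ltnNge ltnW//= eqSS gtn_eqF.
have X1 : Z.1.1 t = x by rewrite /= ltnn eqxx.
have X2 : Z.1.2 t = ub by rewrite /= ltnn eqxx.
have X3 : Z.2 t.+1 = u by rewrite /= ltnn eqxx.
exists Z; split=> //; split.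
  move=> s sT; have sFs := sigma_algebra_filtration sT; have [m1 m2 m3] := aZ' s sT.
  split; [move: m1|move: m2|move: m3] => m /=.
  - by case: ltngtP => [_|//|->//]; exact: mwrt_cst.
  - by case: ltngtP => [_|//|->//]; exact: mwrt_cst.
  - by case: ifP => _; [exact: mwrt_cst|case: (eqVneq s t.+1) => [->|]].
apply: filterS2 rZ' rL => w [hs hT] rLw; split; last by rewrite E1.
move=> s; rewrite leq_eqVlt => /andP[/predU1P[<- _|ts sT]].
  by rewrite /rec_step X1 X2 X3 E1// EX.
by rewrite /rec_step E1// E2// E3// E1 ?(leq_trans ts)//; apply: hs; rewrite ts.
Qed.

Let mPhi_comp (z : Om -> X * B * U) : measurable_wrt (Fil t.+1) z ->
  measurable_wrt (Fil t.+1) (fun w => Phi t w (z w)).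
Proof. by move=> mz; exact: (mwrt_caratheodory sF1 (@cPhi t) (fun z => @mPhi t z tT) mz). Qed.

Let C w : set (X * B * U) := [set z | rec (epi (L t ^~ w)) (z, 0) /\ K' w (Phi t w z)].

Let rC : random_set (Fil t.+1) C.
Proof.
have [rK' _ _] := pK'; pose RL w := [set v : X * B * U | rec (epi (L t ^~ w)) (v, 0)].
have rL : random_set (Fil t.+1) RL by exact (random_rec sF1 (nL tT)).
apply: (@random_set_preimage _ _ _ _ sF1 _ _ _ _ (fun w => RL w `*` K' w)
  (fun z w => (z, Phi t w z))).
- exact: random_set_prod.
- by move=> w; apply: continuous_pair; [exact: continuous_id|exact: cPhi].
- by move=> z; exact: (mwrt_pair sF1 (mwrt_cst sF1 z) (mPhi z tT)).
Qed.

Let coneC : {ae P, forall w, convex_cone (C w)}.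
Proof.
have [_ cK' _] := pK'; apply: filterS cK' => w [K0 KD KZ].
have cL : convexS (epi (L t ^~ w)) by apply/convex_efunE; exact: convL.
have [L0 LD LZ] := convex_cone_rec_epi cL.
split=> [|y z [y1 y2] [z1 z2]|a z a0 [z1 z2]].
- by split; [exact: L0|rewrite Phi0].
- by split; [exact: LD|rewrite PhiD; exact: KD].
- by split; [exact: LZ|rewrite PhiZ; exact: KZ].
Qed.

Lemma rec_plan_succ Z : rec_plan t Z -> rec_plan t.+1 Z.
Proof.
move=> [aZ rZ]; split=> //; apply: filterS rZ => w [hs hT]; split=> // s /andP[/ltnW ts sT].
by apply: hs; rewrite ts.
Qed.

Lemma rec_plan_stepQ Z : rec_plan t Z ->
  {ae P, forall w, C w (Z.1.1 t w, Z.1.2 t w, Z.2 t.+1 w)}.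
Proof using hFil pK' tT.
move=> hZ; have [aZ rZ] := hZ; have [_ _ cK'] := pK'; have [mX _ _] := aZ _ tT.
have KX : {ae P, forall w, K' w (Z.1.1 t.+1 w)}.
  by apply/cK' => //; exists Z => //; exact: rec_plan_succ.
apply: filterS2 rZ KX => w [/(_ t) + _].
by rewrite leqnn tT => /(_ isT)[hr hE]; rewrite hE.
Qed.

(** The control [u] is selected measurably at time [t.+1], and the plan is continued from the new
    state by the property of [K']. *)
Lemma rec_stepQ_plan x ub : measurable_wrt (Fil t) x -> measurable_wrt (Fil t) ub ->
  {ae P, forall w, rec_stepQ t K' w (x w, ub w)} <->
  exists Z, [/\ rec_plan t Z, Z.1.1 t = x & Z.1.2 t = ub].
Proof using hFil nL convL nJ lPhi cPhi mPhi pK' tT pX pB pU.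
move=> mx mub; split=> [hC|[Z [/rec_plan_stepQ hZ EX EB]]]; last first.
  by apply: filterS hZ => w; rewrite EX EB; exists (Z.2 t.+1 w).
have mx1 := sub_mwrt (filtrationS tT) mx; have mub1 := sub_mwrt (filtrationS tT) mub.
have rS : random_set (Fil t.+1) (fun w => [set u | C w (x w, ub w, u)]).
  apply: (@random_set_preimage _ _ _ _ sF1 _ _ _ _ C (fun u w => (x w, ub w, u))) => //.
    by move=> w; apply: continuous_pair; [exact: continuous_cst|exact: continuous_id].
  by move=> u; exact: (mwrt_pair sF1 (mwrt_pair sF1 mx1 mub1) (mwrt_cst sF1 u)).
have [u [mu hu]] := measurable_selection sF1 rS.
have {}hu : {ae P, forall w, C w (x w, ub w, u w)}.
  by apply: filterS hC => w [u0 hu0]; apply: hu; exists u0.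
have mF : measurable_wrt (Fil t.+1) (fun w => Phi t w (x w, ub w, u w)).
  exact: (mPhi_comp (mwrt_pair sF1 (mwrt_pair sF1 mx1 mub1) mu)).
have [_ _ /(_ _ mF)[hK' _]] := pK'.
have [|Z' rZ' EZ'] := hK'; first by apply: filterS hu => w [].
have rL : {ae P, forall w, rec (epi (L t ^~ w)) (x w, ub w, u w, 0)}.
  by apply: filterS hu => w [].
by have [Z [? ? ? _]] := rec_plan_glue mx mub mu rZ' rL EZ'; exists Z.
Qed.

(** A selected kernel direction starts a plan with zero state and zero [ub] at time [t]; the
    opposite plan supplies the opposite direction. *)
Lemma rec_stepQ_ker : {ae P, forall w, forall u,
  rec (epi (L t ^~ w)) (0, u, 0) -> K' w (Phi t w (0, u)) ->
  rec (epi (L t ^~ w)) (0, - u, 0) /\ K' w (Phi t w (0, - u))}.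
Proof using hFil nL convL nJ lPhi cPhi mPhi pK' tT pX pB pU rec_plan0_opp.
have rS : random_set (Fil t.+1) (fun w => [set u | C w (0, u)]).
  apply: (@random_set_preimage _ _ _ _ sF1 _ _ _ _ C (fun u w => (0, u))) => //.
    by move=> w; apply: continuous_pair; [exact: continuous_cst|exact: continuous_id].
  by move=> u; exact: mwrt_cst.
suff : {ae P, forall w, forall u, C w (0, u) -> C w (0, - u)}.
  by apply: filterS => w h u h1 h2; exact: (h u (conj h1 h2)).
apply: (random_set_opp sF1 rS) => [|u mu hu].
  by apply: filterS coneC => w [].
have mF : measurable_wrt (Fil t.+1) (fun w => Phi t w (0, 0, u w)).
  exact: (mPhi_comp (mwrt_pair sF1 (mwrt_cst sF1 (0 : X * B)) mu)).
have [_ _ /(_ _ mF)[hK' _]] := pK'.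
have [|Z' rZ' EZ'] := hK'; first by apply: filterS hu => w [].
have rL : {ae P, forall w, rec (epi (L t ^~ w)) (0, 0, u w, 0)}.
  by apply: filterS hu => w [].
have [Z [rZ EX EB EU]] := rec_plan_glue (mwrt_cst sF 0) (mwrt_cst sF 0) mu rZ' rL EZ'.
have := rec_plan_stepQ (rec_plan_opp (ltnW tT) rZ EX).
by apply: filterS => w; rewrite /= EX EB EU !oppr0.
Qed.

Lemma convex_cone_stepQ : {ae P, forall w, convex_cone (rec_stepQ t K' w)}.
Proof using convL lPhi pK' tT.
apply: filterS coneC => w [C0 CD CZ]; split.
- by exists 0; exact: C0.
- by move=> y z [u hu] [v hv]; exists (u + v); exact: (CD _ _ hu hv).
- by move=> a y a0 [u hu]; exists (a *: u); exact: (CZ _ _ a0 hu).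
Qed.

Lemma closed_stepQ : {ae P, forall w, closed (rec_stepQ t K' w)}.
Proof using hFil nL convL nJ lPhi cPhi mPhi pK' tT pX pB pU rec_plan0_opp.
have [clC _] := rC; apply: filterS2 coneC rec_stepQ_ker => w cC ker.
rewrite (_ : rec_stepQ t K' w = fst @` C w); last first.
  apply/seteqP; split=> [y [u hu]|_ [[y u] hu <-]]; last by exists u.
  by exists (y, u).
apply: closed_proj => //.
- exact: continuous_fst.
- exact: convex_cone_convex.
- move=> [y u]; rewrite (convex_cone_rec cC) => -[h1 h2] /= y0; rewrite y0 in h1 h2.
  by rewrite -[- _]/(- y, - u) y0 oppr0; exact: ker.
Qed.

(** [KE] is the adapted core of the stage cone and [K] its projection. Both are returned:
    [stage_exists] identifies [KE] with the recession cone of the conditional expectation of [Q_t],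
    and [K] with that of [J_t]. *)
Lemma plan_cone_step : exists KE K, [/\ random_set (Fil t) KE,
  forall y, measurable_wrt (Fil t) y ->
    ({ae P, forall w, KE w (y w)} <-> {ae P, forall w, rec_stepQ t K' w (y w)}),
  {ae P, forall w, forall ub, KE w (0, ub) -> KE w (0, - ub)},
  {ae P, forall w, forall x, K w x <-> exists ub, KE w (x, ub)} &
  plan_cone t K].
Proof using hFil nL convL nJ lPhi cPhi mPhi pK' tT pX pB pU rec_plan0_opp.
have GF := filtration_measurable (ltnW tT).
(* [rec_stepQ] is known to be closed only almost surely, and a random set has closed values at every
   outcome. *)
pose KQ w := closure (fst @` C w).
have KQE : {ae P, forall w, KQ w = rec_stepQ t K' w}.
  apply: filterS closed_stepQ => w cl; rewrite ((closure_id (rec_stepQ t K' w)).1 cl).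
  congr closure.
  apply/seteqP; split=> [_ [[y u] hu <-]|y [u hu]]; first by exists u.
  by exists (y, u).
have rKQ : random_set measurable KQ.
  have rQ := random_set_closure (@continuous_fst _ (X * B)%type U) rC.
  by have [cl mQ] := rQ; split=> // O /mQ; exact: (filtration_measurable tT).
have [KE rKE hKE'] := random_core P sF GF rKQ.
have hKE y : measurable_wrt (Fil t) y ->
    ({ae P, forall w, KE w (y w)} <-> {ae P, forall w, rec_stepQ t K' w (y w)}).
  move=> /hKE' ->; split=> h; apply: filterS2 KQE h => w; by [move=> <-|move=> ->].
have coneKE : {ae P, forall w, convex_cone (KE w)}.
  exact: (random_core_cone sF rKE hKE convex_cone_stepQ).
have ker : {ae P, forall w, forall ub, KE w (0, ub) -> KE w (0, - ub)}.
  have rS : random_set (Fil t) (fun w => [set ub | KE w (0, ub)]).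
    apply: (@random_set_preimage _ _ _ _ sF _ _ _ _ KE (fun ub w => (0, ub))) => //.
      by move=> w; apply: continuous_pair; [exact: continuous_cst|exact: continuous_id].
    by move=> ub; exact: mwrt_cst.
  suff : {ae P, forall w, forall ub, KE w (0, ub) -> KE w (0, - ub)} by [].
  apply: (random_set_opp sF rS) => [|ub mub hub]; first by apply: filterS coneKE => w [].
  have m0 := mwrt_cst sF (0 : X).
  have mNub : measurable_wrt (Fil t) (fun w => - ub w) by exact: mwrtN.
  apply/(hKE _ (mwrt_pair sF m0 mNub)); apply/(rec_stepQ_plan m0 mNub).
  have [Z [rZ EX EB]] := (rec_stepQ_plan m0 mub).1 ((hKE _ (mwrt_pair sF m0 mub)).1 hub).
  exists (opp_plan Z); split; first exact: (rec_plan_opp (ltnW tT) rZ EX).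
    by rewrite /= EX; apply/funext => w; rewrite oppr0.
  by rewrite /= EB.
pose K w := closure (fst @` KE w).
have KE' : {ae P, forall w, forall x, K w x <-> exists ub, KE w (x, ub)}.
  have [clKE _] := rKE; apply: filterS2 coneKE ker => w cKE hk x.
  rewrite /K -(closure_id _).1; first by split=> [[[y ub] h <-]|[ub h]]; [exists ub|exists (x, ub)].
  apply: closed_proj => //.
  - exact: continuous_fst.
  - exact: convex_cone_convex.
  - move=> [y u]; rewrite (convex_cone_rec cKE) => h /= y0; rewrite y0 in h.
    by rewrite -[- _]/(- y, - u) y0 oppr0; exact: hk.
exists KE, K; split=> //; split.
- exact: random_set_closure continuous_fst rKE.
- apply: filterS2 coneKE KE' => w [E0 ED EZ] KEw; split.
  + by apply/KEw; exists 0; exact: E0.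
  + move=> x y /KEw[u hu] /KEw[v hv]; apply/KEw; exists (u + v); exact: (ED _ _ hu hv).
  + move=> a x a0 /KEw[u hu]; apply/KEw; exists (a *: u); exact: (EZ _ _ a0 hu).
move=> x mx; split=> [Kx|[Z rZ EX]].
  have rS : random_set (Fil t) (fun w => [set ub | KE w (x w, ub)]).
    apply: (@random_set_preimage _ _ _ _ sF _ _ _ _ KE (fun ub w => (x w, ub))) => //.
      by move=> w; apply: continuous_pair; [exact: continuous_cst|exact: continuous_id].
    by move=> ub; exact: (mwrt_pair sF mx (mwrt_cst sF ub)).
  have [ub [mub hub]] := measurable_selection sF rS.
  have h : {ae P, forall w, KE w (x w, ub w)}.
    by apply: filterS2 Kx KE' => w Kw KEw; have [u hu] := (KEw (x w)).1 Kw; apply: hub; exists u.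
  have [Z [rZ EX EB]] := (rec_stepQ_plan mx mub).1 ((hKE _ (mwrt_pair sF mx mub)).1 h).
  by exists Z.
have [aZ _] := rZ; have [_ mub _] := aZ _ (ltnW tT).
have h : {ae P, forall w, rec_stepQ t K' w (x w, Z.1.2 t w)}.
  by apply/(rec_stepQ_plan mx mub); exists Z.
have h' : {ae P, forall w, KE w (x w, Z.1.2 t w)} by exact: (hKE _ (mwrt_pair sF mx mub)).2.
by apply: filterS2 KE' h' => w KEw hw; apply/KEw; exists (Z.1.2 t w).
Qed.

End step.

(** * The Bellman equations *)

Variable W : nat -> Om -> X.
Hypothesis mW : forall t, (t < T)%N -> measurable_wrt (Fil t.+1) (W t.+1).
Hypothesis lbL : forall t, (t < T)%N -> lower_bounded P (L t).
Hypothesis lbJ : lower_bounded P J.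

(* [Jt] may be identically [+oo] with positive probability, hence the cone [K],
   which is defined independently of [Jt]. *)
Definition value t (Jt : X -> Om -> \bar R) (K : Om -> set X) : Prop :=
  [/\ normal_integrand (Fil t) Jt, lower_bounded P Jt, convex_integrand Jt, plan_cone t K &
   {ae P, forall w, epi (Jt ^~ w) !=set0 -> forall v, K w v <-> rec (epi (Jt ^~ w)) (v, 0)}].

(** Measurable minimisers are recorded beside the equations; the forward construction of an optimal
    plan consumes them. *)
Definition stage t (Jt : X -> Om -> \bar R) (Q EQ : X * B -> Om -> \bar R)
    (J1 : X -> Om -> \bar R) : Prop :=
  [/\ [/\ normal_integrand (Fil t.+1) Q, lower_bounded P Q & convex_integrand Q],
      cond_integrand P (Fil t) Q EQ,
      {ae P, forall w, forall y, Q y w =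
        ereal_inf (range (fun u => L t (y, u) w + J1 (Phi t w (y, u) + W t.+1 w)%R w)%E)} /\
      {ae P, forall w, forall x, Jt x w = ereal_inf (range (fun ub => EQ (x, ub) w))},
      forall y, measurable_wrt (Fil t.+1) y -> exists2 u, measurable_wrt (Fil t.+1) u &
        {ae P, forall w, L t (y w, u w) w + J1 (Phi t w (y w, u w) + W t.+1 w)%R w
                           <= Q (y w) w}%E &
      forall x, measurable_wrt (Fil t) x -> exists2 ub, measurable_wrt (Fil t) ub &
        {ae P, forall w, EQ (x w, ub w) w <= Jt (x w) w}%E].

(** Both infima are infimal compositions. For the one over [ub], the second function and the linear
    map are [0], so its kernel condition reduces to the symmetry of [KE] in [ub]. *)
Lemma stage_exists t (J1 : X -> Om -> \bar R) (K1 : Om -> set X) : (t < T)%N ->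
  value t.+1 J1 K1 -> exists Jt Q EQ K, value t Jt K /\ stage t Jt Q EQ J1.
Proof.
move=> tT [nJ1 lbJ1 convJ1 pK1 recJ1].
have sF := sigma_algebra_filtration (ltnW tT).
have sF1 := sigma_algebra_filtration tT.
have GF := filtration_measurable (ltnW tT).
have recL : {ae P, forall w, epi (L t ^~ w) !=set0 -> forall v,
    [set v | rec (epi (L t ^~ w)) (v, 0)] v <-> rec (epi (L t ^~ w)) (v, 0)}.
  exact: aeW.
have kerQ := rec_stepQ_ker tT pK1.
have mPhit z := @mPhi t z tT.
pose Q : X * B -> Om -> \bar R := rinf_fun (L t) J1 (Phi t) (W t.+1).
have nQ : normal_integrand (Fil t.+1) Q.
  exact: (normal_rinf_fun sF1 (nL tT) nJ1 (@cPhi t) mPhit (mW tT)).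
have nQm : normal_integrand measurable Q.
  exact: sub_normal_integrand (filtration_measurable tT) nQ.
have cQ : convex_integrand Q by exact: (convex_rinf_fun (convL tT) convJ1 (lPhi t)).
have lbQ : lower_bounded P Q by exact: lower_bounded_rinf_fun (lbL tT) lbJ1.
pose proof (rinf_funE (W t.+1) (nL tT) nJ1 (convL tT) convJ1 (lbL tT) lbJ1 (lPhi t) (@cPhi t)
  recL recJ1 kerQ) as QE.
pose proof (fun y (my : measurable_wrt (Fil t.+1) y) => rinf_fun_attained sF1 (nL tT) nJ1 (convL tT)
  convJ1 (lbL tT) lbJ1 (lPhi t) (@cPhi t) mPhit (mW tT) recL recJ1 kerQ my) as Qatt.
pose proof (rec_rinf_fun (W t.+1) (nL tT) nJ1 (convL tT) convJ1 (lbL tT) lbJ1 (lPhi t) (@cPhi t)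
  recL recJ1 kerQ) as recQ.
have [EQ hEQ cEQ] := cond_integrand_exists_convex sF GF nQm lbQ cQ.
have nEQ := hEQ.1; have lbEQ : lower_bounded P EQ.
  exact: (cond_integrand_lower_bounded sF GF nQm lbQ hEQ).
have [KE [K [rKE hKE kerE KEE pK]]] := plan_cone_step tT pK1.
have recEQ : {ae P, forall w, epi (EQ ^~ w) !=set0 ->
    forall v, KE w v <-> rec (epi (EQ ^~ w)) (v, 0)}.
  apply: (cond_integrand_recession sF GF nQm lbQ hEQ cQ rKE hKE) => //.
  by apply: filterS (convex_cone_stepQ tT pK1) => w [].
pose z0 (x : X) (w : Om) : \bar R := 0%E.
have nz0 : normal_integrand (Fil t) z0 by exact: normal_integrand0.
have cz0 : convex_integrand z0 by move=> w; exact: convex_efun0.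
have lz0 : lower_bounded P z0.
  by exists (fun=> 0); [exact: integrable0|exact: aeW].
pose A0 (w : Om) (y : X * B) : X := 0.
have lA0 w : linear (A0 w) by move=> a x y; rewrite /A0 scaler0 addr0.
have cA0 w : continuous (A0 w) by exact: continuous_cst.
have mA0 y : measurable_wrt (Fil t) (A0 ^~ y) by exact: mwrt_cst.
have mx0 : measurable_wrt (Fil t) (fun=> 0 : X) by exact: mwrt_cst.
have rec0 : {ae P, forall w, epi (z0 ^~ w) !=set0 -> forall v,
    [set: X] v <-> rec (epi (z0 ^~ w)) (v, 0)}.
  by apply: aeW => w _ v; split=> // _; exact: rec_epi0.
have ker0 : {ae P, forall w, forall ub, KE w (0, ub) -> [set: X] (A0 w (0, ub)) ->
    KE w (0, - ub) /\ [set: X] (A0 w (0, - ub))}.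
  by apply: filterS kerE => w h ub /h.
pose Jt : X -> Om -> \bar R := rinf_fun EQ z0 A0 (fun=> 0).
have nJt : normal_integrand (Fil t) Jt.
  exact: (normal_rinf_fun sF nEQ nz0 cA0 mA0 mx0).
have cJt : convex_integrand Jt by exact: (convex_rinf_fun cEQ cz0 lA0).
have lbJt : lower_bounded P Jt by exact: lower_bounded_rinf_fun lbEQ lz0.
pose proof (rinf_funE (fun=> 0) nEQ nz0 cEQ cz0 lbEQ lz0 lA0 cA0 recEQ rec0 ker0) as JtE.
pose proof (fun x (mx : measurable_wrt (Fil t) x) => rinf_fun_attained sF nEQ nz0 cEQ cz0
  lbEQ lz0 lA0 cA0 mA0 mx0 recEQ rec0 ker0 mx) as Jtatt.
pose proof (rec_rinf_fun (fun=> 0) nEQ nz0 cEQ cz0 lbEQ lz0 lA0 cA0 recEQ rec0 ker0) as recJt.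
exists Jt, Q, EQ, K; split; split=> //.
- apply: filterS2 KEE recJt => w hK hr h0 v; rewrite hK -(hr h0).
  by split=> -[ub]; [exists ub|move=> []; exists ub].
- split=> //; apply: filterS JtE => w h x; rewrite /Jt h; congr (ereal_inf (image setT _)).
  by apply/funext => ub; rewrite /z0 adde0.
- move=> x /Jtatt[ub mub hub]; exists ub => //.
  by apply: filterS hub => w; rewrite /z0 adde0.
Qed.

Lemma value_last : value T J (fun w => [set v | rec (epi (J ^~ w)) (v, 0)]).
Proof.
split=> //; first exact: plan_cone_last.
by apply: aeW.
Qed.

Lemma stages_exist n t : (t + n = T)%N -> exists Js Qs EQs K,
  [/\ value t (Js t) K, Js T = J &
   forall s, (t <= s < T)%N ->
     (exists K', value s (Js s) K') /\ stage s (Js s) (Qs s) (EQs s) (Js s.+1)].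
Proof.
elim: n t => [|n IH] t tT.
  rewrite addn0 in tT; rewrite tT.
  exists (fun=> J), (fun=> fun _ _ => 0%E), (fun=> fun _ _ => 0%E).
  exists (fun w => [set v | rec (epi (J ^~ w)) (v, 0)]); split=> //; first exact: value_last.
  by move=> s; rewrite ltnNge andbN.
have [|Js [Qs [EQs [K1 [hv hJ hs]]]]] := IH t.+1; first by rewrite addSnnS.
have {}tT : (t < T)%N by rewrite -tT -addSnnS leq_addr.
have [Jt [Q [EQ [K [hvt hst]]]]] := stage_exists tT hv.
exists (fun s => if s == t then Jt else Js s), (fun s => if s == t then Q else Qs s).
exists (fun s => if s == t then EQ else EQs s), K; rewrite eqxx gtn_eqF//; split=> // s.
rewrite leq_eqVlt => /andP[/predU1P[<- _|ts sT]].
  by rewrite eqxx gtn_eqF//; split=> //; exists K.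
by rewrite (gtn_eqF ts) gtn_eqF ?(leq_trans ts)//; apply: hs; rewrite ts.
Qed.

(** Minimising [J0] is an infimal composition with a dummy outer argument in [R^o], the state
    playing the part of the control. Its kernel condition is the symmetry of [K], obtained by
    reversing recession plans that start at time [0]. *)
Lemma optimal_state0 (J0 : X -> Om -> \bar R) (K : Om -> set X) : value 0 J0 K ->
  exists2 x : Om -> X, measurable_wrt (Fil 0) x &
    {ae P, forall w, forall y, (J0 (x w) w <= J0 y w)%E}.
Proof.
move=> [nJ0 lbJ0 cJ0 [rK cK hK] recJ0]; have sF := sigma_algebra_filtration (leq0n T).
have KN : {ae P, forall w, forall x, K w x -> K w (- x)}.
  apply: (random_set_opp sF rK) => [|x mx Kx]; first by apply: filterS cK => w [].
  have mNx : measurable_wrt (Fil 0) (fun w => - x w) by exact: mwrtN.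
  apply/(hK _ mNx); have [Z rZ EX] := (hK _ mx).1 Kx.
  by exists (opp_plan Z); [exact: rec_plan0_opp|rewrite /= EX].
pose z0 (y : R^o * X) (w : Om) : \bar R := 0%E.
have nz0 : normal_integrand (Fil 0) z0 by exact: normal_integrand0.
have cz0 : convex_integrand z0 by move=> w; exact: convex_efun0.
have lz0 : lower_bounded P z0.
  by exists (fun=> 0); [exact: integrable0|exact: aeW].
pose A0 (w : Om) (y : R^o * X) : X := y.2.
have lA0 w : linear (A0 w) by [].
have cA0 w : continuous (A0 w) by exact: continuous_snd.
have mA0 y : measurable_wrt (Fil 0) (A0 ^~ y) by exact: mwrt_cst.
have mx0 : measurable_wrt (Fil 0) (fun=> 0 : X) by exact: mwrt_cst.
have my0 : measurable_wrt (Fil 0) (fun=> 0 : R^o) by exact: mwrt_cst.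
have rec0 : {ae P, forall w, epi (z0 ^~ w) !=set0 -> forall v,
    [set: R^o * X] v <-> rec (epi (z0 ^~ w)) (v, 0)}.
  by apply: aeW => w _ v; split=> // _; exact: rec_epi0.
have ker0 : {ae P, forall w, forall x, [set: R^o * X] (0, x) -> K w (A0 w (0, x)) ->
    [set: R^o * X] (0, - x) /\ K w (A0 w (0, - x))}.
  by apply: filterS KN => w h x _ /h.
pose proof (rinf_funE (fun=> 0) nz0 nJ0 cz0 cJ0 lz0 lbJ0 lA0 cA0 rec0 recJ0 ker0) as infE.
have [x mx hx] := rinf_fun_attained sF nz0 nJ0 cz0 cJ0
  lz0 lbJ0 lA0 cA0 mA0 mx0 rec0 recJ0 ker0 my0.
exists x => //; apply: filterS2 infE hx => w hE; rewrite hE /z0 add0e /A0 addr0 => h y.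
apply: le_trans h _; apply: ereal_inf_lbound; exists y => //.
by rewrite add0e addr0.
Qed.

(** * Verification and optimal plans *)

Definition feasible_plan Z : Prop := adapted_plan Z /\
  {ae P, forall w, forall t, (t < T)%N ->
     Z.1.1 t.+1 w = Phi t w (Z.1.1 t w, Z.1.2 t w, Z.2 t.+1 w) + W t.+1 w}.

Definition stage_cost t Z w : \bar R := L t (Z.1.1 t w, Z.1.2 t w, Z.2 t.+1 w) w.

Definition plan_cost Z : \bar R :=
  (\int[P]_w (\sum_(t < T) stage_cost t Z w + J (Z.1.1 T w) w))%E.

Section verification.
Variables (Js : nat -> X -> Om -> \bar R) (Qs EQs : nat -> X * B -> Om -> \bar R).
Hypothesis JsT : Js T = J.
Hypothesis nJs : forall t, (t <= T)%N -> normal_integrand (Fil t) (Js t).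
Hypothesis lbJs : forall t, (t <= T)%N -> lower_bounded P (Js t).
Hypothesis stages : forall t, (t < T)%N -> stage t (Js t) (Qs t) (EQs t) (Js t.+1).

Let cost_to t Z w : \bar R := (\sum_(s < t) stage_cost s Z w)%E.

Let mX Z t : adapted_plan Z -> (t <= T)%N -> measurable_wrt measurable (Z.1.1 t).
Proof. by move=> aZ tT; have [m _ _] := aZ _ tT; exact: sub_mwrt (filtration_measurable tT) m. Qed.

Let cost_to_spec Z t : adapted_plan Z -> (t <= T)%N ->
  measurable_fun setT (cost_to t Z) /\ integrably_bounded P (cost_to t Z).
Proof.
move=> aZ; elim: t => [_|t IH tT].
  rewrite /cost_to; under eq_fun do rewrite big_ord0.
  by split; [exact: measurable_cst|exists (fun=> 0); [exact: integrable0|exact: aeW]].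
have [m ib] := IH (ltnW tT).
have [mX_ mB_ _] := aZ _ (ltnW tT); have [_ _ mU_] := aZ _ tT.
have sF1 := sigma_algebra_filtration tT; have FS := filtrationS tT.
have mz : measurable_wrt (Fil t.+1) (fun w => (Z.1.1 t w, Z.1.2 t w, Z.2 t.+1 w)).
  exact: (mwrt_pair sF1 (mwrt_pair sF1 (sub_mwrt FS mX_) (sub_mwrt FS mB_)) mU_).
have -> : cost_to t.+1 Z = (fun w => cost_to t Z w + stage_cost t Z w)%E.
  by apply/funext => w; rewrite /cost_to big_ord_recr.
split.
  apply: emeasurable_funD => //; apply: normal_measurable_comp.
    exact: sub_normal_integrand (filtration_measurable tT) (nL tT).
  exact: sub_mwrt (filtration_measurable tT) mz.
apply: integrably_boundedD => //.
exact: (lower_bounded_comp (fun w => (Z.1.1 t w, Z.1.2 t w, Z.2 t.+1 w)) (lbL tT)).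
Qed.

Let value_along t Z w : \bar R := (cost_to t Z w + Js t (Z.1.1 t w) w)%E.

Let measurable_value_along Z t : adapted_plan Z -> (t <= T)%N ->
  measurable_fun setT (value_along t Z).
Proof.
move=> aZ tT; have [m _] := cost_to_spec aZ tT.
apply: emeasurable_funD => //; apply: normal_measurable_comp; last exact: mX.
exact: sub_normal_integrand (filtration_measurable tT) (nJs tT).
Qed.

(** The lower bounds split both integrals, so conditioning enters only through the total expectation
    of [Qs t] along the plan. *)
Let integral_EQ Z t : adapted_plan Z -> (t < T)%N ->
  let EQ w := (cost_to t Z w + EQs t (Z.1.1 t w, Z.1.2 t w) w)%E in
  let Q w := (cost_to t Z w + Qs t (Z.1.1 t w, Z.1.2 t w) w)%E in
  [/\ (\int[P]_w EQ w = \int[P]_w Q w)%E, measurable_fun setT EQ & measurable_fun setT Q].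
Proof.
move=> aZ tT EQ Q; have [m ib] := cost_to_spec aZ (ltnW tT).
have [mX_ mB_ _] := aZ _ (ltnW tT); have sF := sigma_algebra_filtration (ltnW tT).
have GF := filtration_measurable (ltnW tT).
have mz : measurable_wrt (Fil t) (fun w => (Z.1.1 t w, Z.1.2 t w)) by exact: (mwrt_pair sF mX_ mB_).
have mzF := sub_mwrt GF mz.
have [[nQ lQ _] [nEQ hEQ] _ _ _] := stages tT.
have nQm := sub_normal_integrand (filtration_measurable tT) nQ.
have mQ : measurable_fun setT (fun w => Qs t (Z.1.1 t w, Z.1.2 t w) w).
  exact: (normal_measurable_comp nQm mzF).
have mEQ : measurable_fun setT (fun w => EQs t (Z.1.1 t w, Z.1.2 t w) w).
  exact: (normal_measurable_comp (sub_normal_integrand GF nEQ) mzF).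
have lbEQ : lower_bounded P (EQs t).
  exact: (cond_integrand_lower_bounded sF GF nQm lQ (conj nEQ hEQ)).
split; [|exact: emeasurable_funD|exact: emeasurable_funD].
rewrite integralD_integrably_bounded//; last first.
  exact: (lower_bounded_comp (fun w => (Z.1.1 t w, Z.1.2 t w)) lbEQ).
rewrite integralD_integrably_bounded//; last first.
  exact: (lower_bounded_comp (fun w => (Z.1.1 t w, Z.1.2 t w)) lQ).
have [_ ->//] := hEQ _ mz.
by have := sa_const sF True; congr (Fil t _); apply/seteqP.
Qed.

Let value_alongS t Z w : value_along t.+1 Z w =
  (cost_to t Z w + (stage_cost t Z w + Js t.+1 (Z.1.1 t.+1 w) w))%E.
Proof. by rewrite /value_along /cost_to big_ord_recr/= addeA. Qed.

Let value_along_le Z t : feasible_plan Z -> (t < T)%N ->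
  (\int[P]_w value_along t Z w <= \int[P]_w value_along t.+1 Z w)%E.
Proof.
move=> [aZ fZ] tT; have [E mEQ mQ] := integral_EQ aZ tT.
have [_ _ [QE JE] _ _] := stages tT.
apply: (@le_trans _ _ (\int[P]_w (cost_to t Z w + EQs t (Z.1.1 t w, Z.1.2 t w) w))%E).
  apply: ae_le_integral => //; first exact: measurable_value_along (ltnW tT).
  apply: filterS JE => w h _; rewrite leeD2l// h.
  by apply: ereal_inf_lbound; exists (Z.1.2 t w).
rewrite E; apply: ae_le_integral => //; first exact: measurable_value_along.
apply: filterS2 QE fZ => w h hf _; rewrite value_alongS leeD2l// h.
by apply: ereal_inf_lbound; exists (Z.2 t.+1 w) => //; rewrite hf.
Qed.

Let value_along_ge Z t : adapted_plan Z -> (t < T)%N ->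
  {ae P, forall w, EQs t (Z.1.1 t w, Z.1.2 t w) w <= Js t (Z.1.1 t w) w}%E ->
  {ae P, forall w, stage_cost t Z w + Js t.+1 (Z.1.1 t.+1 w) w <=
                   Qs t (Z.1.1 t w, Z.1.2 t w) w}%E ->
  (\int[P]_w value_along t.+1 Z w <= \int[P]_w value_along t Z w)%E.
Proof.
move=> aZ tT hEQ hQ; have [E mEQ mQ] := integral_EQ aZ tT.
apply: (@le_trans _ _ (\int[P]_w (cost_to t Z w + Qs t (Z.1.1 t w, Z.1.2 t w) w))%E).
  apply: ae_le_integral => //; first exact: measurable_value_along.
  by apply: filterS hQ => w h _; rewrite value_alongS leeD2l.
rewrite -E; apply: ae_le_integral => //; first exact: measurable_value_along (ltnW tT).
by apply: filterS hEQ => w h _; rewrite leeD2l.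
Qed.

Let plan_costE Z : plan_cost Z = (\int[P]_w value_along T Z w)%E.
Proof. by rewrite /value_along JsT. Qed.

Let value_along0 Z : (\int[P]_w value_along 0 Z w = \int[P]_w Js 0 (Z.1.1 0%N w) w)%E.
Proof. by apply: eq_integral => w _; rewrite /value_along /cost_to big_ord0 add0e. Qed.

Lemma plan_cost_ge Z : feasible_plan Z -> (\int[P]_w Js 0 (Z.1.1 0%N w) w <= plan_cost Z)%E.
Proof using hFil nL lbL JsT nJs lbJs stages pX pB pU.
move=> fZ; rewrite plan_costE -value_along0.
have h t : (t <= T)%N -> (\int[P]_w value_along 0 Z w <= \int[P]_w value_along t Z w)%E.
  elim: t => // t IH tT; apply: le_trans (IH (ltnW tT)) _.
  exact: value_along_le.
exact: h.
Qed.

Lemma plan_cost_le Z : adapted_plan Z -> (forall t, (t < T)%N ->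
  {ae P, forall w, EQs t (Z.1.1 t w, Z.1.2 t w) w <= Js t (Z.1.1 t w) w}%E /\
  {ae P, forall w, stage_cost t Z w + Js t.+1 (Z.1.1 t.+1 w) w <=
                   Qs t (Z.1.1 t w, Z.1.2 t w) w}%E) ->
  (plan_cost Z <= \int[P]_w Js 0 (Z.1.1 0%N w) w)%E.
Proof using hFil nL lbL JsT nJs lbJs stages pX pB pU.
move=> aZ hZ; rewrite plan_costE -value_along0.
have h t : (t <= T)%N -> (\int[P]_w value_along t Z w <= \int[P]_w value_along 0 Z w)%E.
  elim: t => // t IH tT; apply: le_trans (IH (ltnW tT)).
  by have [h1 h2] := hZ t tT; exact: value_along_ge.
exact: h.
Qed.

End verification.


Lemma optimal_plan_exists (Js : nat -> X -> Om -> \bar R) (Qs EQs : nat -> X * B -> Om -> \bar R)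
    (x0 : Om -> X) : Js T = J ->
  (forall t, (t <= T)%N -> normal_integrand (Fil t) (Js t) /\ lower_bounded P (Js t)) ->
  (forall t, (t < T)%N -> stage t (Js t) (Qs t) (EQs t) (Js t.+1)) ->
  measurable_wrt (Fil 0) x0 -> {ae P, forall w, forall y, (Js 0%N (x0 w) w <= Js 0%N y w)%E} ->
  exists2 Z, feasible_plan Z & forall Z', feasible_plan Z' -> (plan_cost Z <= plan_cost Z')%E.
Proof using hFil nL lbL cPhi mPhi mW pX pB pU.
move=> JsT nlJs stages mx0 hx0.
have nJs t (tT : (t <= T)%N) := (nlJs t tT).1; have lbJs t (tT : (t <= T)%N) := (nlJs t tT).2.
(* The state process is defined by recursion before its measurability is known, so the choice is
   made for all pairs of a time and a random state, with the requirements as premises. *)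
have /choice[phi hphi] (tx : nat * (Om -> X)) : exists bu : (Om -> B) * (Om -> U),
    (tx.1 < T)%N -> measurable_wrt (Fil tx.1) tx.2 ->
    [/\ measurable_wrt (Fil tx.1) bu.1, measurable_wrt (Fil tx.1.+1) bu.2,
        {ae P, forall w, EQs tx.1 (tx.2 w, bu.1 w) w <= Js tx.1 (tx.2 w) w}%E &
        {ae P, forall w, L tx.1 (tx.2 w, bu.1 w, bu.2 w) w +
          Js tx.1.+1 (Phi tx.1 w (tx.2 w, bu.1 w, bu.2 w) + W tx.1.+1 w)%R w <=
          Qs tx.1 (tx.2 w, bu.1 w) w}%E].
  case: tx => t x /=; have [tT|] := boolP (t < T)%N; last by exists (fun=> 0, fun=> 0).
  have [mx|] := pselect (measurable_wrt (Fil t) x); last by exists (fun=> 0, fun=> 0).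
  have [_ _ _ hQ hEQ] := stages t tT; have [ub mub hub] := hEQ _ mx.
  have sF1 := sigma_algebra_filtration tT; have FS := filtrationS tT.
  have [u mu hu] := hQ _ (mwrt_pair sF1 (sub_mwrt FS mx) (sub_mwrt FS mub)).
  by exists (ub, u).
pose xs : nat -> Om -> X := nat_rect (fun=> Om -> X) x0 (fun t x w =>
  Phi t w (x w, (phi (t, x)).1 w, (phi (t, x)).2 w) + W t.+1 w).
have mxs t : (t <= T)%N -> measurable_wrt (Fil t) (xs t).
  elim: t => [//|t IH tT]; have mx := IH (ltnW tT).
  have [/= mub mu _ _] := hphi (t, xs t) tT mx.
  have sF1 := sigma_algebra_filtration tT; have FS := filtrationS tT.
  have mz : measurable_wrt (Fil t.+1)
      (fun w => (xs t w, (phi (t, xs t)).1 w, (phi (t, xs t)).2 w)).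
    exact: (mwrt_pair sF1 (mwrt_pair sF1 (sub_mwrt FS mx) (sub_mwrt FS mub)) mu).
  have mF : measurable_wrt (Fil t.+1)
      (fun w => Phi t w (xs t w, (phi (t, xs t)).1 w, (phi (t, xs t)).2 w)).
    exact: (mwrt_caratheodory sF1 (@cPhi t) (fun z => @mPhi t z tT) mz).
  exact: (mwrtD sF1 mF (mW tT)).
(* The last component at time [s.+1] is chosen in stage [s]. Its value at [0] and that of the second
   component from [T] on enter neither the cost nor the dynamics. *)
pose Z : plan := (xs, fun t => if (t < T)%N then (phi (t, xs t)).1 else fun=> 0,
                  fun t => if t is s.+1 then (phi (s, xs s)).2 else fun=> 0).
have ZB t : (t < T)%N -> Z.1.2 t = (phi (t, xs t)).1 by move=> /= ->.
have aZ : adapted_plan Z.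
  move=> t tT; have sF := sigma_algebra_filtration tT; split=> /=; first exact: mxs.
    case: ifPn => tT'; last exact: mwrt_cst.
    by have [] := hphi (t, xs t) tT' (mxs t tT).
  case: t tT sF => [|t] tT sF; first exact: mwrt_cst.
  by have [] := hphi (t, xs t) tT (mxs t (ltnW tT)).
exists Z; first by split=> //; apply: aeW => w t tT; rewrite ZB.
move=> Z' fZ'; have [aZ' _] := fZ'.
apply: le_trans (plan_cost_ge JsT nJs lbJs stages fZ').
apply: (@le_trans _ _ (\int[P]_w Js 0%N (Z.1.1 0%N w) w)%E).
  apply: (plan_cost_le JsT nJs lbJs stages aZ) => t tT.
  have [_ _ h1 h2] := hphi (t, xs t) tT (mxs t (ltnW tT)).
  by rewrite /stage_cost ZB.
have GF := filtration_measurable (leq0n T).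
have nJ0 := sub_normal_integrand GF (nJs 0%N isT); have [mX' _ _] := aZ' _ (leq0n T).
apply: ae_le_integral => //.
- exact: (normal_measurable_comp nJ0 (sub_mwrt GF mx0)).
- exact: (normal_measurable_comp nJ0 (sub_mwrt GF mX')).
- by apply: filterS hx0 => w h _; exact: h.
Qed.

(** Backward induction: the first equation carries equality from [J_(t+1)] to [Q_t], almost sure
    uniqueness of conditional integrands carries it to the conditional expectation, and the second
    equation to [J_t]. *)
Lemma stages_unique (Js Js' : nat -> X -> Om -> \bar R)
    (Qs Qs' EQs EQs' : nat -> X * B -> Om -> \bar R) :
  (forall t, (t < T)%N -> normal_integrand measurable (Qs t)) ->
  (forall t, (t < T)%N -> normal_integrand measurable (Qs' t)) ->
  (forall t, (t < T)%N -> cond_integrand P (Fil t) (Qs t) (EQs t)) ->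
  (forall t, (t < T)%N -> cond_integrand P (Fil t) (Qs' t) (EQs' t)) ->
  {ae P, forall w, forall x, Js' T x w = Js T x w} ->
  (forall t, (t < T)%N -> {ae P, forall w, forall y, Qs t y w =
    ereal_inf (range (fun u => L t (y, u) w + Js t.+1 (Phi t w (y, u) + W t.+1 w)%R w)%E)}) ->
  (forall t, (t < T)%N -> {ae P, forall w, forall y, Qs' t y w =
    ereal_inf (range (fun u => L t (y, u) w + Js' t.+1 (Phi t w (y, u) + W t.+1 w)%R w)%E)}) ->
  (forall t, (t < T)%N -> {ae P, forall w, forall x, Js t x w =
    ereal_inf (range (fun ub => EQs t (x, ub) w))}) ->
  (forall t, (t < T)%N -> {ae P, forall w, forall x, Js' t x w =
    ereal_inf (range (fun ub => EQs' t (x, ub) w))}) ->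
  {ae P, forall w, (forall t, (t <= T)%N -> forall x, Js' t x w = Js t x w) /\
                   (forall t, (t < T)%N -> forall y, Qs' t y w = Qs t y w)}.
Proof using hFil pX pB.
move=> nQ nQ' hEQ hEQ' ET QE QE' JE JE'.
have stepQ t : (t < T)%N -> {ae P, forall w, forall x, Js' t.+1 x w = Js t.+1 x w} ->
    {ae P, forall w, forall y, Qs' t y w = Qs t y w}.
  move=> tT; apply: filterS3 (QE t tT) (QE' t tT) => w h h' E y; rewrite h h'.
  by congr (ereal_inf (image setT _)); apply/funext => u; rewrite E.
have stepJ t : (t < T)%N -> {ae P, forall w, forall x, Js' t.+1 x w = Js t.+1 x w} ->
    {ae P, forall w, forall x, Js' t x w = Js t x w}.
  move=> tT /(stepQ t tT) EQQ.
  have EE : {ae P, forall w, forall y, EQs' t y w = EQs t y w}.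
    exact: (cond_integrand_unique (sigma_algebra_filtration (ltnW tT))
      (filtration_measurable (ltnW tT)) (nQ' t tT) (nQ t tT) EQQ (hEQ' t tT) (hEQ t tT)).
  apply: filterS3 (JE t tT) (JE' t tT) EE => w h h' E x; rewrite h h'.
  by congr (ereal_inf (image setT _)); apply/funext => ub; rewrite E.
have EJ n t : (t + n = T)%N -> {ae P, forall w, forall x, Js' t x w = Js t x w}.
  elim: n t => [|n IH] t tT; first by rewrite -(addn0 t) tT.
  have tT' : (t < T)%N by rewrite -tT -addSnnS leq_addr.
  by apply: stepJ => //; apply: IH; rewrite addSnnS.
have EJ' t : {ae P, forall w, (t <= T)%N -> forall x, Js' t x w = Js t x w}.
  have [tT|] := boolP (t <= T)%N; last by move=> _; apply: aeW.
  by apply: filterS (EJ _ _ (subnKC tT)) => w h _.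
have EQ' t : {ae P, forall w, (t < T)%N -> forall y, Qs' t y w = Qs t y w}.
  have [tT|] := boolP (t < T)%N; last by move=> _; apply: aeW.
  by apply: filterS (stepQ t tT (EJ _ _ (subnKC tT))) => w h _.
by apply: filterS2 (ae_all_count EJ') (ae_all_count EQ').
Qed.

End recession_plans.

(** * Matrix dynamics and the theorem *)

Section matrix_continuity.
Context {R : realType}.

(** The norm is the largest modulus of an entry, and an entry of the product is a sum of [n]
    products, whence the factor [n]. *)
Lemma norm_mulmx_le m n p (A : 'M[R]_(m, n)) (B : 'M[R]_(n, p)) :
  `|A *m B| <= n%:R * (`|A| * `|B|).
Proof.
apply/mx_norm_leP; first by rewrite !mulr_ge0.
move=> i j; rewrite mxE; apply: le_trans (ler_norm_sum _ _ _) _.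
have h k : `|A i k * B k j| <= `|A| * `|B|.
  rewrite normrM; apply: ler_pM => //.
    exact: ((mx_norm_leP A (normr_ge0 _)).1 (lexx _)).
  exact: ((mx_norm_leP B (normr_ge0 _)).1 (lexx _)).
apply: le_trans (ler_sum _ (fun k _ => h k)) _.
by rewrite sumr_const card_ord -[leLHS]mulr_natl.
Qed.

Lemma continuous_mulmxr m n p (A : 'M[R]_(m, n)) :
  continuous (fun B : 'M[R]_(n, p) => A *m B).
Proof.
apply: (lipschitz_continuous_norm (k := n%:R * `|A|)) => B C.
by rewrite -mulmxBr -mulrA; exact: norm_mulmx_le.
Qed.

Lemma continuous_mulmxl m n p (B : 'M[R]_(n, p)) :
  continuous (fun A : 'M[R]_(m, n) => A *m B).
Proof.
apply: (lipschitz_continuous_norm (k := n%:R * `|B|)) => A C.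
by rewrite -mulmxBl -mulrA (mulrC `|B|); exact: norm_mulmx_le.
Qed.

End matrix_continuity.

(** The lower bounds make the recession functions nonnegative, so the single inequality in the
    recession cone splits into one per stage. *)
Lemma sume_recession_le0 {R : realType} n (f : 'I_n -> \bar R) (a : \bar R) :
  (forall i, 0 <= f i)%E -> (0 <= a)%E ->
  (\sum_(i < n) f i + a <= 0)%E <-> (forall i, f i <= 0)%E /\ (a <= 0)%E.
Proof.
move=> f0 a0; split=> [h|[fle ale]].
  have S0 : (0 <= \sum_(i < n) f i)%E by exact: sume_ge0.
  split=> [i|]; last by apply: le_trans h; rewrite leeDr.
  apply: le_trans h; apply: (@le_trans _ _ (\sum_(i < n) f i)%E); last by rewrite leeDl.
  by rewrite (bigD1 i)//= leeDl// sume_ge0.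
by apply: adde_le0 => //; exact: sume_le0.
Qed.

Section matrix_dynamics.
Context {R : realType} {d : measure_display} {Om : measurableType d}.
Variables (P : probability Om R) (N Mb Ma T : nat) (Fil : nat -> set (set Om)).
Variables (L : nat -> 'cV[R]_N * 'cV[R]_Mb * 'cV[R]_Ma -> Om -> \bar R)
          (J : 'cV[R]_N -> Om -> \bar R).
Variables (A : nat -> Om -> 'M[R]_N) (Bb : nat -> Om -> 'M[R]_(N, Mb))
          (Ba : nat -> Om -> 'M[R]_(N, Ma)).
Hypothesis hFil : filtration T Fil.

Definition lin_dynamics t w (z : 'cV[R]_N * 'cV[R]_Mb * 'cV[R]_Ma) : 'cV[R]_N :=
  A t.+1 w *m z.1.1 + Bb t.+1 w *m z.1.2 + Ba t.+1 w *m z.2.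

Lemma linear_lin_dynamics t w : linear (lin_dynamics t w).
Proof.
move=> a [[x ub] ua] [[x' ub'] ua']; rewrite /lin_dynamics /= !mulmxDr -!scalemxAr.
by rewrite !scalerDr (addrACA (a *: (A t.+1 w *m x))); exact: addrACA.
Qed.

Lemma continuous_lin_dynamics t w : continuous (lin_dynamics t w).
Proof.
have c1 : continuous (fun z : 'cV[R]_N * 'cV[R]_Mb * 'cV[R]_Ma => z.1.1).
  by apply: continuous_comp2; exact: continuous_fst.
have c2 : continuous (fun z : 'cV[R]_N * 'cV[R]_Mb * 'cV[R]_Ma => z.1.2).
  by apply: continuous_comp2; [exact: continuous_fst|exact: continuous_snd].
apply: continuousD; last exact: (continuous_comp2 continuous_snd (@continuous_mulmxr _ _ _ _ _)).
apply: continuousD; first exact: (continuous_comp2 c1 (@continuous_mulmxr _ _ _ _ _)).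
exact: (continuous_comp2 c2 (@continuous_mulmxr _ _ _ _ _)).
Qed.

Lemma measurable_lin_dynamics t z : (t < T)%N -> measurable_wrt (Fil t.+1) (A t.+1) ->
  measurable_wrt (Fil t.+1) (Bb t.+1) -> measurable_wrt (Fil t.+1) (Ba t.+1) ->
  measurable_wrt (Fil t.+1) (lin_dynamics t ^~ z).
Proof using hFil.
move=> tT mA mB mBa; have sF := sigma_algebra_filtration hFil tT.
apply: mwrtD => //; last exact: (mwrt_comp (@continuous_mulmxl _ _ _ _ z.2) mBa).
apply: mwrtD => //; first exact: (mwrt_comp (@continuous_mulmxl _ _ _ _ z.1.1) mA).
exact: (mwrt_comp (@continuous_mulmxl _ _ _ _ z.1.2) mB).
Qed.

Let recession_sign_ae {V : normedModType R} (h : V -> Om -> \bar R) (G : set (set Om)) :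
  normal_integrand G h -> convex_integrand h -> lower_bounded P h ->
  {ae P, forall w, dom (h ^~ w) !=set0} ->
  {ae P, forall w, forall v, (0 <= recession_integrand h v w)%E /\
    ((recession_integrand h v w <= 0)%E <-> rec (epi (h ^~ w)) (v, 0))}.
Proof.
move=> [cl _] ch [m _ hm] hd; apply: filterS2 hm hd => w lb d0 v.
have ce : convexS (epi (h ^~ w)) by apply/convex_efunE; exact: ch.
exact: (recession_sign v (cl w) ce lb d0).
Qed.

(** The passage from recession functions to epigraphs. The domains are nonempty almost surely, so
    [recession] is evaluated where it has its meaning. *)
Lemma recession_coneP (hL : forall t, (t < T)%N ->
       [/\ normal_integrand (Fil t.+1) (L t), lower_bounded P (L t) &
           convex_integrand (L t)])
    (hJ : [/\ normal_integrand (Fil T) J, lower_bounded P J & convex_integrand J])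
    (hLdom : forall t, (t < T)%N -> {ae P, forall w, dom (L t ^~ w) !=set0})
    (hJdom : {ae P, forall w, dom (J ^~ w) !=set0}) Z :
  oc_recession_cone P T Fil L J A Bb Ba Z <-> rec_plan P T Fil L J lin_dynamics 0 Z.
Proof.
have signL t : {ae P, forall w, (t < T)%N -> forall v,
    (0 <= recession_integrand (L t) v w)%E /\
    ((recession_integrand (L t) v w <= 0)%E <-> rec (epi (L t ^~ w)) (v, 0))}.
  have [tT|] := boolP (t < T)%N; last by move=> _; apply: aeW.
  have [nL lL cL] := hL t tT.
  by apply: filterS (recession_sign_ae nL cL lL (hLdom t tT)) => w h _.
have [nJ lJ cJ] := hJ; have signJ := recession_sign_ae nJ cJ lJ hJdom.
have key : {ae P, forall w,
    (oc_integrand T (fun t => recession_integrand (L t)) (recession_integrand J) Z w <= 0)%E <->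
    (forall t, (t < T)%N -> rec (epi (L t ^~ w)) (stX Z t w, stUb Z t w, stUa Z t.+1 w, 0)) /\
    rec (epi (J ^~ w)) (stX Z T w, 0)}.
  apply: filterS2 (ae_all_count signL) signJ => w hl hj.
  have := @sume_recession_le0 R T
    (fun t => recession_integrand (L t) (stX Z t w, stUb Z t w, stUa Z t.+1 w) w)
    (recession_integrand J (stX Z T w) w).
  move=> /(_ (fun t => (hl t (ltn_ord t) _).1) (hj _).1) ->.
  split=> -[h1 h2]; split; try exact/(hj _).2.
  - by move=> t tT; apply/(hl t tT _).2; exact: (h1 (Ordinal tT)).
  - by move=> t; apply/(hl t (ltn_ord t) _).2; exact: h1.
split=> -[aZ hZ]; split=> //.
  apply: filterS2 key hZ => w k [/k[h1 h2] h3]; split=> // s /andP[_ sT].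
  by split; [exact: h1|have /= := h3 s.+1; rewrite sT => /(_ isT)].
apply: filterS2 key hZ => w k [h1 h2]; split.
  by apply/k; split=> // t tT; have [] := h1 t tT.
(* The dynamics in the cone are indexed by the time of arrival, those of a plan by the time of
   departure. *)
by move=> [//|t] /andP[_ tT]; have [_ E] := h1 t tT; exact: E.
Qed.

End matrix_dynamics.

Theorem theorem2 (R : realType) (d : measure_display) (Om : measurableType d)
    (P : probability Om R) (N Mb Ma T : nat) (Fil : nat -> set (set Om))
    (L : nat -> 'cV[R]_N * 'cV[R]_Mb * 'cV[R]_Ma -> Om -> \bar R)
    (J : 'cV[R]_N -> Om -> \bar R)
    (A : nat -> Om -> 'M[R]_N) (Bb : nat -> Om -> 'M[R]_(N, Mb))
    (Ba : nat -> Om -> 'M[R]_(N, Ma)) (W : nat -> Om -> 'cV[R]_N)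
    (hFil : filtration T Fil)
    (hFil0 : forall B, Fil 0%N B -> P B = 0%E \/ P B = 1%E)
    (hL : forall t, (t < T)%N ->
       [/\ normal_integrand (Fil t.+1) (L t), lower_bounded P (L t) &
           convex_integrand (L t)])
    (hJ : [/\ normal_integrand (Fil T) J, lower_bounded P J &
              convex_integrand J])
    (hLdom : forall t, (t < T)%N ->
       {ae P, forall w, dom (L t ^~ w) !=set0})
    (hJdom : {ae P, forall w, dom (J ^~ w) !=set0})
    (hF : forall t, (t < T)%N ->
       [/\ measurable_wrt (Fil t.+1) (A t.+1),
           measurable_wrt (Fil t.+1) (Bb t.+1),
           measurable_wrt (Fil t.+1) (Ba t.+1) &
           measurable_wrt (Fil t.+1) (W t.+1)])
    (hlin : GRing.submod_closed
       [in oc_recession_cone P T Fil L J A Bb Ba]) :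
  (exists Z : strategy R Om N Mb Ma, oc_solution P T Fil L J A Bb Ba W Z) /\
  (exists (Js : nat -> 'cV[R]_N -> Om -> \bar R)
          (Qs : nat -> 'cV[R]_N * 'cV[R]_Mb -> Om -> \bar R),
     lb_convex_bellman_solution P T Fil L J A Bb Ba W Js Qs /\
     forall (Js' : nat -> 'cV[R]_N -> Om -> \bar R)
            (Qs' : nat -> 'cV[R]_N * 'cV[R]_Mb -> Om -> \bar R),
       lb_convex_bellman_solution P T Fil L J A Bb Ba W Js' Qs' ->
       {ae P, forall w,
          (forall t, (t <= T)%N -> forall x, Js' t x w = Js t x w) /\
          (forall t, (t < T)%N -> forall z, Qs' t z w = Qs t z w)}).
Proof.
have nL t (tT : (t < T)%N) : normal_integrand (Fil t.+1) (L t) by have [] := hL t tT.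
have lbL t (tT : (t < T)%N) : lower_bounded P (L t) by have [] := hL t tT.
have cL t (tT : (t < T)%N) : convex_integrand (L t) by have [] := hL t tT.
have [nJ lbJ cJ] := hJ.
pose Phi := lin_dynamics A Bb Ba.
have lPhi t w : linear (Phi t w) by exact: linear_lin_dynamics.
have cPhi t w : continuous (Phi t w) by exact: continuous_lin_dynamics.
have mPhi t z (tT : (t < T)%N) : measurable_wrt (Fil t.+1) (Phi t ^~ z).
  by have [mA mB mBa _] := hF t tT; exact: (measurable_lin_dynamics hFil).
have mW t (tT : (t < T)%N) : measurable_wrt (Fil t.+1) (W t.+1) by have [] := hF t tT.
have rec_opp Z : rec_plan P T Fil L J Phi 0 Z -> rec_plan P T Fil L J Phi 0 (opp_plan Z).
  have coneP := recession_coneP A Bb Ba hL hJ hLdom hJdom.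
  move=> /coneP hZ; apply/coneP.
  (* Linearity is applied with the scalar [-1] and the zero strategy, which yields the opposite
     plan. *)
  have [h0 hsub] := hlin; have := hsub (-1) Z 0.
  rewrite !in_setE => /(_ hZ); rewrite in_setE in h0 => /(_ h0).
  by rewrite scaleN1r addr0.
pose proof (stages_exist hFil nL cL nJ cJ lPhi cPhi mPhi rec_opp mW lbL lbJ (add0n T))
  as [Js [Qs [EQs [K0 [hv JsT hs]]]]].
have stages t (tT : (t < T)%N) := (hs t tT).2.
have nlcJs t : (t <= T)%N ->
    [/\ normal_integrand (Fil t) (Js t), lower_bounded P (Js t) & convex_integrand (Js t)].
  rewrite leq_eqVlt => /predU1P[->|tT]; first by rewrite JsT.
  by have [[K' [? ? ? _ _]] _] := hs t tT.
have nlJs t (tT : (t <= T)%N) : normal_integrand (Fil t) (Js t) /\ lower_bounded P (Js t).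
  by have [] := nlcJs t tT.
split.
  pose proof (optimal_state0 hFil rec_opp hv) as [x0 mx0 hx0].
  pose proof (optimal_plan_exists hFil nL cPhi mPhi mW lbL JsT nlJs stages mx0 hx0) as [Z fZ optZ].
  exists Z; split=> //; apply/eqP; rewrite eq_le; apply/andP; split.
    by apply: le_ereal_inf_tmp => _ [Z' fZ' <-]; exact: optZ.
  by apply: ereal_inf_lbound; exists Z.
have FM t (tT : (t <= T)%N) := filtration_measurable hFil tT.
exists Js, Qs; split.
  split; last first.
  - by move=> t tT; have [[_ ? ?] _ _ _ _] := stages t tT.
  - by move=> t tT; have [_ ? ?] := nlcJs t tT.
  split.
  - move=> t tT; exact: sub_normal_integrand (FM t tT) (nlJs t tT).1.
  - move=> t tT; have [[nQ _ _] _ _ _ _] := stages t tT.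
    exact: sub_normal_integrand (FM _ tT) nQ.
  exists EQs; first by move=> t tT; have [_ ? _ _ _] := stages t tT.
  (* With [t < T] as a premise inside the event, the countable intersection can run over all natural
     [t]. *)
  have aeQ t : {ae P, forall w, (t < T)%N ->
      (forall y, Qs t y w = ereal_inf (range (fun u => L t (y, u) w +
        Js t.+1 (Phi t w (y, u) + W t.+1 w)%R w)%E)) /\
      (forall x, Js t x w = ereal_inf (range (fun ub => EQs t (x, ub) w)))}.
    have [tT|] := boolP (t < T)%N; last by move=> _; apply: aeW.
    by have [_ _ [h1 h2] _ _] := stages t tT; apply: filterS2 h1 h2 => w h1 h2 _.
  apply: filterS (ae_all_count aeQ) => w h; split; first by rewrite JsT.
  split; first by move=> t x ub tT; exact: (h t tT).1.
  by move=> t x tT; exact: (h t tT).2.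
move=> Js' Qs' [[nJs' nQs' [EQs' hEQs' bell]] _ _].
have nQs t : (t < T)%N -> normal_integrand measurable (Qs t).
  move=> tT; have [[nQ _ _] _ _ _ _] := stages t tT.
  exact: sub_normal_integrand (FM _ tT) nQ.
have hEQs t : (t < T)%N -> cond_integrand P (Fil t) (Qs t) (EQs t).
  by move=> tT; have [_ ? _ _ _] := stages t tT.
apply: (stages_unique (L := L) (Phi := Phi) (W := W) hFil nQs nQs' hEQs hEQs') => [|t tT|t tT|t tT|t tT].
- by rewrite JsT; apply: filterS bell => w [].
- by have [_ _ [? _] _ _] := stages t tT.
- by apply: filterS bell => w [_ [h _]] [x ub]; exact: h.
- by have [_ _ [_ ?] _ _] := stages t tT.
- by apply: filterS bell => w [_ [_ h]] x; exact: h.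
Qed.
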